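(* There exists a pair $(a^*,b^* )$ with $a^*<b^*$ such that $\Gamma(a^*,b^* )=\gamma(a^*,b^* )=0$.
   Context: $X$ is a spectrally negative Lévy process with Laplace exponent $\psi(s)=\log\mathbb E_0[e^{sX(1)}]=\gamma_X s+\frac{\sigma^2}{2}s^2+\int_{(-\infty,0)}(e^{sz}-1-sz1_{\{z>-1\}})\,\mu(dz)$, $s\ge0$, with $\gamma_X\in\mathbb R$, $\sigma\ge0$, $\int_{(-\infty,0)}(1\wedge z^2)\mu(dz)<\infty$. Assume $X$ is not the negative of a subordinator and that there is $\theta>0$ with $\int_{(-\infty,-1]}e^{\theta|y|}\mu(dy)<\infty$. Constants $q>0$, $\lambda>0$ and reals $K_c>K_p$ are fixed. $f:\mathbb R\to\mathbb R$ is convex, piecewise continuously differentiable, and of at most polynomial growth; $f'$ denotes the right-hand derivative where $f$ is not differentiable. Put $\tilde f(x)=f(x)+qK_cx+\lambda(K_c-K_p)x$. Assume $\bar a=\inf\{a:\tilde f'(a)\ge0\}$ and $\bar{\bar a}=\inf\{a:f'(a)+qK_p>0\}$ are both finite. For $p\ge0$, $\Phi(p)=\sup\{s\ge0:\psi(s)=p\}$; the scale function $W^{(p)}$ is $0$ on $(-\infty,0)$ and on $[0,\infty)$ is the continuous strictly increasing function with $\int_0^\infty e^{-sx}W^{(p)}(x)dx=1/(\psi(s)-p)$ for $s>\Phi(p)$. $\rho_a^{(p)}(x;h)=\int_a^xh(y)W^{(p)}(x-y)\,dy$. For $a<b$, $$\Gamma(a,b)=\int_0^\infty e^{-\Phi(q)y}\tilde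 f'(y+a)\,dy+\lambda\int_0^{b-a}e^{-\Phi(q)y}\rho_a^{(q+\lambda)}(y+a;\tilde f')\,dy+\frac{\lambda}{\Phi(q)}e^{-\Phi(q)(b-a)}(K_p-K_c),$$ $$\gamma(a,b)=-\rho_a^{(q+\lambda)}(b;\tilde f')+K_p-K_c.$$ *)

(* Defs.v *)
From HB Require Import structures.
From mathcomp Require Import all_boot all_order all_algebra.
From mathcomp Require Import all_classical all_reals all_analysis.

Set Implicit Arguments.
Unset Strict Implicit.
Unset Printing Implicit Defensive.

Import Order.TTheory GRing.Theory Num.Theory.
Import numFieldNormedType.Exports.

Local Open Scope classical_set_scope.
Local Open Scope ring_scope.

(* A process is a map X : R -> T -> R of which only the times t >= 0 matter. *)

Definition independent_increments (d : measure_display) (T : measurableType d)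
    (R : realType) (P : probability T R) (X : R -> T -> R) : Prop :=
  forall (n : nat) (t : nat -> R) (B : nat -> set (measurableTypeR R)),
    0 <= t 0%N -> (forall i, t i <= t i.+1) -> (forall i, measurable (B i)) ->
    P (\big[setI/setT]_(i < n) [set w | B i (X (t i.+1) w - X (t i) w)%R]) =
    (\prod_(i < n) P [set w | B i (X (t i.+1) w - X (t i) w)%R])%E.

Definition stationary_increments (d : measure_display) (T : measurableType d)
    (R : realType) (P : probability T R) (X : R -> T -> R) : Prop :=
  forall (s t : R) (B : set (measurableTypeR R)),
    0 <= s -> s <= t -> measurable B ->
    P [set w | B (X t w - X s w)%R] = P [set w | B (X (t - s)%R w)].

Definition cadlag (R : realType) (x : R -> R) : Prop :=
  (forall t, 0 <= t -> x s @[s --> t^'+] --> x t) /\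
  (forall t, 0 < t -> cvg (x s @[s --> t^'-])).

Definition levy_process (d : measure_display) (T : measurableType d)
    (R : realType) (P : probability T R) (X : R -> T -> R) : Prop :=
  [/\ forall t, 0 <= t -> measurable_fun [set: T] (X t),
      {ae P, forall w, X 0 w = 0},
      independent_increments P X,
      stationary_increments P X &
      {ae P, forall w, cadlag (X ^~ w)}].

Definition spectrally_negative (d : measure_display) (T : measurableType d)
    (R : realType) (P : probability T R) (X : R -> T -> R) : Prop :=
  levy_process P X /\
  {ae P, forall w, forall t, 0 < t -> X t w <= lim (X s w @[s --> t^'-])}.

Definition subordinator (d : measure_display) (T : measurableType d)
    (R : realType) (P : probability T R) (X : R -> T -> R) : Prop :=
  levy_process P X /\
  {ae P, forall w, forall s t, 0 <= s -> s <= t -> X s w <= X t w}.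

(* A Levy measure carried by the negative half-line is represented by a measure
   on R of which only the restriction to ]-oo, 0[ is ever used. *)
Definition levy_measure (R : realType)
    (mu : {measure set (measurableTypeR R) -> \bar R}) : Prop :=
  (\int[mu]_(z in `]-oo, 0%R[) (Num.min 1 (z ^+ 2))%:E < +oo)%E.

Definition levy_khintchine (R : realType) (gammaX sigma : R)
    (mu : {measure set (measurableTypeR R) -> \bar R}) (s : R) : R :=
  gammaX * s + sigma ^+ 2 / 2 * s ^+ 2 +
  \int[mu]_(z in `]-oo, 0[)
     (expR (s * z) - 1 - s * z * (if -1 < z then 1 else 0)).

(* psi s = log E[exp(s X(1))], stated in exponential form so that the finiteness
   of the expectation is part of the predicate. *)
Definition laplace_exponent (d : measure_display) (T : measurableType d)
    (R : realType) (P : probability T R) (X : R -> T -> R)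
    (psi : R -> R) : Prop :=
  forall s, 0 <= s -> ('E_P[(fun w => expR (s * X 1 w))%R] = (expR (psi s))%:E)%E.

Definition Phi (R : realType) (psi : R -> R) (p : R) : R :=
  sup [set s | 0 <= s /\ psi s = p].

Definition scale_function (R : realType) (psi : R -> R) (p : R)
    (W : R -> R) : Prop :=
  [/\ forall x, x < 0 -> W x = 0,
      {within `[0, +oo[, continuous W},
      {in `[0, +oo[ &, {homo W : x y / x < y}} &
      forall s, Phi psi p < s ->
        (\int[lebesgue_measure]_(x in `[0%R, +oo[) (expR (- (s * x)) * W x)%:E =
         ((psi s - p)^-1)%:E)%E].

(* C^1 off a locally finite set of break points, the derivative having finite
   one-sided limits at these points. *)
Definition piecewise_C1 (R : realType) (f : R -> R) : Prop :=
  continuous f /\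
  exists D : set R,
    [/\ forall a b, finite_set (D `&` `[a, b]),
        forall x, ~ D x ->
          derivable f x 1 /\ {for x, continuous (derive1 f)} &
        forall x, D x ->
          cvg (derive1 f y @[y --> x^'-]) /\
          cvg (derive1 f y @[y --> x^'+])].

Definition polynomial_growth (R : realType) (f : R -> R) : Prop :=
  exists (C : R) (N : nat), forall x, `|f x| <= C * (1 + `|x| ^+ N).

(* Right-hand derivative; it agrees with [derive1 f] wherever f is differentiable. *)
Definition rderiv (R : realType) (f : R -> R) (x : R) : R :=
  lim ((h^-1 * (f (x + h) - f x)) @[h --> 0^'+]).

Definition ftilde (R : realType) (q lambda Kc Kp : R) (f : R -> R) (x : R) : R :=
  f x + q * Kc * x + lambda * (Kc - Kp) * x.

Definition abar (R : realType) (q lambda Kc Kp : R) (f : R -> R) : \bar R :=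
  ereal_inf [set a%:E | a in [set a | 0 <= rderiv (ftilde q lambda Kc Kp f) a]].

Definition abarbar (R : realType) (q Kp : R) (f : R -> R) : \bar R :=
  ereal_inf [set a%:E | a in [set a | 0 < rderiv f a + q * Kp]].

Definition rho (R : realType) (W : R -> R) (a x : R) (h : R -> R) : R :=
  \int[lebesgue_measure]_(y in `[a, x]) (h y * W (x - y)).

(* In the next two definitions W is the (q + lambda)-scale function. *)
Definition Gamma_fun (R : realType) (psi W : R -> R) (q lambda Kc Kp : R)
    (f : R -> R) (a b : R) : R :=
  let ft' := rderiv (ftilde q lambda Kc Kp f) in
  \int[lebesgue_measure]_(y in `[0, +oo[) (expR (- (Phi psi q * y)) * ft' (y + a))
  + lambda * \int[lebesgue_measure]_(y in `[0, b - a])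
               (expR (- (Phi psi q * y)) * rho W a (y + a) ft')
  + lambda / Phi psi q * expR (- (Phi psi q * (b - a))) * (Kp - Kc).

Definition gamma_fun (R : realType) (W : R -> R) (q lambda Kc Kp : R)
    (f : R -> R) (a b : R) : R :=
  - rho W a b (rderiv (ftilde q lambda Kc Kp f)) + Kp - Kc.

(* Main.v *)
Require Import Defs.
From HB Require Import structures.
From mathcomp Require Import all_boot all_order all_algebra.
From mathcomp Require Import all_classical all_reals all_analysis.
From mathcomp Require Import measurable_realfun.
From mathcomp Require Import ring lra.
Import Order.TTheory GRing.Theory Num.Theory.
Import numFieldNormedType.Exports.
Local Open Scope classical_set_scope.
Local Open Scope ring_scope.

Set Implicit Arguments.
Unset Strict Implicit.
Unset Printing Implicit Defensive.

(** Write g for the right derivative of ftilde, r for q + lambda, delta for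
    Kc - Kp, and phi < Phi for the values of the function Phi at q and r.  The pair
    sought is a common zero of
      F1 a b = rho_a(b; g) + delta     (this is - gamma(a, b))
      F2 a b = exp (phi (b - a)) Gamma(a, b).
    The associativity of convolution [convA] turns the double integral in Gamma
    into a single one,
      F2 a b = exp (phi b) T_phi(a) + lambda rho_a(b; g, V) - lambda delta / phi,
    where T_s(a) is the integral of exp (- s z) g z over z >= a, V is the
    convolution of W with exp (phi x), and rho_a(b; g, V) is rho with V in place
    of W.  Since g is nondecreasing and W, V are nonnegative and nondecreasing, on
    the half-line where g a < 0, which is not empty since the threshold of ftilde is
    finite, F1 is increasing and F2 nondecreasing in a, and both are Lipschitz in a
    and continuous in b.  For each b there is exactly one alpha b < b on this
    half-line with F1 (alpha b) b = 0, and it remains to see that F2 (alpha b) b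
    changes sign as b varies [common_root].  It is negative when b is very negative,
    because T_phi(b) is negative then and bounds it up to a positive factor.

    For the other sign, let a1 be the zero of T_Phi, where g is negative, and put
    M x = F2 a1 (a1 + x).  It is enough to find x > 0 with F1 a1 (a1 + x) <= 0 <= M x
    [value_function_crossing], since the monotonicity in a then gives
    F2 (alpha b) b >= 0 at b = a1 + x.  The derivative of exp (- phi x) M x is
    lambda exp (- phi x) F1 a1 (a1 + x).  So, if there were no such x, then M would
    be nonpositive everywhere, or would eventually exceed a positive multiple of
    exp (phi x).  For t > Phi the Laplace transform of M is
      (G phi + lambda G t / (psi t - r)) / (t - phi) - lambda delta / (phi t),
    where G is the Laplace transform of g (a1 + x).  The choice of a1 means
    G Phi = 0, which removes the pole at Phi, and the pole at phi is removable
    because psi phi - r = - lambda.  Hence this expression is analytic at all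
    t > 0, and is a power series in t0 - t with radius t0, for t0 = Phi + 1
    [transform_series].  By Pringsheim's theorem for Laplace transforms of functions
    of constant sign [laplace_pringsheim], it remains equal to the transform of M
    for all t in (0, t0) in both alternatives, a constant being added to M in the
    second one.  The second one is absurd, since the transform would be infinite at
    phi [value_function_not_exp].  In the first one the transform would be
    nonpositive; but t times it becomes positive as t tends to 0, since g exceeds r delta far to the right, which is what the finiteness
    of the threshold of f' + q Kp means [value_function_pos].

    The power series are available because psi (t0 - h) has nonnegative
    coefficients from order 2 on [levy_khintchine_pseries].  Dividing psi - r by
    t - Phi lowers the orders by one and keeps these signs [pseries_on_div], and a
    positive series whose coefficients after the first are nonpositive has a
    reciprocal with the same radius [pseries_on_inv].  The hypothesis that X
    is not the negative of a subordinator gives that psi is unbounded, so that Phi is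
    a right inverse of psi [levy_nonpos_subordinator, Phi_spec]. *)

(** * Absolutely convergent power series *)

(** The bound on the sums of absolute values is what products of series need.  Only
    nonnegative arguments occur, because the series are expansions of Laplace
    transforms in the direction of decreasing arguments. *)
Definition pseries_on {R : realType} (r : R) (a : nat -> R) (F : R -> R) :=
  forall h : R, 0 <= h < r ->
    (exists C : R, forall n, \sum_(k < n) `|a k| * h ^+ k <= C) /\
    (fun n => \sum_(k < n) a k * h ^+ k) @ \oo --> F h.

Lemma sumr_bounded_cvg (R : realType) (u : nat -> R) (C : R) :
  (forall n, \sum_(k < n) `|u k| <= C) -> cvgn (fun n => \sum_(k < n) u k).
Proof.
move=> uC; have -> : (fun n => \sum_(k < n) u k) = series u.
  by apply/funext => n; rewrite seriesEord.
apply: normed_cvg; apply: nondecreasing_is_cvgn.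
  by apply: nondecreasing_series => k _ _; exact: normr_ge0.
by exists C => _ [n _ <-]; rewrite /= /normed_series_of /series/= big_mkord; exact: uC.
Qed.

Lemma pseries_onD (R : realType) (r : R) a b (F G : R -> R) :
  pseries_on r a F -> pseries_on r b G ->
  pseries_on r (fun k => a k + b k) (fun h => F h + G h).
Proof.
move=> aF bG h hr; have [[A hA] sa] := aF h hr; have [[B hB] sb] := bG h hr.
have h0 : 0 <= h by case/andP: hr.
split.
  exists (A + B) => n; apply: le_trans (lerD (hA n) (hB n)).
  rewrite -big_split/=; apply: ler_sum => k _.
  by rewrite -mulrDl ler_wpM2r ?exprn_ge0// ler_normD.
rewrite (_ : (fun n => _) = (fun n => \sum_(k < n) a k * h ^+ k +
                        \sum_(k < n) b k * h ^+ k)); first exact: cvgD.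
by apply/funext => n /=; rewrite -big_split/=; apply: eq_bigr => k _; rewrite mulrDl.
Qed.

Lemma pseries_onZ (R : realType) (r c : R) a (F : R -> R) :
  pseries_on r a F ->
  pseries_on r (fun k => c * a k) (fun h => c * F h).
Proof.
move=> aF h hr; have [[A hA] sa] := aF h hr; split.
  exists (`|c| * A) => n; apply: le_trans (ler_wpM2l _ (hA n)) => //.
  by rewrite mulr_sumr; apply: ler_sum => k _; rewrite normrM mulrA.
rewrite (_ : (fun n => _) = (fun n => c * \sum_(k < n) a k * h ^+ k)).
  by apply: cvgMl_tmp.
by apply/funext => n; rewrite mulr_sumr; apply: eq_bigr => k _; rewrite mulrA.
Qed.

Lemma geometric_sum_le (R : realType) (q : R) (n : nat) : 0 <= q < 1 ->
  \sum_(k < n) q ^+ k <= (1 - q)^-1.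
Proof.
move=> /andP[q0 q1]; have := subrX1 q n.
have : 0 < 1 - q by lra.
have := exprn_ge0 n q0; move: (q ^+ n) (\sum_(k < n) q ^+ k) => x s x0 p E.
rewrite -(ler_pM2l p) divff ?gt_eqF//; nra.
Qed.

Lemma pseries_on_geometric (R : realType) (t : R) : 0 < t ->
  pseries_on t (fun k => t^-1 ^+ k.+1) (fun h => (t - h)^-1).
Proof.
move=> t0 h /andP[h0 ht].
have q0 : 0 <= h / t by rewrite divr_ge0// ltW.
have q1 : h / t < 1 by rewrite ltr_pdivrMr// mul1r.
have E k : t^-1 ^+ k.+1 * h ^+ k = t^-1 * (h / t) ^+ k.
  by rewrite exprS -mulrA -exprMn [_ * h]mulrC.
split.
  exists (t^-1 * (1 - h / t)^-1) => n.
  rewrite (eq_bigr (fun k : 'I_n => t^-1 * (h / t) ^+ k)); last first.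
    by move=> k _; rewrite ger0_norm ?E// exprn_ge0// invr_ge0 ltW.
  by rewrite -mulr_sumr ler_wpM2l ?invr_ge0 ?(ltW t0)// geometric_sum_le// q0.
rewrite (_ : (fun n => _) = series (geometric t^-1 (h / t))); last first.
  by apply/funext => n; rewrite seriesEord; apply: eq_bigr => k _; rewrite E.
have <- : t^-1 * (1 - h / t)^-1 = (t - h)^-1.
  by rewrite -invfM mulrBr mulr1 mulrCA divff ?mulr1// gt_eqF.
by apply: cvg_geometric_series; rewrite ger0_norm.
Qed.

Lemma pseries_on_eq (R : realType) (r : R) a (F G : R -> R) :
  (forall h : R, 0 <= h < r -> F h = G h) -> pseries_on r a F -> pseries_on r a G.
Proof.
by move=> FG aF h hr; have [ca sa] := aF h hr; split; rewrite -?FG.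
Qed.

Lemma pseries_on_le (R : realType) (r s : R) a (F : R -> R) :
  s <= r -> pseries_on r a F -> pseries_on s a F.
Proof.
by move=> sr aF h /andP[h0 hs]; apply: aF; rewrite h0 (lt_le_trans hs).
Qed.

(** The value of [F] at 0 is left free, so that the lemma still applies after the
    coefficients have been shifted. *)
Lemma pseries_on_coef0 (R : realType) (r : R) a F : 0 < r ->
  pseries_on r a F -> (forall h : R, 0 < h < r -> F h = 0) -> a 0%N = 0.
Proof.
move=> r0 aF F0.
pose s := r / 2.
have s0 : 0 < s by rewrite divr_gt0.
have sr : s < r by rewrite /s; lra.
have s0r : 0 <= s < r by rewrite ltW.
have [[C hC] _] := aF s s0r.
have key h : 0 < h <= s -> `|a 0%N| <= h * (C / s).
  move=> /andP[h0 hs].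
  have h0r : 0 <= h < r by rewrite (ltW h0) (le_lt_trans hs sr).
  have [_ ch] := aF h h0r.
  have : (fun n => \sum_(k < n.+1) a k * h ^+ k) @ \oo --> F h.
    by rewrite (cvg_shiftS (fun n => \sum_(k < n) a k * h ^+ k)).
  rewrite F0 ?h0 ?(le_lt_trans hs)// => /cvg_norm; rewrite normr0 => c0.
  rewrite -subr_le0; apply: (cvgr_to_ge c0); apply: nearW => n.
  rewrite big_ord_recl expr0 mulr1.
  apply: le_trans (lerB_normD _ _); rewrite lerB//.
  apply: (le_trans (ler_norm_sum _ _ _)).
  rewrite mulrCA [C * _]mulrC; apply: (@le_trans _ _ (h / s * \sum_(k < n.+1) `|a k| * s ^+ k)).
    rewrite big_ord_recl mulrDr -[leLHS]add0r lerD//.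
      by rewrite !mulr_ge0 ?invr_ge0 ?expr0// ltW.
    rewrite mulr_sumr; apply: ler_sum => k _.
    rewrite normrM (ger0_norm (exprn_ge0 _ (ltW h0))) lift0 mulrCA ler_wpM2l//.
    rewrite !exprS mulrA divfK ?gt_eqF// ler_pM2l// lerXn2r// ?nnegrE ltW//.
  by apply: ler_wpM2l; [rewrite divr_ge0 ?ltW|exact: hC].
apply/eqP; rewrite -normr_eq0 eq_le normr_ge0 andbT.
apply/ler_addgt0Pl => e e0; rewrite addr0.
have C0 : 0 <= C by have := hC 0%N; rewrite big_ord0.
pose h := Num.min s (e / (C / s + 1)).
have d0 : 0 < C / s + 1 by rewrite ltr_wpDl// divr_ge0// ltW.
have h0 : 0 < h by rewrite lt_min s0 divr_gt0.
have hs : h <= s by rewrite ge_min lexx.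
apply: le_trans (key h _) _; first by rewrite h0.
apply: (@le_trans _ _ (e / (C / s + 1) * (C / s + 1))); last by rewrite divfK ?gt_eqF.
apply: ler_pM; rewrite ?lerDl ?divr_ge0 ?(ltW s0) ?(ltW h0)//.
  exact: ltW.
by rewrite /h ge_min lexx orbT.
Qed.

Lemma pseries_on_shift (R : realType) (r : R) a F :
  pseries_on r a F -> (forall h : R, 0 < h < r -> F h = 0) -> a 0%N = 0 ->
  exists2 G, pseries_on r (fun k => a k.+1) G & forall h : R, 0 < h < r -> G h = 0.
Proof.
move=> aF F0 a0; exists (fun h => if h == 0 then a 1%N else 0); last first.
  by move=> h /andP[h0 _]; rewrite gt_eqF.
move=> h /andP[h0]; have [->|hn0] := eqVneq h 0 => hr.
  split.
    exists `|a 1%N| => -[|n]; first by rewrite big_ord0.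
    rewrite big_ord_recl expr0 mulr1 big1 ?addr0// => k _.
    by rewrite expr0n/= mulr0.
  rewrite -(cvg_shiftS (fun n => \sum_(k < n) a k.+1 * 0 ^+ k)).
  apply: cvg_near_cst; apply: nearW => n /=.
  rewrite big_ord_recl expr0 mulr1 big1 ?addr0// => k _.
  by rewrite expr0n/= mulr0.
have {}h0 : 0 < h by rewrite lt_def hn0.
have [[C hC] ch] := aF h (introT andP (conj (ltW h0) hr)).
split.
  exists (C / h) => n; rewrite ler_pdivlMr//; apply: le_trans (hC n.+1).
  rewrite big_ord_recl a0 normr0 mul0r add0r mulr_suml; apply: ler_sum => k _.
  by rewrite lift0 exprSr mulrA.
have : (fun n => h^-1 * \sum_(k < n.+1) a k * h ^+ k) @ \oo --> h^-1 * F h.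
  apply: cvgMl_tmp.
  by rewrite (cvg_shiftS (fun n => \sum_(k < n) a k * h ^+ k)).
rewrite F0 ?h0// mulr0; apply: cvg_trans; apply: near_eq_cvg; apply: nearW => n.
rewrite big_ord_recl a0 mul0r add0r mulr_sumr; apply: eq_bigr => k _.
by rewrite lift0 mulrCA exprS mulKf// gt_eqF.
Qed.

Lemma pseries_on_eq0 (R : realType) (r : R) a F : 0 < r ->
  pseries_on r a F -> (forall h : R, 0 < h < r -> F h = 0) -> forall k, a k = 0.
Proof.
move=> r0 aF F0 k; elim: k a F F0 aF => [|k IH] c G G0 cG.
  exact: (pseries_on_coef0 r0 cG).
have c0 := pseries_on_coef0 r0 cG G0.
have [G' cG' G'0] := pseries_on_shift cG G0 c0.
exact: (IH (fun k => c k.+1) G').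
Qed.

Lemma pseries_on_uniq (R : realType) (r : R) a b F : 0 < r ->
  pseries_on r a F -> pseries_on r b F -> a = b.
Proof.
move=> r0 aF bF; apply/funext => k.
apply/eqP; rewrite -subr_eq0 -mulN1r; apply/eqP.
apply: (pseries_on_eq0 r0 (pseries_onD aF (pseries_onZ (-1) bF))).
by move=> h _; rewrite mulN1r subrr.
Qed.

Lemma sum_conv_triangle (R : realType) (u v : nat -> R) (N : nat) :
  \sum_(n < N) \sum_(i < n.+1) u i * v (n - i)%N =
  \sum_(i < N) u i * \sum_(j < N - i) v j.
Proof.
elim: N => [|N IH]; first by rewrite !big_ord0.
rewrite big_ord_recr IH/= [RHS]big_ord_recr/= subSnn big_ord1.
rewrite big_ord_recr/= subnn addrA -big_split/=; congr (_ + _).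
apply: eq_bigr => i _; rewrite -mulrDr (subSn (ltnW (ltn_ord i))).
by rewrite big_ord_recr.
Qed.

Lemma sum_conv_le (R : realType) (u v : nat -> R) (N : nat) :
  (forall k, 0 <= u k) -> (forall k, 0 <= v k) ->
  \sum_(n < N) \sum_(i < n.+1) u i * v (n - i)%N <=
  (\sum_(i < N) u i) * \sum_(j < N) v j.
Proof.
move=> u0 v0; rewrite sum_conv_triangle mulr_suml; apply: ler_sum => i _.
rewrite ler_wpM2l// [leRHS](bigID (fun j : 'I_N => (j < N - i)%N))/=.
rewrite (big_ord_widen_cond N xpredT v) ?leq_subr//= lerDl.
by apply: sumr_ge0.
Qed.

(** The Cauchy product of two absolutely convergent series.  For nonnegative terms
    the triangular partial sums lie between the products of partial sums of half
    the order and of the same order. *)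
Lemma sum_conv_cvg (R : realType) (u v : nat -> R) (U V : R) (C D : R) :
  (forall n, \sum_(k < n) `|u k| <= C) -> (forall n, \sum_(k < n) `|v k| <= D) ->
  (fun n => \sum_(k < n) u k) @ \oo --> U -> (fun n => \sum_(k < n) v k) @ \oo --> V ->
  (fun N => \sum_(n < N) \sum_(i < n.+1) u i * v (n - i)%N) @ \oo --> U * V.
Proof.
move=> uC vD uU vV.
have C0 : 0 <= C by have := uC 0%N; rewrite big_ord0.
have D0 : 0 <= D by have := vD 0%N; rewrite big_ord0.
have cabs : cvgn (fun n => \sum_(k < n) `|u k|).
  by apply: (@sumr_bounded_cvg R (fun k => `|u k|) C) => n; under eq_bigr do rewrite normr_id.
have cabs' : cvgn (fun n => \sum_(k < n) `|v k|).
  by apply: (@sumr_bounded_cvg R (fun k => `|v k|) D) => n; under eq_bigr do rewrite normr_id.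
pose X := limn (fun n => \sum_(k < n) `|u k|) * limn (fun n => \sum_(k < n) `|v k|).
have UVabs : (fun n => (\sum_(k < n) `|u k|) * (\sum_(k < n) `|v k|)) @ \oo --> X.
  exact: cvgM cabs cabs'.
pose P N := \sum_(n < N) \sum_(i < n.+1) `|u i| * `|v (n - i)%N|.
have PP N : P N <= (\sum_(i < N) `|u i|) * \sum_(j < N) `|v j|.
  by apply: (@sum_conv_le _ (fun i => `|u i|) (fun i => `|v i|)) => k.
have ndP : nondecreasing_seq P.
  apply/nondecreasing_seqP => n; rewrite /P big_ord_recr/= lerDl.
  by apply: sumr_ge0 => i _; rewrite mulr_ge0.
have cP : cvgn P.
  apply: nondecreasing_is_cvgn => //; exists (C * D) => _ [N _ <-].
  by apply: le_trans (PP N) _; apply: ler_pM; rewrite ?sumr_ge0.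
have limP : limn P = X.
  apply/eqP; rewrite eq_le; apply/andP; split.
    by apply: (ler_cvg_to cP UVabs); apply: nearW => N; exact: PP.
  apply: (cvgr_to_le UVabs); apply: nearW => N.
  apply: le_trans (nondecreasing_cvgn_le ndP cP (N + N)%N).
  rewrite /P (sum_conv_triangle (fun i => `|u i|) (fun i => `|v i|)) /= mulr_suml.
  rewrite big_split_ord/= -[leLHS]addr0 lerD//; last first.
    by apply: sumr_ge0 => i _; rewrite mulr_ge0// sumr_ge0.
  apply: ler_sum => i _; rewrite ler_wpM2l//.
  have NN : (N <= N + N - i)%N by rewrite -addnBA ?leq_addr// ltnW.
  rewrite [leRHS](bigID (fun j : 'I__ => (j < N)%N))/=.
  rewrite (big_ord_widen_cond _ xpredT (fun j => `|v j|) NN)/= lerDl.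
  by apply: sumr_ge0.
(* the product of the partial sums and the partial sum of the product differ
   by at most the same quantity for the absolute values *)
suff H : (fun N => (\sum_(i < N) u i) * (\sum_(j < N) v j) -
     \sum_(n < N) \sum_(i < n.+1) u i * v (n - i)%N) @ \oo --> (0 : R).
  pose UVN N := (\sum_(i < N) u i) * (\sum_(j < N) v j).
  have H' : (fun N => UVN N - (UVN N - \sum_(n < N) \sum_(i < n.+1) u i * v (n - i)%N)) @ \oo --> U * V - 0.
    exact: cvgB (cvgM uU vV) H.
  rewrite subr0 in H'; apply: cvg_trans H'.
  by apply: near_eq_cvg; apply: nearW => n /=; rewrite opprB addrC subrK.
have tails (a b : nat -> R) N : (\sum_(i < N) a i) * (\sum_(j < N) b j) -
     \sum_(n < N) \sum_(i < n.+1) a i * b (n - i)%N =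
     \sum_(i < N) a i * \sum_(j < N | ~~ (j < N - i)%N) b j.
  rewrite sum_conv_triangle mulr_suml -sumrB; apply: eq_bigr => i _.
  rewrite -mulrBr; congr (_ * _).
  rewrite (@big_ord_widen_cond _ _ _ (N - i) N xpredT b) ?leq_subr//=.
  by rewrite [X in X - _](bigID (fun j : 'I_N => (j < N - i)%N))/= addrAC subrr add0r.
apply/norm_cvg0P.
have L0 : (fun N => (\sum_(i < N) `|u i|) * (\sum_(j < N) `|v j|) - P N) @ \oo --> X - limn P.
  exact: cvgB UVabs cP.
rewrite limP subrr in L0.
apply: (squeeze_cvgr _ (cvg_cst 0) L0); apply: nearW => N; rewrite normr_ge0/=.
rewrite tails /P (tails (fun i => `|u i|) (fun i => `|v i|)).
apply: (le_trans (ler_norm_sum _ _ _)); apply: ler_sum => i _.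
by rewrite normrM ler_wpM2l// ler_norm_sum.
Qed.

Lemma pseries_onM (R : realType) (r : R) a b (F G : R -> R) :
  pseries_on r a F -> pseries_on r b G ->
  pseries_on r (fun n => \sum_(i < n.+1) a i * b (n - i)%N) (fun h => F h * G h).
Proof.
move=> aF bG h hr; have [[A hA] sa] := aF h hr; have [[B hB] sb] := bG h hr.
have h0 : 0 <= h by case/andP: hr.
have E (u v : nat -> R) n : (\sum_(i < n.+1) u i * v (n - i)%N) * h ^+ n =
    \sum_(i < n.+1) (u i * h ^+ i) * (v (n - i)%N * h ^+ (n - i)).
  rewrite mulr_suml; apply: eq_bigr => i _; rewrite mulrACA -exprD subnKC//.
  by rewrite -ltnS.
have nE (u : nat -> R) n : \sum_(k < n) `|u k * h ^+ k| = \sum_(k < n) `|u k| * h ^+ k.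
  by apply: eq_bigr => k _; rewrite normrM (ger0_norm (exprn_ge0 _ h0)).
split; last first.
  under eq_fun do under eq_bigr do rewrite E.
  by apply: (@sum_conv_cvg _ (fun k => a k * h ^+ k) (fun k => b k * h ^+ k) _ _ A B) => // n; rewrite nE.
exists (A * B) => n.
apply: (@le_trans _ _ (\sum_(k < n) \sum_(i < k.+1) (`|a i| * h ^+ i) * (`|b (k - i)%N| * h ^+ (k - i)))).
  apply: ler_sum => k _; rewrite -(E (fun i => `|a i|) (fun i => `|b i|)) ler_wpM2r ?exprn_ge0//.
  by apply: (le_trans (ler_norm_sum _ _ _)); apply: ler_sum => i _; rewrite normrM.
apply: (le_trans (@sum_conv_le _ (fun i => `|a i| * h ^+ i) (fun i => `|b i| * h ^+ i) _ _ _)).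
- by move=> k; rewrite mulr_ge0// exprn_ge0.
- by move=> k; rewrite mulr_ge0// exprn_ge0.
by apply: ler_pM; rewrite ?sumr_ge0// => k _; rewrite mulr_ge0// exprn_ge0.
Qed.

(** The quotient of [F] by [h - h0] is again a power series as soon as [F]
    vanishes at [h0]: its coefficients are the tails of the series at [h0], and
    a tail of order k is at most of size (h0 / h)^k for every h in (h0, r). *)
Lemma pseries_on_div (R : realType) (r h0 : R) a F : 0 < h0 < r ->
  pseries_on r a F -> F h0 = 0 ->
  exists2 b, exists2 G, pseries_on r b G &
      forall h : R, 0 <= h < r -> (h - h0) * G h = F h &
    (forall k, (0 < k)%N -> 0 <= a k.+1) -> forall k, (0 < k)%N -> 0 <= b k.
Proof.
move=> /andP[h00 h0r] aF F0.
pose b k := - (\sum_(j < k.+1) a j * h0 ^+ j) / h0 ^+ k.+1.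
have [[C0 hC0] c0] := aF h0 (introT andP (conj (ltW h00) h0r)).
rewrite F0 in c0.
have tail k : (fun M => \sum_(j < M) a (k.+1 + j)%N * h0 ^+ (k.+1 + j)) @ \oo -->
    - (\sum_(j < k.+1) a j * h0 ^+ j).
  have H : (fun M => \sum_(j < M + k.+1) a j * h0 ^+ j - \sum_(j < k.+1) a j * h0 ^+ j)
      @ \oo --> 0 - \sum_(j < k.+1) a j * h0 ^+ j.
    apply: cvgB; last exact: cvg_cst.
    by rewrite (cvg_shiftn k.+1 (fun M => \sum_(j < M) a j * h0 ^+ j)).
  rewrite sub0r in H; apply: cvg_trans H.
  apply: near_eq_cvg; apply: nearW => M /=.
  by rewrite addnC big_split_ord/= addrAC subrr add0r.
have bound h : h0 < h < r -> exists C, forall k, `|b k| * h ^+ k.+1 <= C.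
  move=> /andP[h0h hr]; have hp : 0 < h by exact: lt_trans h0h.
  have [[C hC] _] := aF h (introT andP (conj (ltW hp) hr)).
  exists C => k; rewrite /b normrM normfV (ger0_norm (exprn_ge0 _ (ltW h00))).
  rewrite mulrAC ler_pdivrMr ?exprn_gt0// -ler_pdivlMr ?exprn_gt0//.
  have := cvg_norm (tail k) => /(_ _ ) ct.
  apply: (cvgr_to_le ct); apply: nearW => M.
  rewrite ler_pdivlMr ?exprn_gt0//.
  apply: le_trans (ler_wpM2r (exprn_ge0 _ (ltW h00)) (hC (k.+1 + M)%N)).
  rewrite big_split_ord/= mulrDl -[leLHS]add0r lerD//.
    apply: mulr_ge0; last by rewrite exprn_ge0// ltW.
    by apply: sumr_ge0 => j _; rewrite mulr_ge0// exprn_ge0//; exact: ltW.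
  apply: (@le_trans _ _ ((\sum_(j < M) `|a (k.+1 + j)%N * h0 ^+ (k.+1 + j)|) * h ^+ k.+1)).
    by rewrite ler_wpM2r ?exprn_ge0 ?ler_norm_sum// ltW.
  rewrite !mulr_suml; apply: ler_sum => j _.
  rewrite normrM (ger0_norm (exprn_ge0 _ (ltW h00))) -!mulrA ler_wpM2l//.
  rewrite !exprD -mulrA [leRHS]mulrC ler_wpM2l ?exprn_ge0 ?(ltW h00)//.
  rewrite [leRHS]mulrC ler_wpM2r ?exprn_ge0 ?(ltW hp)//.
  by apply: lerXn2r; rewrite ?nnegrE; exact: ltW.
have sb h : 0 <= h < r -> exists C : R, forall n, \sum_(k < n) `|b k| * h ^+ k <= C.
  move=> /andP[hh0 hr].
  pose s := (Num.max h h0 + r) / 2.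
  have [hs h0s sr] : [/\ h < s, h0 < s & s < r].
    have : Num.max h h0 < r by rewrite gt_max hr.
    have : h <= Num.max h h0 by rewrite le_max lexx.
    have : h0 <= Num.max h h0 by rewrite le_max lexx orbT.
    by rewrite /s; move: (Num.max h h0) => m *; split; lra.
  have sp : 0 < s by exact: lt_trans h0s.
  have [C hC] := bound s (introT andP (conj h0s sr)).
  have Cp : 0 <= C by apply: le_trans (hC 0%N); rewrite mulr_ge0// exprn_ge0// ltW.
  exists (C / s * (1 - h / s)^-1) => n.
  have q01 : 0 <= h / s < 1 by rewrite divr_ge0 ?(ltW sp)//= ltr_pdivrMr// mul1r.
  apply: le_trans (ler_wpM2l _ (geometric_sum_le n q01)); last by rewrite divr_ge0// ltW.
  rewrite mulr_sumr; apply: ler_sum => k _.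
  rewrite expr_div_n mulrACA mulrC [C * _]mulrC -mulrA ler_wpM2l ?exprn_ge0//.
  by rewrite -invfM -exprS ler_pdivlMr ?exprn_gt0.
have sG h : 0 <= h < r -> cvgn (fun n => \sum_(k < n) b k * h ^+ k).
  move=> hr; have [C hC] := sb h hr; have hp : 0 <= h by case/andP: hr.
  apply: (@sumr_bounded_cvg _ (fun k => b k * h ^+ k) C) => n.
  apply: le_trans (hC n); apply: ler_sum => k _.
  by rewrite normrM (ger0_norm (exprn_ge0 _ hp)).
exists b; last first.
  move=> a0 k k0; rewrite /b divr_ge0 ?exprn_ge0 ?(ltW h00)//.
  apply: (cvgr_to_ge (tail k)); apply: nearW => M.
  apply: sumr_ge0 => j _; rewrite mulr_ge0 ?exprn_ge0 ?(ltW h00)// addSn a0//.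
  by rewrite ltn_addr.
exists (fun h => limn (fun n => \sum_(k < n) b k * h ^+ k)).
  by move=> h hr; split; [exact: sb|exact: sG].
move=> h hr; have [_ cF] := aF h hr.
have rec n : \sum_(k < n) a k * h ^+ k =
    (h - h0) * (\sum_(k < n) b k * h ^+ k) - (if n is m.+1 then b m * h ^+ m.+1 else 0).
  have b0 : h0 * b 0%N = - a 0%N.
    by rewrite /b big_ord1 expr0 mulr1 expr1 mulrC divfK// gt_eqF.
  have bS k : h0 * b k.+1 = b k - a k.+1.
    rewrite /b big_ord_recr/= [h0 ^+ k.+2]exprS.
    have hn0 : h0 != 0 by rewrite gt_eqF.
    have := expf_neq0 k.+1 hn0; move: (h0 ^+ k.+1) (\sum_(_ < _) _) => x S x0.
    by field; rewrite x0.
  elim: n => [|n IH]; first by rewrite !big_ord0 mulr0 subr0.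
  rewrite big_ord_recr IH [in RHS]big_ord_recr/=.
  case: n {IH} => [|n]; first by rewrite big_ord0 !expr0 expr1; lra.
  have := bS n; rewrite [h ^+ n.+2]exprS; move: (h ^+ n.+1) => x E.
  rewrite (_ : b n = h0 * b n.+1 + a n.+1); last by rewrite E subrK.
  by ring.
have bh0 : (fun n => b n * h ^+ n) @ \oo --> (0 : R).
  rewrite (_ : (fun n => _) = (fun n => series (fun k => b k * h ^+ k) n.+1 -
     series (fun k => b k * h ^+ k) n)); last first.
    by apply/funext => n; rewrite !seriesEord/= big_ord_recr/= addrAC subrr add0r.
  have cs : cvgn (series (fun k => b k * h ^+ k)).
    rewrite (_ : series _ = (fun n => \sum_(k < n) b k * h ^+ k)); first exact: sG.
    by apply/funext => n; rewrite seriesEord.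
  rewrite -(subrr (limn (series (fun k => b k * h ^+ k)))).
  by apply: cvgB; [rewrite (cvg_shiftS (series _))|].
have cF' : (fun n => \sum_(k < n.+1) a k * h ^+ k) @ \oo --> F h.
  by rewrite (cvg_shiftS (fun n => \sum_(k < n) a k * h ^+ k)).
have H : (fun n => (h - h0) * (\sum_(k < n.+1) b k * h ^+ k) - h * (b n * h ^+ n)) @ \oo -->
   (h - h0) * (limn (fun n => \sum_(k < n) b k * h ^+ k)) - h * 0.
  apply: cvgB; apply: cvgMl_tmp => //.
  by rewrite (cvg_shiftS (fun n => \sum_(k < n) b k * h ^+ k)); exact: sG.
rewrite mulr0 subr0 in H; apply: (cvg_unique _ _ cF') => //; apply: cvg_trans H.
by apply: near_eq_cvg; apply: nearW => n; rewrite rec exprS mulrCA.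
Qed.

(** The coefficients of the formal reciprocal satisfy a course-of-values recursion,
    for which all the previous ones are kept in a sequence. *)
Fixpoint recip_coef_seq (R : realType) (a : nat -> R) (n : nat) : seq R :=
  if n is m.+1 then
    rcons (recip_coef_seq a m)
      (((m == 0)%:R - \sum_(i < m) a (m - i)%N * (recip_coef_seq a m)`_i) / a 0%N)
  else [::].

Definition recip_coef (R : realType) (a : nat -> R) (n : nat) : R :=
  (recip_coef_seq a n.+1)`_n.

Lemma size_recip_coef_seq (R : realType) (a : nat -> R) n :
  size (recip_coef_seq a n) = n.
Proof. by elim: n => //= n IH; rewrite size_rcons IH. Qed.

Lemma nth_recip_coef_seq (R : realType) (a : nat -> R) n i : (i < n)%N ->
  (recip_coef_seq a n)`_i = recip_coef a i.
Proof.
elim: n => // n IH; rewrite ltnS leq_eqVlt => /predU1P[->//|i_n].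
by rewrite /= nth_rcons size_recip_coef_seq i_n IH.
Qed.

Lemma recip_coefE (R : realType) (a : nat -> R) n :
  recip_coef a n = ((n == 0)%:R - \sum_(i < n) a (n - i)%N * recip_coef a i) / a 0%N.
Proof.
rewrite {1}/recip_coef/= nth_rcons size_recip_coef_seq ltnn eqxx.
by congr ((_ - _) / _); apply: eq_bigr => i _; rewrite nth_recip_coef_seq.
Qed.

Lemma recip_coef_ge0 (R : realType) (a : nat -> R) n : 0 < a 0%N ->
  (forall k, a k.+1 <= 0) -> 0 <= recip_coef a n.
Proof.
move=> a0 aS; have [m] := ubnP n; elim: m n => // m IH n; rewrite ltnS => nm.
rewrite recip_coefE divr_ge0 ?(ltW a0)// subr_ge0 (@le_trans _ _ 0)//.
apply: sumr_le0 => i _; rewrite mulr_le0_ge0//; last by rewrite IH// (leq_trans (ltn_ord i)).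
by rewrite -(subnSK (ltn_ord i)).
Qed.

(** With [F = a_0 - C], the coefficients of the reciprocal are nonnegative and their
    partial sums [s] satisfy [a_0 s <= 1 + C s], so they are bounded by [1 / F]: the
    radius is not reduced as long as [F] has no zero. *)
Lemma pseries_on_inv (R : realType) (r : R) a F :
  pseries_on r a F -> 0 < a 0%N -> (forall k, a k.+1 <= 0) ->
  (forall h : R, 0 <= h < r -> 0 < F h) ->
  exists b, pseries_on r b (fun h => (F h)^-1).
Proof.
move=> aF a0 aS Fp; exists (recip_coef a).
set u := recip_coef a.
have u0 n : 0 <= u n by exact: recip_coef_ge0.
have conv n : \sum_(i < n.+1) u i * a (n - i)%N = (n == 0)%:R.
  rewrite big_ord_recr/= subnn [u n]recip_coefE divfK//; last exact: lt0r_neq0.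
  by rewrite addrCA (eq_bigr _ (fun i _ => mulrC _ _)) subrr addr0.
suff G : pseries_on r u (fun h => limn (fun n => \sum_(k < n) u k * h ^+ k)).
  apply: (pseries_on_eq _ G); move=> h hr.
  have [_ FG] := pseries_onM G aF hr.
  have : limn (fun n => \sum_(k < n) u k * h ^+ k) * F h = 1.
    apply: (cvg_unique _ FG) => //; apply: cvg_near_cst.
    exists 1%N => // -[//|n] _ /=; rewrite big_ord_recl conv expr0 mulr1.
    by rewrite big1 ?addr0// => k _; rewrite conv lift0 mul0r.
  by move/(congr1 (fun x => x / F h)); rewrite mulfK ?div1r// gt_eqF// Fp.
move=> h hr; have h0 : 0 <= h by case/andP: hr.
have uh n : 0 <= u n * h ^+ n by rewrite mulr_ge0 ?exprn_ge0.
suff bnd n : \sum_(k < n) `|u k| * h ^+ k <= (F h)^-1.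
  split; first by exists (F h)^-1.
  apply: (@sumr_bounded_cvg _ (fun k => u k * h ^+ k) (F h)^-1) => n.
  apply: le_trans (bnd n); apply: ler_sum => k _.
  by rewrite normrM (ger0_norm (exprn_ge0 _ h0)).
have -> : \sum_(k < n) `|u k| * h ^+ k = \sum_(k < n) u k * h ^+ k.
  by apply: eq_bigr => k _; rewrite ger0_norm.
rewrite -[leRHS]mul1r ler_pdivlMr ?Fp//; have [_ cF] := aF h hr.
case: n => [|n]; first by rewrite big_ord0 mul0r.
pose c k := if k is j.+1 then - a k * h ^+ k else 0.
have c0 k : 0 <= c k by case: k => //= k; rewrite mulr_ge0 ?exprn_ge0// oppr_ge0.
have cF' : \sum_(k < n.+1) c k <= a 0%N - F h.
  rewrite lerBrDr -lerBrDl; apply: (cvgr_to_le cF).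
  exists n.+1 => // M /= nM; rewrite -(subnKC nM) big_split_ord/= -[leRHS]addr0 lerD//.
    rewrite !big_ord_recl expr0 mulr1 add0r lerD2l// -sumrN.
    by apply: ler_sum => k _; rewrite lift0 /c mulNr opprK.
  by apply: sumr_le0 => k _; rewrite addSn mulr_le0_ge0// exprn_ge0.
have E : a 0%N * (\sum_(k < n.+1) u k * h ^+ k) =
    1 + \sum_(k < n.+1) \sum_(i < k.+1) (u i * h ^+ i) * c (k - i)%N.
  rewrite mulr_sumr (_ : 1 = \sum_(k < n.+1) (k == 0 :> nat)%:R); last first.
    by rewrite big_ord_recl big1 ?addr0.
  rewrite -big_split/=; apply: eq_bigr => k _.
  rewrite [X in _ + X]big_ord_recr/= subnn mulr0 addr0.
  have <- : (k == 0 :> nat)%:R * h ^+ k = (k == 0 :> nat)%:R :> R.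
    by case: (nat_of_ord k) => [|j]; rewrite ?mul0r// mul1r expr0.
  rewrite -conv big_ord_recr/= subnn mulrDl.
  rewrite mulrA [a 0%N * _]mulrC addrAC mulr_suml -big_split/= big1 ?add0r// => i _.
  rewrite -(subnSK (ltn_ord i)) /c mulrACA -exprD addnS -addSn.
  by rewrite (subnKC (ltn_ord i)) mulrN mulNr addrN.
have H := @sum_conv_le _ (fun k => u k * h ^+ k) c n.+1 uh c0.
have S0 : 0 <= \sum_(k < n.+1) u k * h ^+ k by apply: sumr_ge0.
have {}H := le_trans H (ler_wpM2l S0 cF').
rewrite mulrBr [X in _ <= X - _]mulrC E in H.
by move: H; rewrite lerBrDr addrC lerD2r.
Qed.

Lemma pseries_on_poly (R : realType) (r : R) (p : {poly R}) :
  pseries_on r (fun k => p`_k) (fun h => p.[h]).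
Proof.
move=> h /andP[h0 _].
have stop (u : nat -> R) n : (forall k, (size p <= k)%N -> u k = 0) -> (size p <= n)%N ->
    \sum_(k < n) u k = \sum_(k < size p) u k.
  move=> u0 pn; rewrite -(subnKC pn) big_split_ord/= [X in _ + X]big1 ?addr0// => i _.
  by rewrite u0// leq_addr.
split.
  exists (\sum_(k < size p) `|p`_k| * h ^+ k) => n.
  rewrite -(stop (fun k => `|p`_k| * h ^+ k) (n + size p)%N) ?leq_addl//; last first.
    by move=> k pk; rewrite nth_default// normr0 mul0r.
  by rewrite big_split_ord/= lerDl sumr_ge0// => i _; rewrite mulr_ge0// exprn_ge0.
apply: cvg_near_cst; exists (size p) => // n /= pn; rewrite horner_coef.
by rewrite (stop (fun k => p`_k * h ^+ k))// => k pk; rewrite nth_default// mul0r.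
Qed.

(** * Exponential integrals as power series, and Pringsheim's theorem *)

Lemma nneseries_EFin_cvg (R : realType) (c : nat -> R) (l : R) :
  (fun n => \sum_(k < n) c k) @ \oo --> l -> (\sum_(k <oo) (c k)%:E = l%:E)%E.
Proof.
move=> cl; have E : (fun n => \sum_(0 <= k < n) (c k)%:E)%E = EFin \o (fun n => \sum_(k < n) c k).
  by apply/funext => n; rewrite /= big_mkord -sumEFin.
by rewrite E EFin_lim; [rewrite (cvg_lim _ cl)|apply/cvg_ex; exists l].
Qed.

Lemma nneseries_EFin_bounded (R : realType) (c : nat -> R) (l : R) (n : nat) :
  (forall k, 0 <= c k) -> (\sum_(k <oo) (c k)%:E = l%:E)%E -> \sum_(k < n) c k <= l.
Proof.
move=> c0 H; rewrite -lee_fin -H -sumEFin.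
have := @nneseries_lim_ge R (fun k => (c k)%:E) xpredT 0 n.
by rewrite big_mkord; apply => k _ _; rewrite lee_fin.
Qed.

Lemma cvg_nneseries_EFin (R : realType) (c : nat -> R) (l : R) :
  (forall k, 0 <= c k) -> (\sum_(k <oo) (c k)%:E = l%:E)%E ->
  (fun n => \sum_(k < n) c k) @ \oo --> l.
Proof.
move=> c0 H.
have cc : cvgn (fun n => \sum_(k < n) c k).
  apply: (@sumr_bounded_cvg _ c l) => n.
  rewrite (eq_bigr (fun k : 'I_n => c k)); first exact: nneseries_EFin_bounded.
  by move=> k _; rewrite ger0_norm.
by have := nneseries_EFin_cvg cc; rewrite H => -[->].
Qed.

(** Removing the first [N] terms makes the exponential integrable against measures
    with infinite mass near 0: [N = 2] is used for Levy measures, and [N = 0] for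
    Laplace transforms. *)
Definition exp_tail_coef {R : realType} (N k : nat) : R := (N <= k)%:R / k`!%:R.

Definition exp_tail {R : realType} (N : nat) (z : R) : R :=
  expR z - \sum_(k < N) z ^+ k / k`!%:R.

Lemma exp_tail_coef_ge0 (R : realType) N k : 0 <= exp_tail_coef N k :> R.
Proof. by rewrite divr_ge0. Qed.

Lemma exp_tailE (R : realType) (N : nat) (z : R) : 0 <= z ->
  (\sum_(k <oo) (exp_tail_coef N k * z ^+ k)%:E = (exp_tail N z)%:E)%E.
Proof.
move=> z0; apply: nneseries_EFin_cvg.
have H : (fun n => \sum_(k < n) z ^+ k / k`!%:R) @ \oo --> expR z.
  rewrite (_ : (fun n => _) = series (exp_coeff z)); first exact: is_cvg_series_exp_coeff.
  by apply/funext => n; rewrite seriesEord.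
have H' : (fun n => \sum_(k < n) z ^+ k / k`!%:R - \sum_(k < N) z ^+ k / k`!%:R) @ \oo --> exp_tail N z.
  by apply: cvgB => //; apply: cvg_cst.
apply: cvg_trans H'; apply: near_eq_cvg; exists N => // n /= Nn.
rewrite -(subnKC Nn) !big_split_ord/= addrAC subrr add0r.
rewrite [X in _ = X + _]big1 => [|i _]; last first.
  by rewrite /exp_tail_coef leqNgt ltn_ord !mul0r.
rewrite add0r; apply: eq_bigr => i _.
by rewrite /exp_tail_coef leq_addr mul1r mulrC.
Qed.

Section integral_exp_tail.
Context (d : measure_display) (T : measurableType d) (R : realType).
Context (mu : {measure set T -> \bar R}) (D : set T) (mD : measurable D).
Context (w y : T -> R) (mw : measurable_fun D w) (my : measurable_fun D y).
Context (w0 : forall x, D x -> 0 <= w x) (y0 : forall x, D x -> 0 <= y x).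
Context (N : nat).

Let M k := (\int[mu]_(x in D) (w x * (exp_tail_coef N k * y x ^+ k))%:E)%E.

Let mM k : measurable_fun D (fun x => w x * (exp_tail_coef N k * y x ^+ k)).
Proof.
apply: measurable_funM => //; apply: measurable_funM => //.
exact: measurable_funX.
Qed.

Let M0 k : (0 <= M k)%E.
Proof.
apply: integral_ge0 => x Dx; rewrite lee_fin !mulr_ge0 ?w0 ?exp_tail_coef_ge0//.
by rewrite exprn_ge0// y0.
Qed.

(** Sum and integral are exchanged freely, all the terms being nonnegative. *)
Lemma integral_exp_tail h : 0 <= h ->
  (\int[mu]_(x in D) (w x * exp_tail N (h * y x))%:E =
   \sum_(k <oo) (h ^+ k)%:E * M k)%E.
Proof.
move=> h0.
transitivity (\int[mu]_(x in D) (\sum_(k <oo) (h ^+ k)%:E *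
    (w x * (exp_tail_coef N k * y x ^+ k))%:E))%E.
  apply: eq_integral => x /set_mem Dx.
  rewrite EFinM -exp_tailE; last by rewrite mulr_ge0// y0.
  rewrite -nneseriesZl; last first.
    by move=> k _; rewrite lee_fin mulr_ge0 ?exp_tail_coef_ge0// exprn_ge0// mulr_ge0// y0.
  apply: eq_eseriesr => k _; rewrite -!EFinM exprMn; congr EFin; ring.
rewrite integral_nneseries//.
- apply: eq_eseriesr => k _; rewrite ge0_integralZl_EFin ?exprn_ge0//.
    by move=> x Dx; rewrite lee_fin !mulr_ge0 ?w0 ?exp_tail_coef_ge0// exprn_ge0// y0.
  exact/measurable_EFinP.
- by move=> k; apply: emeasurable_funM => //; apply/measurable_EFinP.
- move=> k x Dx; rewrite -EFinM lee_fin !mulr_ge0 ?exprn_ge0 ?w0 ?exp_tail_coef_ge0//.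
  exact: y0.
Qed.

Definition exp_moment k : R := fine (M k).

Lemma exp_moment_ge0 k : 0 <= exp_moment k.
Proof. exact: fine_ge0. Qed.

Section finite.
Context (r : R) (r0 : 0 < r) (F : R -> R).
Context (wF : forall h : R, 0 <= h < r ->
  (\int[mu]_(x in D) (w x * exp_tail N (h * y x))%:E = (F h)%:E)%E).

Lemma exp_moment_fin k : M k = (exp_moment k)%:E.
Proof.
rewrite fineK// ge0_fin_numE//.
pose h := r / 2; have h0 : 0 < h by rewrite divr_gt0.
have hr : 0 <= h < r by rewrite (ltW h0)/= /h ltr_pdivrMr// ltr_pMr// ltr1n.
have hM : ((h ^+ k)%:E * M k <= (F h)%:E)%E.
  rewrite -wF// integral_exp_tail//; last exact: ltW.
  have := @nneseries_lim_ge R (fun k => (h ^+ k)%:E * M k)%E xpredT 0 k.+1.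
  rewrite big_mkord big_ord_recr/= => H; apply: le_trans (H _) => [|i _ _].
    rewrite leeDr// sume_ge0// => i _; rewrite mule_ge0// lee_fin.
    by rewrite exprn_ge0// ltW.
  by rewrite mule_ge0// lee_fin exprn_ge0// ltW.
have := le_lt_trans hM (ltry (F h)); case: (M k) (M0 k) => [x||] // _.
  by rewrite !ltry.
by rewrite gt0_muley// lte_fin exprn_gt0.
Qed.

Lemma pseries_on_exp_moment : pseries_on r exp_moment F.
Proof.
move=> h hr; have h0 : 0 <= h by case/andP: hr.
have mh k : 0 <= exp_moment k * h ^+ k by rewrite mulr_ge0 ?exp_moment_ge0 ?exprn_ge0.
have E : (\sum_(k <oo) (exp_moment k * h ^+ k)%:E = (F h)%:E)%E.
  rewrite -wF// integral_exp_tail//; apply: eq_eseriesr => k _.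
  by rewrite exp_moment_fin muleC -EFinM.
split; last exact: (cvg_nneseries_EFin mh E).
exists (F h) => n; under eq_bigr do rewrite ger0_norm ?exp_moment_ge0//.
exact: (nneseries_EFin_bounded n mh E).
Qed.

(** A power series that represents the integral near 0 represents it on its
    whole interval of convergence, since all the terms are nonnegative: this is
    Pringsheim's theorem. *)
Lemma pringsheim s a G : pseries_on s a G -> 0 < s ->
  (forall h : R, 0 <= h < Num.min r s -> F h = G h) ->
  forall h : R, 0 <= h < s ->
  (\int[mu]_(x in D) (w x * exp_tail N (h * y x))%:E = (G h)%:E)%E.
Proof.
move=> aG s0 FG h hs; have h0 : 0 <= h by case/andP: hs.
have rs0 : 0 < Num.min r s by rewrite lt_min r0.
have aE : exp_moment = a.
  apply: (pseries_on_uniq rs0).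
    apply: (pseries_on_le _ pseries_on_exp_moment).
    by rewrite ge_min lexx.
  apply: (@pseries_on_eq _ _ _ G) => [x /FG->//|].
  by apply: (pseries_on_le _ aG); rewrite ge_min lexx orbT.
rewrite integral_exp_tail//; have [_ aGh] := aG h hs.
rewrite -(@nneseries_EFin_cvg _ (fun k => a k * h ^+ k) _ aGh).
by apply: eq_eseriesr => k _; rewrite exp_moment_fin aE muleC -EFinM.
Qed.

End finite.
End integral_exp_tail.

(** * Lebesgue integrals over the line *)

Section affine_substitution.
Context (R : realType).
Local Notation leb := (@lebesgue_measure R).

(** Lebesgue measure is determined by its values on half-open intervals. *)
Lemma lebesgue_measure_affine (phi : {mfun measurableTypeR R >-> measurableTypeR R}) :
  (forall a b : R, leb (phi @^-1` `]a, b]) = leb `]a, b]) ->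
  forall A : set R, measurable A -> pushforward leb phi A = leb A.
Proof.
move=> H A mA; apply/esym.
apply: (@lebesgue_measure_unique R (pushforward leb phi)) => // _ [[a b] _ <-].
exact/esym/H.
Qed.

Lemma integral_affine (phi : {mfun measurableTypeR R >-> measurableTypeR R}) :
  (forall a b : R, leb (phi @^-1` `]a, b]) = leb `]a, b]) ->
  forall (D : set R) (f : R -> \bar R), measurable D -> measurable_fun D f ->
  (\int[leb]_(x in D) f x = \int[leb]_(x in phi @^-1` D) f (phi x))%E.
Proof.
move=> H; have ge0_case (D : set R) (f : R -> \bar R) : measurable D -> measurable_fun D f ->
    (forall x, 0 <= f x)%E ->
    (\int[leb]_(x in D) f x = \int[leb]_(x in phi @^-1` D) f (phi x))%E.
  move=> mD mf f0.
  have := @ge0_integral_pushforward _ _ _ _ R phi (measurable_funPT phi) leb D f mD mf.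
  move=> /(_ (fun x _ => f0 x)) <-.
  by apply: eq_measure_integral => A mA _; apply/esym; exact: lebesgue_measure_affine.
move=> D f mD mf; rewrite [LHS]integralE [RHS]integralE; congr (_ - _)%E.
  etransitivity; first exact: (ge0_case D f^\+%E mD (measurable_funepos mf)).
  by apply: eq_integral => x _; rewrite !funeposE.
etransitivity; first exact: (ge0_case D f^\-%E mD (measurable_funeneg mf)).
by apply: eq_integral => x _; rewrite !funenegE.
Qed.

Let shift_mfun (c : R) : measurableTypeR R -> measurableTypeR R := fun x => c + x.
Let mshift c : measurable_fun setT (shift_mfun c). Proof. exact: measurable_funD. Qed.
HB.instance Definition _ c := isMeasurableFun.Build _ _ _ _ (shift_mfun c) (mshift c).

Let flip_mfun (c : R) : measurableTypeR R -> measurableTypeR R := fun x => c - x.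
Let mflip c : measurable_fun setT (flip_mfun c). Proof. exact: measurable_funB. Qed.
HB.instance Definition _ c := isMeasurableFun.Build _ _ _ _ (flip_mfun c) (mflip c).

Lemma integral_shift (c : R) (D : set R) (f : R -> \bar R) : measurable D -> measurable_fun D f ->
  (\int[leb]_(x in D) f x = \int[leb]_(x in [set x | D (c + x)%R]) f (c + x)%R)%E.
Proof.
move=> mD mf; rewrite (@integral_affine (shift_mfun c))// => a b.
rewrite (_ : _ @^-1` _ = `]a - c, b - c]%classic).
  rewrite !lebesgue_measure_itv/= !lte_fin ltrD2r; case: ifP => // _.
  by rewrite -!EFinB; congr EFin; ring.
by apply/seteqP; split => x /=; rewrite !in_itv/= /shift_mfun ltrBlDl lerBrDl.
Qed.

Lemma integral_flip (c : R) (D : set R) (f : R -> \bar R) : measurable D -> measurable_fun D f ->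
  (\int[leb]_(x in D) f x = \int[leb]_(x in [set x | D (c - x)%R]) f (c - x)%R)%E.
Proof.
move=> mD mf; rewrite (@integral_affine (flip_mfun c))// => a b.
rewrite (_ : _ @^-1` _ = `[c - b, c - a[%classic).
  rewrite !lebesgue_measure_itv/= !lte_fin ltrD2l ltrN2; case: ifP => // _.
  by rewrite -!EFinB; congr EFin; ring.
apply/seteqP; split => x /=; rewrite !in_itv/= /flip_mfun => /andP[h1 h2]; apply/andP; split; lra.
Qed.

End affine_substitution.

(** * Laplace transforms and convolutions *)

(** Monotonicity gives nonnegativity, measurability and local bounds at once, and it
    is inherited by convolutions. *)
Definition causal_nondecreasing {R : realType} (u : R -> R) :=
  {homo u : x y / x <= y} /\ forall x, x < 0 -> u x = 0.

Definition laplace {R : realType} (u : R -> R) (t : R) : \bar R :=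
  (\int[lebesgue_measure]_(x in `[0%R, +oo[) (expR (- (t * x)) * u x)%:E)%E.

Definition conv {R : realType} (u v : R -> R) (x : R) : R :=
  \int[lebesgue_measure]_(y in `[0, x]) (u y * v (x - y)).

Section causal.
Context (R : realType).
Local Notation leb := (@lebesgue_measure R).
Implicit Types (u v : R -> R) (t x : R) (D : set R).

Lemma causal_ge0 u x : causal_nondecreasing u -> 0 <= u x.
Proof.
move=> [ndu u0]; have [x0|x0] := ltP x 0; first by rewrite u0.
by rewrite -(u0 (-1)) ?ltrN10// ndu// (le_trans _ x0)// lerN10.
Qed.

Lemma causal_measurable u D : measurable D -> causal_nondecreasing u -> measurable_fun D u.
Proof. by move=> mD [ndu _]; exact: nondecreasing_measurable. Qed.

Lemma measurable_convolved u v x D : measurable D ->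
  causal_nondecreasing u -> causal_nondecreasing v ->
  measurable_fun D (fun y => u y * v (x - y)).
Proof.
move=> mD uN vN; apply: measurable_funM; first exact: causal_measurable.
apply: (@measurableT_comp _ _ _ _ _ _ v); first exact: causal_measurable.
exact: measurable_funB.
Qed.

Lemma causal_integrableM u v x : causal_nondecreasing u -> causal_nondecreasing v ->
  leb.-integrable `[0, x] (EFin \o (fun y => u y * v (x - y))).
Proof.
move=> uN vN; apply: measurable_bounded_integrable => //.
- rewrite /= lebesgue_measure_itv/=; case: ifP => // _; first by rewrite -EFinB ltry.
- exact: measurable_convolved.
- exists (u x * v x); split; first by rewrite num_real.
  move=> M uM y; rewrite /= in_itv/= => /andP[y0 yx].
  rewrite ger0_norm; last by rewrite mulr_ge0// causal_ge0.
  apply: le_trans (ltW uM); apply: ler_pM; rewrite ?causal_ge0//.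
    by apply: uN.1.
  by apply: vN.1; rewrite gerBl.
Qed.

Lemma EFin_conv u v x : causal_nondecreasing u -> causal_nondecreasing v ->
  ((conv u v x)%:E = \int[leb]_y (u y * v (x - y))%:E)%E.
Proof.
move=> uN vN; rewrite /conv /Rintegral fineK; last first.
  by apply: integrable_fin_num => //; exact: causal_integrableM.
rewrite integral_mkcond; apply: eq_integral => y _.
rewrite patchE; case: ifPn => //; rewrite notin_setE/= in_itv/= => /negP.
rewrite negb_and -!ltNge => /orP[y0|xy]; first by rewrite uN.2 ?mul0r.
by rewrite vN.2 ?mulr0// subr_lt0.
Qed.

Lemma causal_conv u v : causal_nondecreasing u -> causal_nondecreasing v ->
  causal_nondecreasing (conv u v).
Proof.
move=> uN vN; split; last first.
  by move=> x x0; rewrite /conv set_itv_ge ?Rintegral_set0// bnd_simp -ltNge.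
move=> x y xy; rewrite -lee_fin !EFin_conv//; apply: ge0_le_integral => //.
- by move=> z _; rewrite lee_fin mulr_ge0// causal_ge0.
- by apply/measurable_EFinP; exact: measurable_convolved.
- by apply/measurable_EFinP; exact: measurable_convolved.
move=> z _; rewrite lee_fin ler_wpM2l ?causal_ge0//.
by apply: vN.1; rewrite lerB.
Qed.

Lemma laplaceT u t : causal_nondecreasing u ->
  laplace u t = (\int[leb]_x (expR (- (t * x)) * u x)%:E)%E.
Proof.
move=> uN; rewrite /laplace integral_mkcond; apply: eq_integral => x _.
rewrite patchE; case: ifPn => //; rewrite notin_setE/= in_itv/= andbT => /negP.
by rewrite -ltNge => x0; rewrite uN.2 ?mulr0.
Qed.

Lemma measurable_laplace u t D : measurable D -> causal_nondecreasing u ->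
  measurable_fun D (fun x => expR (- (t * x)) * u x).
Proof.
move=> mD uN; apply: measurable_funM; last exact: causal_measurable.
by apply: measurableT_comp => //; apply: measurable_funN; exact: measurable_funM.
Qed.

Lemma laplace_ge0 u t : causal_nondecreasing u -> (0 <= laplace u t)%E.
Proof.
by move=> uN; apply: integral_ge0 => x _; rewrite lee_fin mulr_ge0 ?expR_ge0 ?causal_ge0.
Qed.

(** Tonelli's theorem, the exponential being multiplicative. *)
Lemma laplace_conv u v t : causal_nondecreasing u -> causal_nondecreasing v ->
  laplace (conv u v) t = (laplace u t * laplace v t)%E.
Proof.
move=> uN vN.
pose K (z : measurableTypeR R * measurableTypeR R) :=
  ((expR (- (t * z.2)) * u z.2) * (expR (- (t * (z.1 - z.2))) * v (z.1 - z.2)))%:E.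
have K0 z : (0 <= K z)%E by rewrite lee_fin !mulr_ge0 ?expR_ge0 ?causal_ge0.
have mK : measurable_fun setT K.
  apply/measurable_EFinP; apply: measurable_funM.
    apply: (@measurableT_comp _ _ _ _ _ _ (fun x => expR (- (t * x)) * u x)) => //.
    exact: measurable_laplace.
  apply: (@measurableT_comp _ _ _ _ _ _ (fun x => expR (- (t * x)) * v x)).
    exact: measurable_laplace.
  exact: measurable_funB.
rewrite laplaceT; last exact: causal_conv.
transitivity (\int[leb]_x \int[leb]_y K (x, y))%E.
  apply: eq_integral => x _; rewrite EFinM EFin_conv// -ge0_integralZl_EFin//.
  - by apply: eq_integral => y _; rewrite /K/= -EFinM mulrACA -expRD; congr (_ * _)%:E; congr expR; ring.
  - by move=> y _; rewrite lee_fin mulr_ge0// causal_ge0.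
  - by apply/measurable_EFinP; exact: measurable_convolved.
rewrite (fubini_tonelli (m1 := leb) (m2 := leb) K mK K0).
transitivity (\int[leb]_y ((expR (- (t * y)) * u y)%:E * laplace v t))%E.
  apply: eq_integral => y _.
  have mKy : measurable_fun setT (fun x => K (x, y)).
    apply/measurable_EFinP => /=; apply: measurable_funM; first exact: measurable_cst.
    apply: (@measurableT_comp _ _ _ _ _ _ (fun x => expR (- (t * x)) * v x)).
      exact: measurable_laplace.
    exact: measurable_funB.
  rewrite (integral_shift y measurableT mKy).
  rewrite (_ : [set _ | _] = setT); last exact/seteqP.
  rewrite (laplaceT t vN) -ge0_integralZl_EFin//.
  - by apply: eq_integral => x _; rewrite /K/= -EFinM [y + x]addrC addrK.
  - by move=> x _; rewrite lee_fin mulr_ge0 ?expR_ge0 ?causal_ge0.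
  - by apply/measurable_EFinP; exact: measurable_laplace.
  - by rewrite mulr_ge0 ?expR_ge0 ?causal_ge0.
rewrite ge0_integralZr// ?laplaceT//.
- by apply/measurable_EFinP; exact: measurable_laplace.
- by move=> x _; rewrite lee_fin mulr_ge0 ?expR_ge0 ?causal_ge0.
- by rewrite -laplaceT// laplace_ge0.
Qed.

End causal.

(** Integrability is part of the notion, so that transforms of differences can be
    formed. *)
Definition has_laplace {R : realType} (u : R -> R) (t l : R) :=
  lebesgue_measure.-integrable `[0%R, +oo[ (EFin \o (fun x => expR (- (t * x)) * u x)) /\
  laplace u t = l%:E.

Section has_laplace.
Context (R : realType).
Local Notation leb := (@lebesgue_measure R).
Implicit Types (u v F : R -> R) (t l x r s h : R) (a : nat -> R).

Lemma has_laplaceD u v t l k : has_laplace u t l -> has_laplace v t k ->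
  has_laplace (fun x => u x + v x) t (l + k).
Proof.
move=> [iu lu] [iv lv]; have E : (fun x => expR (- (t * x)) * (u x + v x)) =
    (fun x => expR (- (t * x)) * u x + expR (- (t * x)) * v x).
  by apply/funext => x; rewrite mulrDr.
split; first by rewrite E; exact: (integrableD _ iu iv).
rewrite EFinD -lu -lv /laplace -integralD_EFin//.
by apply: eq_integral => x _; rewrite mulrDr EFinD.
Qed.

Lemma has_laplaceZ u t l c : has_laplace u t l -> has_laplace (fun x => c * u x) t (c * l).
Proof.
move=> [iu lu]; have E : (fun x => expR (- (t * x)) * (c * u x)) =
    (fun x => c * (expR (- (t * x)) * u x)).
  by apply/funext => x; rewrite mulrCA.
split.
  rewrite E (_ : EFin \o _ = (fun x => c%:E * (expR (- (t * x)) * u x)%:E)%E)//.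
  exact: (integrableZl _ c iu).
rewrite EFinM -lu /laplace -integralZl//.
by apply: eq_integral => x _; rewrite -EFinM mulrCA.
Qed.

Lemma has_laplace_eq u v t l : (forall x, 0 <= x -> u x = v x) ->
  has_laplace u t l -> has_laplace v t l.
Proof.
move=> uv [iu lu]; split.
  apply: eq_integrable iu => // x /set_mem; rewrite /= in_itv/= andbT => x0.
  by rewrite /= uv.
rewrite -lu; apply: eq_integral => x /set_mem; rewrite /= in_itv/= andbT => x0.
by rewrite uv.
Qed.

Lemma has_laplace_causal u t l : causal_nondecreasing u -> laplace u t = l%:E ->
  has_laplace u t l.
Proof.
move=> uN lu; split => //; apply/integrableP; split.
  by apply/measurable_EFinP; exact: measurable_laplace.
under eq_integral do rewrite /= ger0_norm ?mulr_ge0 ?expR_ge0 ?causal_ge0//.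
by rewrite -/(laplace u t) lu ltry.
Qed.

Lemma has_laplace_conv u v t l k : causal_nondecreasing u -> causal_nondecreasing v ->
  has_laplace u t l -> has_laplace v t k -> has_laplace (conv u v) t (l * k).
Proof.
move=> uN vN [_ lu] [_ lv]; apply: has_laplace_causal; first exact: causal_conv.
by rewrite laplace_conv// lu lv.
Qed.

(** The convolution of [v] with this function is [exp (c x)] times the integral of
    [exp (- c y) v y] up to [x]. *)
Definition causal_exp (c x : R) : R := if 0 <= x then expR (c * x) else 0.

Lemma causal_nondecreasing_exp c : 0 <= c -> causal_nondecreasing (causal_exp c).
Proof.
move=> c0; split => [x y xy|x x0]; last by rewrite /causal_exp leNgt x0.
rewrite /causal_exp; case: (leP 0 x) => x0; last by case: ifP => // _; exact: expR_ge0.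
by rewrite (le_trans x0 xy) ler_expR ler_wpM2l.
Qed.

Lemma has_laplace_exp c t : 0 <= c < t -> has_laplace (causal_exp c) t (t - c)^-1.
Proof.
move=> /andP[c0 ct]; apply: has_laplace_causal; first exact: causal_nondecreasing_exp.
have r0 : 0 < t - c by rewrite subr_gt0.
rewrite laplaceT; last exact: causal_nondecreasing_exp.
transitivity (\int[leb]_x ((t - c)^-1%:E * (exponential_pdf (t - c) x)%:E))%E.
  apply: eq_integral => x _; rewrite -EFinM /causal_exp; congr EFin; case: ifPn => x0.
    rewrite exponential_pdfE// mulrA mulVf ?gt_eqF// mul1r.
    by rewrite -expRD; congr expR; ring.
  by rewrite /exponential_pdf patchE memNset ?mulr0//= in_itv/= (negbTE x0).
rewrite ge0_integralZl_EFin//.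
- by rewrite integral_exponential_pdf// mule1.
- by move=> x _; rewrite lee_fin exponential_pdf_ge0// ltW.
- by apply/measurable_EFinP; exact: measurable_exponential_pdf.
- by rewrite invr_ge0 ltW.
Qed.

Definition heaviside : R -> R := causal_exp 0.

Lemma heavisideE x : heaviside x = (0 <= x)%R%:R.
Proof. by rewrite /heaviside /causal_exp mul0r expR0; case: ifP. Qed.

Lemma has_laplace_heaviside t : 0 < t -> has_laplace heaviside t t^-1.
Proof.
by move=> t0; rewrite -[t in t^-1]subr0; apply: has_laplace_exp; rewrite lexx.
Qed.

Lemma has_laplace_le u c C t : causal_nondecreasing u -> 0 <= c < t ->
  (forall x, 0 <= x -> u x <= C * expR (c * x)) -> exists l, has_laplace u t l.
Proof.
move=> uN ct uC; exists (fine (laplace u t)).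
apply: has_laplace_causal => //; rewrite fineK// ge0_fin_numE ?laplace_ge0//.
have [_ lC] := has_laplaceZ C (has_laplace_exp ct).
apply: le_lt_trans (ltry (C * (t - c)^-1)); rewrite -lC; apply: ge0_le_integral => //.
- by move=> x _; rewrite lee_fin mulr_ge0 ?expR_ge0 ?causal_ge0.
- by apply/measurable_EFinP; exact: measurable_laplace.
- apply/measurable_EFinP; apply: measurable_funM; last apply: measurable_funM => //.
    by apply: measurableT_comp => //; apply: measurable_funN; exact: measurable_funM.
  by apply: causal_measurable => //; apply: causal_nondecreasing_exp; case/andP: ct.
- move=> x; rewrite /= in_itv/= andbT => x0; rewrite lee_fin ler_wpM2l ?expR_ge0//.
  by rewrite /causal_exp x0 uC.
Qed.

(** Both the power series of a Laplace transform around [t0] and Pringsheim's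
    theorem for it come from [exp (- t x) = exp (- t0 x) exp ((t0 - t) x)]. *)
Lemma laplace_exp_tail u t0 h :
  laplace u (t0 - h) = (\int[leb]_(x in `[0%R, +oo[)
     ((expR (- (t0 * x)) * u x) * exp_tail 0 (h * x))%:E)%E.
Proof.
apply: eq_integral => x _; rewrite /exp_tail big_ord0 subr0 mulrAC -expRD.
by congr (expR _ * _)%:E; ring.
Qed.

Lemma pseries_on_laplace u t0 r F : 0 < r -> causal_nondecreasing u ->
  (forall h, 0 <= h < r -> has_laplace u (t0 - h) (F (t0 - h))) ->
  exists a, pseries_on r a (fun h => F (t0 - h)).
Proof.
move=> r0 uN uF; eexists.
apply: (@pseries_on_exp_moment _ _ R leb `[0, +oo[ _
  (fun x => expR (- (t0 * x)) * u x) id _ _ _ _ 0 r r0 (fun h => F (t0 - h))) => //.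
- exact: measurable_laplace.
- by move=> x _; rewrite mulr_ge0 ?expR_ge0 ?causal_ge0.
- by move=> x; rewrite /= in_itv/= andbT.
- by move=> h /uF [_ <-]; rewrite laplace_exp_tail.
Qed.

Lemma laplace_pringsheim u t0 r s a F : 0 < r -> 0 < s ->
  measurable_fun (`[0%R, +oo[ : set R) u -> (forall x, 0 <= x -> 0 <= u x) ->
  (forall h, 0 <= h < r -> laplace u (t0 - h) = (F (t0 - h))%:E) ->
  pseries_on s a (fun h => F (t0 - h)) ->
  forall h, 0 <= h < s -> laplace u (t0 - h) = (F (t0 - h))%:E.
Proof.
move=> r0 s0 mu u0 uF aF h hs; rewrite laplace_exp_tail.
apply: (@pringsheim _ _ R leb `[0, +oo[ _
  (fun x => expR (- (t0 * x)) * u x) id _ _ _ _ 0 r r0 (fun h => F (t0 - h)) _ s a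
  (fun h => F (t0 - h))) => //.
- apply: measurable_funM => //.
  by apply: measurableT_comp => //; apply: measurable_funN; exact: measurable_funM.
- by move=> x; rewrite /= in_itv/= andbT => x0; rewrite mulr_ge0 ?expR_ge0 ?u0.
- by move=> x; rewrite /= in_itv/= andbT.
- by move=> k kr; rewrite -uF// laplace_exp_tail.
Qed.

End has_laplace.

(** * The Laplace exponent *)

Section levy_khintchine.
Context (R : realType) (gammaX sigma : R).
Context (mu : {measure set (measurableTypeR R) -> \bar R}) (Hmu : levy_measure mu).
Implicit Types (t z h : R).

Let D : set (measurableTypeR R) := `]-oo, 0[.

Let mD : measurable D. Proof. exact: measurable_itv. Qed.

Lemma levy_integrable (k : R -> R) (C : R) : measurable_fun D k ->
  (forall z, z < 0 -> `|k z| <= C * Num.min 1 (z ^+ 2)) -> mu.-integrable D (EFin \o k).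
Proof.
move=> mk kC; have mm : measurable_fun D (fun z : measurableTypeR R => Num.min 1 (z ^+ 2) : R).
  apply: measurable_minr => //; exact: measurable_funX.
have m0 z : 0 <= Num.min 1 (z ^+ 2) by rewrite le_min ler01 sqr_ge0.
have im : mu.-integrable D (fun z : measurableTypeR R => (Num.min 1 (z ^+ 2))%:E).
  apply/integrableP; split; first exact/measurable_EFinP.
  by under eq_integral do rewrite /= ger0_norm//; exact: Hmu.
apply: (le_integrable mD _ _ (integrableZl mD C im)); first exact/measurable_EFinP.
move=> z; rewrite /D/= in_itv/= => z0; rewrite lee_fin.
by rewrite (le_trans (kC z z0))// ler_norm.
Qed.

Let trunc z : R := if -1 < z then 1 else 0.

Let measurable_trunc : measurable_fun D (trunc : measurableTypeR R -> R).
Proof.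
rewrite (_ : trunc = \1_(`]-1, +oo[ : set R)); last first.
  by apply/funext => z; rewrite indicE /trunc mem_setE/= in_itv/= andbT; case: ifP.
exact: measurable_indic.
Qed.

Let kernel t z : R := expR (t * z) - 1 - t * z * trunc z.

Let measurable_expM t : measurable_fun D (fun z : measurableTypeR R => expR (t * z)).
Proof. by apply: measurableT_comp => //; exact: measurable_funM. Qed.

Lemma expRN_quadratic (x : R) : 0 <= x -> expR (- x) - 1 + x <= x ^+ 2.
Proof.
move=> x0; rewrite expRN; have := expR_ge1Dx x; have := expR_gt0 x.
move: (expR x) => e e0 ex.
have x1 : 0 < 1 + x by rewrite ltr_wpDr.
have : e^-1 <= (1 + x)^-1 by rewrite lef_pV2.
have : (1 + x)^-1 <= 1 - x + x ^+ 2.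
  rewrite -[leLHS]mul1r ler_pdivrMr//.
  have : 0 <= x ^+ 3 by rewrite exprn_ge0.
  have -> : (1 - x + x ^+ 2) * (1 + x) = 1 + x ^+ 3 by ring.
  lra.
lra.
Qed.

Let min_sq z : -1 < z -> z < 0 -> Num.min 1 (z ^+ 2) = z ^+ 2.
Proof. by move=> z1 z0; apply/min_idPr; nra. Qed.

Let min_1 z : z <= -1 -> Num.min 1 (z ^+ 2) = 1.
Proof. by move=> z1; apply/min_idPl; nra. Qed.

Let integrable_kernel t : 0 <= t -> mu.-integrable D (EFin \o (kernel t)).
Proof.
move=> t0; apply: (@levy_integrable _ (t ^+ 2 + 1)).
  apply: measurable_funB; first exact: measurable_funB.
  by apply: measurable_funM => //; exact: measurable_funM.
move=> z z0; rewrite /kernel /trunc; case: ltP => z1.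
  rewrite min_sq// mulr1.
  have tz : 0 <= - (t * z) by nra.
  have := expRN_quadratic tz; rewrite opprK => h1.
  have := expR_ge1Dx (t * z) => h2.
  have := sqr_ge0 z => h3.
  rewrite ger0_norm; [|lra].
  rewrite sqrrN exprMn in h1; nra.
rewrite min_1// mulr0 subr0 mulr1.
have h1 : expR (t * z) <= 1 by rewrite expR_le1; nra.
have := expR_gt0 (t * z) => h2.
rewrite ler0_norm; [|lra].
have := sqr_ge0 t; lra.
Qed.

Let slope t z : R := - z * expR (t * z) + z * trunc z.

Let integrable_slope t : 0 < t -> mu.-integrable D (EFin \o (slope t)).
Proof.
move=> t0; apply: (@levy_integrable _ (t + t^-1)).
  apply: measurable_funD; last exact: measurable_funM.
  by apply: measurable_funM => //; exact: measurable_funN.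
move=> z z0; rewrite /slope /trunc; have := expR_gt0 (t * z) => e0.
have tV : 0 < t^-1 by rewrite invr_gt0.
case: ltP => z1.
  rewrite min_sq// mulr1.
  have h1 : expR (t * z) <= 1 by rewrite expR_le1; nra.
  have := expR_ge1Dx (t * z) => h2.
  have := sqr_ge0 z => h3.
  rewrite ler0_norm; [|nra].
  nra.
rewrite min_1// mulr0 addr0 mulr1 ger0_norm; [|nra].
have : - (t * z) * expR (t * z) <= 1.
  have := expR_ge1Dx (- (t * z)); rewrite expRN.
  have : expR (t * z) * (expR (t * z))^-1 = 1 by rewrite divff// gt_eqF.
  move: (expR (t * z)) ((expR _)^-1) e0 => e e' e0; nra.
have : t * t^-1 = 1 by rewrite divff// gt_eqF.
nra.
Qed.

(** The second-order Taylor remainder in [h] of the integral term is the integral of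
    [exp (t0 z)] times the exponential of [- h z] deprived of its first two terms, a
    mixture of nonnegative powers of [h] as [z < 0]; the first two terms are
    integrated separately, with the truncation as compensator. *)
Lemma levy_khintchine_pseries t0 : 0 < t0 ->
  exists2 a, pseries_on t0 a (fun h => levy_khintchine gammaX sigma mu (t0 - h)) &
    forall k, (0 < k)%N -> 0 <= a k.+1.
Proof.
move=> t00.
pose I t := \int[mu]_(z in D) kernel t z.
pose L := \int[mu]_(z in D) slope t0 z.
have remE h z : expR (t0 * z) * exp_tail 2 (h * - z) =
    kernel (t0 - h) z - kernel t0 z - h * slope t0 z.
  rewrite /exp_tail /kernel /slope !big_ord_recl big_ord0 expr0 expr1 fact0 factS fact0.
  rewrite !divr1 addr0 mulrBr -expRD.
  have -> : t0 * z + h * - z = (t0 - h) * z by ring.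
  by rewrite /=; ring.
have rem h : 0 <= h < t0 ->
    (\int[mu]_(z in D) (expR (t0 * z) * exp_tail 2 (h * - z))%:E =
      (I (t0 - h) - I t0 - h * L)%:E)%E.
  move=> /andP[h0 ht].
  have i1 : mu.-integrable D (EFin \o (kernel (t0 - h))) by apply: integrable_kernel; lra.
  have i2 : mu.-integrable D (EFin \o (kernel t0)) by apply: integrable_kernel; lra.
  have i3 := integrable_slope t00.
  have i4 : mu.-integrable D (EFin \o (fun z => h * slope t0 z)) by exact: (integrableZl mD h i3).
  have i5 : mu.-integrable D (EFin \o (fun z => kernel (t0 - h) z - kernel t0 z)).
    exact: (integrableB mD i1 i2).
  rewrite /I /L -RintegralZl// -!RintegralB// /Rintegral fineK.
    by apply: eq_integral => z _; rewrite remE.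
  by apply: integrable_fin_num => //; exact: (integrableB mD i5 i4).
have w0 (z : measurableTypeR R) : D z -> 0 <= expR (t0 * z) by move=> _; exact: expR_ge0.
have y0 (z : measurableTypeR R) : D z -> 0 <= - z.
  by rewrite /D/= in_itv/= oppr_ge0 => /ltW.
have mN : measurable_fun D (fun z : measurableTypeR R => - z : R) by exact: measurable_funN.
have [b b0 bF] : exists2 b, forall k, 0 <= b k &
    pseries_on t0 b (fun h => I (t0 - h) - I t0 - h * L).
  eexists; last exact: (@pseries_on_exp_moment _ _ R mu D mD _ _ (measurable_expM t0) mN
    w0 y0 2 t0 t00 (fun h => I (t0 - h) - I t0 - h * L) rem).
  by move=> k; exact: exp_moment_ge0.
pose p := Poly [:: gammaX * t0 + sigma ^+ 2 / 2 * t0 ^+ 2 + I t0;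
                   - gammaX - sigma ^+ 2 * t0 + L; sigma ^+ 2 / 2].
exists (fun k => p`_k + b k).
  refine (pseries_on_eq _ (pseries_onD (pseries_on_poly (r := t0) p) bF)) => h _.
  have -> : levy_khintchine gammaX sigma mu (t0 - h) =
    gammaX * (t0 - h) + sigma ^+ 2 / 2 * (t0 - h) ^+ 2 + I (t0 - h) by [].
  by rewrite /p horner_Poly/=; field.
move=> k k0; rewrite addr_ge0 ?b0// /p coef_Poly.
case: k k0 => [//|[|k]] _ /=; first by rewrite divr_ge0// sqr_ge0.
by rewrite nth_nil.
Qed.

End levy_khintchine.

Lemma expR_convex (R : realType) (t x y : R) : 0 <= t <= 1 ->
  expR ((1 - t) * x + t * y) <= (1 - t) * expR x + t * expR y.
Proof.
move=> /andP[t0 t1]; rewrite addrC [leRHS]addrC.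
exact: (convex_expR (Itv01 t0 t1) y x).
Qed.

Section moment_generating_function.
Context (d : measure_display) (T : measurableType d) (R : realType).
Context (P : probability T R) (Y : T -> R) (mY : measurable_fun setT Y) (psi : R -> R).
Context (psiE : forall s, 0 <= s -> (\int[P]_w (expR (s * Y w))%:E = (expR (psi s))%:E)%E).
Implicit Types (s t u : R).

Let mexp s : measurable_fun setT (fun w => expR (s * Y w)).
Proof. by apply: measurableT_comp => //; exact: measurable_funM. Qed.

Lemma cumulant0 : psi 0 = 0.
Proof.
have := psiE (lexx 0); under eq_integral do rewrite mul0r expR0.
rewrite integral_cst// mul1e => PT; apply: expR_inj; rewrite expR0.
have : P [set: T] = 1%E by exact: probability_setT.
by rewrite PT => -[].
Qed.

(** This is Hoelder's inequality: the convexity of the exponential is applied to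
    [s Y - psi s] and [u Y - psi u], whose exponentials have expectation 1. *)
Lemma cumulant_convex s u t : 0 <= s -> 0 <= u -> 0 <= t <= 1 ->
  psi ((1 - t) * s + t * u) <= (1 - t) * psi s + t * psi u.
Proof.
move=> s0 u0 /[dup] t01 /andP[t0 t1].
have t1' : 0 <= 1 - t by rewrite subr_ge0.
set v := (X in psi X <= _); set c := (X in _ <= X).
have v0 : 0 <= v by rewrite addr_ge0// mulr_ge0.
rewrite -ler_expR -lee_fin -psiE//.
pose a := expR c * (1 - t) * expR (- psi s).
pose b := expR c * t * expR (- psi u).
have a0 : 0 <= a by rewrite !mulr_ge0 ?expR_ge0.
have b0 : 0 <= b by rewrite !mulr_ge0 ?expR_ge0.
have -> : (expR c)%:E = (\int[P]_w (a%:E * (expR (s * Y w))%:E + b%:E * (expR (u * Y w))%:E))%E.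
  rewrite ge0_integralD//; last 4 first.
  - by move=> w _; rewrite -EFinM lee_fin mulr_ge0 ?expR_ge0.
  - by apply/measurable_EFinP; exact: measurable_funM.
  - by move=> w _; rewrite -EFinM lee_fin mulr_ge0 ?expR_ge0.
  - by apply/measurable_EFinP; exact: measurable_funM.
  have Z k z : 0 <= k -> 0 <= z ->
      (\int[P]_w (k%:E * (expR (z * Y w))%:E) = k%:E * (expR (psi z))%:E)%E.
    move=> k0 z0; rewrite ge0_integralZl_EFin ?psiE//; exact/measurable_EFinP.
  rewrite !Z//; rewrite -!EFinM -EFinD; congr EFin; rewrite /a /b -!mulrA -!expRD.
  by rewrite !addNr expR0; ring.
apply: ge0_le_integral => //.
- exact/measurable_EFinP.
- apply/measurable_EFinP; apply: measurable_funD; exact: measurable_funM.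
move=> w _; rewrite -!EFinM -EFinD lee_fin.
have := @expR_convex R t (s * Y w - psi s) (u * Y w - psi u) t01.
have -> : (1 - t) * (s * Y w - psi s) + t * (u * Y w - psi u) = - c + v * Y w.
  by rewrite /c /v; ring.
rewrite expRD expRN ler_pdivrMl ?expR_gt0// => /le_trans; apply.
rewrite le_eqVlt; apply/orP; left; apply/eqP.
by rewrite /a /b !expRD; ring.
Qed.

(** By dominated convergence: the exponents at most 1 are dominated by
    [1 + exp Y]. *)
Lemma cumulant_cvg0 : (fun n : nat => expR (psi n.+1%:R^-1)) @ \oo --> (1 : R).
Proof.
have i1 : P.-integrable setT (fun w => (1 + expR (1 * Y w))%:E).
  apply: (@integrableD _ _ _ _ _ _ (fun=> 1%:E) (fun w => (expR (1 * Y w))%:E)) => //.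
    exact: finite_measure_integrable_cst.
  apply/integrableP; split; first exact/measurable_EFinP.
  under eq_integral do rewrite /= ger0_norm ?expR_ge0//.
  by rewrite psiE// ltry.
have n01 (n : nat) : 0 <= (n.+1%:R^-1 : R) <= 1.
  by rewrite invr_ge0 ler0n/= invf_le1// ler1n.
have iT : (\int[P]_w 1%:E = 1%:E)%E.
  by rewrite integral_cst// mul1e; exact: probability_setT.
have vcvg : (fun n : nat => n.+1%:R^-1) @ \oo --> (0 : R) by exact: cvg_harmonic.
have pcvg w : (fun n : nat => (expR (n.+1%:R^-1 * Y w))%:E) @ \oo --> 1%:E.
  apply: cvg_EFin; first by apply: nearW.
  suff : (fun n : nat => expR (n.+1%:R^-1 * Y w)) @ \oo --> expR (0 * Y w).
    by rewrite mul0r expR0.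
  by apply: continuous_cvg; [exact: continuous_expR|exact: cvgMr_tmp].
have dom w (n : nat) : (`|(expR (n.+1%:R^-1 * Y w))%:E| <= (1 + expR (1 * Y w))%:E)%E.
  rewrite /= lee_fin ger0_norm ?expR_ge0//; have /andP[n0 n1] := n01 n.
  have [y0|y0] := leP 0 (Y w).
    rewrite -[leLHS]add0r lerD// ler_expR ler_wpM2r//.
  by rewrite -[leLHS]addr0 lerD ?expR_ge0// expR_le1 mulr_ge0_le0// ltW.
have mfn (n : nat) : measurable_fun setT (fun w => (expR (n.+1%:R^-1 * Y w))%:E).
  exact/measurable_EFinP.
have [_ _ H] := @dominated_convergence _ _ _ P setT measurableT
  (fun n w => (expR (n.+1%:R^-1 * Y w))%:E) (fun=> 1%:E) (fun w => (1 + expR (1 * Y w))%:E)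
  mfn (measurable_cst _)
  (aeW P (fun w _ => pcvg w)) i1 (aeW P (fun w n _ => dom w n)).
have H' : (fun n : nat => (expR (psi n.+1%:R^-1))%:E) @ \oo --> 1%:E.
  move: H; rewrite iT; apply: cvg_trans; apply: near_eq_cvg.
  by apply: nearW => n; rewrite /= psiE//; case/andP: (n01 n).
exact: (fine_cvg H').
Qed.

(** Chernoff's bound [P (e <= Y) <= exp (K - s e)], for [s] tending to infinity. *)
Lemma cumulant_bounded K : (forall s, 0 <= s -> psi s <= K) -> P [set w | 0 < Y w] = 0%E.
Proof.
move=> psiK.
pose A (e : R) : set T := [set w | e <= Y w].
have mYe (e : R) : measurable (A e).
  have := mY measurableT (measurable_itv `[e, +oo[).
  rewrite setTI; congr (measurable _); rewrite /A; apply/seteqP; split => w /=; rewrite in_itv/= andbT//.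
have Pe e : 0 < e -> P (A e) = 0%E.
  move=> e0; apply/eqP; rewrite eq_le measure_ge0 andbT.
  have H s : 0 <= s -> (P (A e) <= (expR (K - s * e))%:E)%E.
    move=> s0; rewrite expRD EFinM -lee_pdivrMr ?expR_gt0// expRN invrK.
    apply: (@le_trans _ _ (expR (psi s))%:E); last by rewrite lee_fin ler_expR psiK.
    rewrite -psiE// (@le_trans _ _ (\int[P]_(w in A e) (expR (s * e))%:E)%E)//.
      by rewrite integral_cst// muleC.
    apply: (@le_trans _ _ (\int[P]_(w in A e) (expR (s * Y w))%:E)%E).
      apply: ge0_le_integral => //.
      - by apply/measurable_EFinP; exact: measurable_funTS.
      - by move=> w /= ew; rewrite lee_fin ler_expR ler_wpM2l.
    apply: ge0_subset_integral => //; exact/measurable_EFinP.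
  apply/lee_addgt0Pr => r r0; rewrite add0e.
  have [rK|rK] := leP 0 ((K - ln r) / e).
    apply: le_trans (H _ rK) _; rewrite divfK ?gt_eqF// lee_fin.
    by rewrite opprB addrCA subrr addr0 lnK.
  apply: le_trans (H 0 (lexx _)) _; rewrite mul0r subr0 lee_fin.
  rewrite -[leRHS]lnK// ler_expR -subr_le0.
  by move: rK; rewrite pmulr_llt0 ?invr_gt0// => /ltW.
apply: measure_negligible.
  rewrite (_ : [set w | 0 < Y w] = setT `&` Y @^-1` `]0, +oo[); first exact: mY.
  by rewrite setTI; apply/seteqP; split => w /=; rewrite in_itv/= andbT.
apply: (negligibleS (A := \bigcup_n A n.+1%:R^-1)).
  move=> w /= Yw; have [n nY] := ltr_add_invr Yw.
  by exists n => //=; rewrite /A/= ltW// -[ltLHS]add0r.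
apply: negligible_bigcup => n; apply/negligibleP => //.
by apply: Pe; rewrite invr_gt0.
Qed.

End moment_generating_function.

(** By right-continuity, the values at [s] and at [t] are limits along grid points to
    their right, which can be ordered like [s] and [t]. *)
Lemma grid_nonincreasing (R : realType) (x : R -> R) :
  (forall t : R, 0 <= t -> x s @[s --> t^'+] --> x t) ->
  (forall n k : nat, x (k.+1%:R / n.+1%:R) <= x (k%:R / n.+1%:R)) ->
  forall s t : R, 0 <= s -> s <= t -> x t <= x s.
Proof.
move=> rc grid s t s0 st; rewrite leNgt; apply/negP => xst.
have t0 : 0 <= t by exact: le_trans st.
pose m := (x s + x t) / 2.
have sm : x s < m by rewrite /m; lra.
have mt : m < x t by rewrite /m; lra.
have [e1 /= e10 H1] := cvgr_lt _ (rc s s0) _ sm.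
have [e2 /= e20 H2] := cvgr_gt _ (rc t t0) _ mt.
pose e := Num.min e1 e2; have e0 : 0 < e by rewrite lt_min e10.
have [n ne] := ltr_add_invr e0; rewrite add0r in ne.
have n0 : 0 < n.+1%:R :> R by rewrite ltr0n.
have next (r : R) : 0 <= r -> r < (Num.truncn (r * n.+1%:R)).+1%:R / n.+1%:R < r + e.
  move=> r0; apply/andP; split; first by rewrite ltr_pdivlMr// truncnS_gt.
  apply: (@le_lt_trans _ _ (r + n.+1%:R^-1)); last by rewrite ltrD2l.
  rewrite -natr1 mulrDl mul1r lerD2r ler_pdivrMr// truncn_le//.
  by rewrite mulr_ge0// ltW.
pose k (r : R) := (Num.truncn (r * n.+1%:R)).+1.
have kst : (k s <= k t)%N.
  by rewrite ltnS le_truncn// ler_wpM2r// ltW.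
have mono i j : x ((i + j)%N%:R / n.+1%:R) <= x (i%:R / n.+1%:R).
  elim: j => [|j IH]; first by rewrite addn0.
  by rewrite addnS; apply: le_trans IH; exact: grid.
have := mono (k s) (k t - k s)%N; rewrite subnKC// leNgt => /negP; apply.
apply: (@lt_trans _ _ m).
  have /andP[h1 h2] := next s s0; apply: H1 => //=.
  rewrite ltr0_norm ?subr_lt0// opprB ltrBlDl; apply: lt_le_trans h2 _.
  by rewrite lerD2l /e ge_min lexx.
have /andP[h1 h2] := next t t0; apply: H2 => //=.
rewrite ltr0_norm ?subr_lt0// opprB ltrBlDl; apply: lt_le_trans h2 _.
by rewrite lerD2l /e ge_min lexx orbT.
Qed.

Section nonpositive_levy_process.
Context (d : measure_display) (T : measurableType d) (R : realType).
Context (P : probability T R) (X : R -> T -> R) (HX : levy_process P X).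

Lemma levy_processN : levy_process P (fun t w => - X t w).
Proof.
have [mX X0 indX statX cadX] := HX.
have E (a b : R) (B : set R) : B (- a - - b) = (-%R @^-1` B) (a - b).
  by rewrite /preimage/=; congr (B _); rewrite opprB addrC opprK.
have mB (B : set (measurableTypeR R)) : measurable B -> measurable (-%R @^-1` B : set (measurableTypeR R)).
  move=> mB; rewrite -[X in measurable X]setTI; apply: (@measurable_funN _ _ _ setT id) => //.
split.
- by move=> t t0; apply: measurable_funN; exact: mX.
- by apply: filterS X0 => w ->; rewrite oppr0.
- move=> n t B t0 tS mB'.
  have := indX n t (fun i => -%R @^-1` B i) t0 tS (fun i => mB _ (mB' i)).
  by move=> H; under eq_bigr do under eq_set do rewrite E; rewrite H; apply: eq_bigr => i _; under [in RHS]eq_set do rewrite E.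
- move=> s t B s0 st mB'; have := statX s t _ s0 st (mB _ mB').
  by move=> H; under eq_set do rewrite E.
- apply: filterS cadX => w [rc lc]; split => t t0; first by apply: cvgN; exact: rc.
  by apply: is_cvgN; exact: lc.
Qed.

(** The increments over a grid of step [1 / (n + 1)] are independent with the same
    law.  Were they positive with positive probability, [X 1] would be so as well;
    hence almost all paths decrease along all these grids. *)
Lemma levy_nonpos_subordinator : P [set w | 0 < X 1 w] = 0%E ->
  subordinator P (fun t w => - X t w).
Proof.
move=> P1; split; first exact: levy_processN.
have [mX X0 indX statX cadX] := HX.
pose B : set (measurableTypeR R) := `]0, +oo[%classic.
have mB : measurable B by exact: measurable_itv.
have gridE (n k : nat) : k.+1%:R / n.+1%:R - k%:R / n.+1%:R = n.+1%:R^-1 :> R.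
  by rewrite -mulrBl -natr1 addrAC subrr add0r mul1r.
have g0 (n k : nat) : 0 <= k%:R / n.+1%:R :> R by rewrite divr_ge0.
have gS (n k : nat) : k%:R / n.+1%:R <= k.+1%:R / n.+1%:R :> R.
  by rewrite ler_pM2r ?invr_gt0// ler_nat.
have incr (n k : nat) : P [set w | B (X (k.+1%:R / n.+1%:R) w - X (k%:R / n.+1%:R) w)] =
    P [set w | B (X n.+1%:R^-1 w)] by rewrite statX// gridE.
have msub (s t : R) : 0 <= s -> 0 <= t -> measurable [set w | B (X s w - X t w)].
  move=> s0 t0; rewrite -[X in measurable X]setTI.
  by apply: (measurable_funB (mX s s0) (mX t t0)).
have small n : P [set w | B (X n.+1%:R^-1 w)] = 0%E.
  apply/eqP/negPn/negP => pn.
  have {}pn : (0 < P [set w | B (X n.+1%:R^-1 w)])%E by rewrite lt0e pn measure_ge0.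
  (* n + 1 independent positive increments would make X 1 - X 0 positive *)
  have indn := indX n.+1 (fun i => i%:R / n.+1%:R) (fun=> B) (g0 n 0%N) (gS n) (fun=> mB).
  have : (0 < \prod_(i < n.+1) P [set w | B (X (i.+1%:R / n.+1%:R) w - X (i%:R / n.+1%:R) w)%R])%E.
    by elim/big_ind: _ => [|x y x0 y0|i _]; [exact: lte01|exact: mule_gt0|rewrite incr].
  pose S := \bigcap_(i < n.+1) [set w | B (X (i.+1%:R / n.+1%:R) w - X (i%:R / n.+1%:R) w)].
  rewrite -indn (_ : \big[_/_]_(_ < _) _ = S); last by rewrite /S bigcap_mkord.
  apply/negP; rewrite -leNgt.
  suff : P.-negligible S.
    move=> /measure_negligible ->//; apply: bigcap_measurable => [|i _]; last exact: msub.
    by exists 0%N.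
  apply: (negligibleS (A := [set w | 0 < X 1 w] `|` ~` [set w | X 0 w = 0])).
    move=> w Sw; have [X0w|] := eqVneq (X 0 w) 0; last by move=> /eqP; right.
    left => /=; rewrite -X0w.
    suff H k : (k <= n)%N -> X 0 w < X (k.+1%:R / n.+1%:R) w.
      by have := H n (leqnn n); rewrite divff.
    elim: k => [|k IH] kn.
      by have := Sw 0%N isT; rewrite /B/= in_itv/= andbT subr_gt0 mul0r.
    have := Sw k.+1 kn; rewrite /B/= in_itv/= andbT subr_gt0.
    by apply: lt_trans; apply: IH; exact: ltnW.
  apply: negligibleU => //; apply/negligibleP => //.
  rewrite -[X in measurable X]setTI (_ : [set w | _] = X 1 @^-1` B); last first.
    by apply/seteqP; split => w; rewrite /B/= in_itv/= andbT.
  exact: mX.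
have : {ae P, forall w, forall n k : nat, X (k.+1%:R / n.+1%:R) w <= X (k%:R / n.+1%:R) w}.
  apply: ae_foralln => n; apply: ae_foralln => k.
  exists [set w | B (X (k.+1%:R / n.+1%:R) w - X (k%:R / n.+1%:R) w)]; split.
  - exact: msub.
  - exact: etrans (incr n k) (small n).
  - by move=> w /= /negP; rewrite -ltNge /B/= in_itv/= andbT subr_gt0.
apply: filterS2 cadX => w [rc _] grid s t s0 st; rewrite lerN2.
exact: (@grid_nonincreasing R (X ^~ w)).
Qed.

End nonpositive_levy_process.

Section right_inverse.
Context (R : realType) (psi : R -> R).
Context (psi0 : psi 0 = 0).
Context (psiC : forall s u t : R, 0 <= s -> 0 <= u -> 0 <= t <= 1 ->
  psi ((1 - t) * s + t * u) <= (1 - t) * psi s + t * psi u).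
Context (psiU : forall K : R, exists2 s, 0 <= s & K < psi s).
Implicit Types (p s u : R).

(* [psi] lies below its chord from 0, where it vanishes *)
Let psi_chord s u : 0 <= s -> s <= u -> 0 < u -> psi s <= s / u * psi u.
Proof.
move=> s0 su u0; have su1 : 0 <= s / u <= 1 by rewrite divr_ge0 ?(ltW u0)//= ler_pdivrMr ?mul1r.
have := psiC (lexx 0) (ltW u0) su1; rewrite mulr0 psi0 mulr0 !add0r.
by rewrite divfK// gt_eqF.
Qed.

Let psi_above p s u : 0 < p -> 0 < s -> s < u -> p <= psi s -> p < psi u.
Proof.
move=> p0 s0 su ps; rewrite ltNge; apply/negP => up.
have := psi_chord (ltW s0) (ltW su) (lt_trans s0 su).
have u0 := lt_trans s0 su.
have su1 : s / u < 1 by rewrite ltr_pdivrMr// mul1r.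
have su0 : 0 < s / u by rewrite divr_gt0.
by nra.
Qed.

(** By convexity, [psi] stays above [p > psi 0] once it has reached [p]; so the set
    where [psi s <= p] is an interval, and [psi] takes the value [p] exactly once, at
    its right end. *)
Lemma Phi_spec p : 0 < p -> [/\ 0 < Phi psi p, psi (Phi psi p) = p,
  (forall s, Phi psi p < s -> p < psi s) & (forall s, 0 <= s -> s < Phi psi p -> psi s < p)].
Proof.
move=> p0.
have [U U0 pU] := psiU p.
pose E := [set s | 0 <= s /\ psi s <= p].
have EU s : E s -> s <= U.
  move=> [s0 ps]; rewrite leNgt; apply/negP => Us.
  have U0' : 0 < U by rewrite lt_neqAle U0 andbT; apply/eqP => E0; move: pU; rewrite -E0 psi0; lra.
  by have := psi_above p0 U0' Us (ltW pU); rewrite ltNge ps.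
have hsE : has_sup E by split; [exists 0; split; rewrite ?psi0// ltW|exists U].
pose r := sup E.
have r0 : 0 <= r by apply: sup_ubound; [case: hsE|split; rewrite ?psi0// ltW].
have psir : psi r = p.
  apply/eqP; rewrite eq_le; apply/andP; split.
    (* points of E accumulate at r from the left *)
    apply/ler_addgt0Pr => e e0.
    have [Er|Er] := pselect (E r); first by case: Er => _ ?; lra.
    pose K := `|psi (r + 1)| + 1 + p.
    have K0 : 0 < K by rewrite /K; have := normr_ge0 (psi (r + 1)); lra.
    have d0 : 0 < e / K by rewrite divr_gt0.
    have [s Es rs] := sup_adherent d0 hsE.
    have sr : s <= r by apply: sup_ubound => //; case: hsE.
    case: (Es) => s0 ps.
    pose t := (r - s) / (r + 1 - s).
    have den : 0 < r + 1 - s by lra.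
    have t01 : 0 <= t <= 1.
      apply/andP; split; last by rewrite ler_pdivrMr// mul1r; lra.
      by apply: divr_ge0; [rewrite subr_ge0|exact: ltW].
    have := psiC s0 (addr_ge0 r0 ler01) t01.
    have -> : (1 - t) * s + t * (r + 1) = r.
      by rewrite /t; field; apply/eqP => D0; move: den; rewrite D0 ltxx.
    have : t <= e / K.
      rewrite /t ler_pdivrMr//; have : r - s <= e / K by rewrite lerBlDr -lerBlDl ltW.
      have : 0 <= e / K by exact: ltW.
      by nra.
    have : e / K * K = e by rewrite divfK// gt_eqF.
    have := ler_norm (psi (r + 1)); case/andP: t01 => t0 t1.
    have : (1 - t) * psi s <= (1 - t) * p by rewrite ler_wpM2l// subr_ge0.
    move: (normr_ge0 (psi (r + 1))); rewrite /K.
    move: (psi (r + 1)) => y; move: (`|y|) => ny; move: (e / _) => eK.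
    move: (psi r) (psi s) => a b; nra.
  rewrite leNgt; apply/negP => rp.
  (* otherwise the chord to U stays below p on the right of r *)
  have rU : r < U.
    rewrite lt_neqAle; apply/andP; split; last exact: (ge_sup hsE.1 EU).
    by apply/eqP => rU; move: pU rp; rewrite rU; lra.
  pose t := (p - psi r) / (psi U - psi r).
  have den : 0 < psi U - psi r by lra.
  have t0 : 0 < t by rewrite divr_gt0// subr_gt0.
  have t1 : t <= 1 by rewrite /t ler_pdivrMr// mul1r; lra.
  have := psiC r0 U0 (introT andP (conj (ltW t0) t1)).
  have -> : (1 - t) * psi r + t * psi U = p.
    by rewrite /t; field; apply/eqP => D0; move: den; rewrite D0 ltxx.
  move=> H; have : E ((1 - t) * r + t * U).
    split=> //; nra.
  move=> /(sup_ubound hsE.2); rewrite -/r; nra.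
have rgt0 : 0 < r.
  by rewrite lt_neqAle r0 andbT; apply/eqP => r_0; move: psir; rewrite -r_0 psi0; lra.
have lt_r s : 0 <= s -> s < r -> psi s < p.
  move=> s0 sr; have := psi_chord s0 (ltW sr) rgt0; rewrite psir.
  have : s / r < 1 by rewrite ltr_pdivrMr// mul1r.
  have : 0 <= s / r by rewrite divr_ge0// ltW.
  nra.
have gt_r s : r < s -> p < psi s by move=> rs; apply: (psi_above p0 rgt0 rs); rewrite psir.
have -> : Phi psi p = r.
  rewrite /Phi (_ : [set s | _] = [set r]) ?sup1//; apply/seteqP; split => s /=; last by move=> ->.
  move=> [s0 ps]; have [sr|rs|//] := ltgtP s r.
    by have := lt_r s s0 sr; rewrite ps ltxx.
  by have := gt_r s rs; rewrite ps ltxx.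
by split.
Qed.

End right_inverse.

(** * The scale function *)

Section scale_function_facts.
Context (R : realType) (psi W : R -> R) (r : R).
Context (HW : scale_function psi r W).
Context (psi_gt : forall s, Phi psi r < s -> r < psi s) (Phi0 : 0 < Phi psi r).
Implicit Types (s x y : R).

Let W0 x : x < 0 -> W x = 0. Proof. by case: HW => H _ _ _; exact: H. Qed.

Let W_incr x y : 0 <= x -> x < y -> W x < W y.
Proof.
case: HW => _ _ H _ x0 xy; apply: H => //; rewrite in_itv/= andbT//.
by rewrite (le_trans x0)// ltW.
Qed.

Let W_nondecr x y : 0 <= x -> x <= y -> W x <= W y.
Proof. by move=> x0; rewrite le_eqVlt => /predU1P[->//|xy]; exact/ltW/W_incr. Qed.

Let laplaceW s : Phi psi r < s -> laplace W s = ((psi s - r)^-1)%:E.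
Proof. by case: HW => _ _ _; exact. Qed.

(* unlike [W], this function is monotone across 0 whatever the sign of [W 0] *)
Let U x := W x - W 0 * heaviside x.

Let U_causal : causal_nondecreasing U.
Proof.
split; last by move=> x x0; rewrite /U W0// heavisideE leNgt x0 mulr0 subr0.
move=> x y xy; rewrite /U !heavisideE; have [x0|x0] := leP 0 x.
  by rewrite (le_trans x0 xy) lerB// W_nondecr.
rewrite W0// mulr0 subr0; have [y0|y0] := leP 0 y; last by rewrite W0// mulr0 subr0.
by rewrite mulr1 subr_ge0 W_nondecr.
Qed.

Let WE : W = fun x => U x + W 0 * heaviside x.
Proof. by apply/funext => x; rewrite /U subrK. Qed.

Let has_laplaceW s : Phi psi r < s -> has_laplace W s (psi s - r)^-1.
Proof.
move=> rs; split; last exact: laplaceW.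
have mW : measurable_fun (`[0, +oo[ : set R) (fun x => expR (- (s * x)) * W x).
  apply: measurable_funM.
    by apply: measurableT_comp => //; apply: measurable_funN; exact: measurable_funM.
  rewrite WE; apply: measurable_funD; first exact: causal_measurable.
  by apply: measurable_funM => //; apply: causal_measurable => //; exact: causal_nondecreasing_exp.
apply/integrableP; split; first exact/measurable_EFinP.
rewrite integral_fin_num_abs//.
by have := laplaceW rs; rewrite /laplace => ->.
Qed.

(** Tauberian: [s] times the Laplace transform of [W - W 0] tends to 0 as [s]
    tends to infinity, whereas the transform of [W] is positive. *)
Lemma scale_function_ge0 : 0 <= W 0.
Proof.
rewrite leNgt; apply/negP => Wneg.
pose s0 := Phi psi r + 1; have s0r : Phi psi r < s0 by rewrite ltrDl.
have s00 : 0 < s0 by exact: lt_trans s0r.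
have HU s : Phi psi r < s -> has_laplace U s ((psi s - r)^-1 - W 0 * s^-1).
  move=> rs; have := has_laplaceD (has_laplaceW rs) (has_laplaceZ (- W 0)
    (has_laplace_heaviside (lt_trans Phi0 rs))).
  by rewrite mulNr; apply: has_laplace_eq => x _; rewrite /U mulNr.
pose eta := - W 0 / 2.
have eta0 : 0 < eta by rewrite divr_gt0// oppr_gt0.
have [e e0 We] : exists2 e, 0 < e & forall x, 0 <= x -> x <= e -> U x <= eta.
  case: HW => _ + _ _ => /continuous_within_itvcyP[_ /cvgrPdist_lt/(_ _ eta0)].
  move=> [d /= d0 H]; exists (d / 2); first by rewrite divr_gt0.
  move=> x x0 xd; rewrite /U heavisideE x0 mulr1.
  move: x0; rewrite le_eqVlt => /predU1P[<-|x0]; first by rewrite subrr ltW.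
  have := H x; rewrite /= sub0r normrN gtr0_norm// distrC => /(_ _ x0) h.
  apply: le_trans (ler_norm _) _; apply/ltW/h.
  by rewrite (le_lt_trans xd)// ltr_pdivrMr// ltr_pMr// ltr1n.
set L := (psi s0 - r)^-1 - W 0 * s0^-1 in HU *.
have L0 : 0 < L.
  rewrite /L addr_gt0//; first by rewrite invr_gt0 subr_gt0 psi_gt.
  by rewrite -mulNr mulr_gt0 ?oppr_gt0 ?invr_gt0.
have key s : s0 < s -> eta <= s * (expR (- ((s - s0) * e)) * L).
  move=> s0s; have rs : Phi psi r < s by exact: lt_trans s0s.
  have sp : 0 < s by exact: lt_trans s0s.
  have [iU lU] := HU s rs; have [iU0 lU0] := HU s0 s0r.
  have [iE lE] := has_laplaceZ eta (has_laplace_heaviside sp).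
  pose c := expR (- ((s - s0) * e)).
  have iC : lebesgue_measure.-integrable (`[0, +oo[ : set R)
      (EFin \o (fun x => c * (expR (- (s0 * x)) * U x))).
    exact: (integrableZl _ c iU0).
  have : (laplace U s <= (eta * s^-1 + c * L)%:E)%E.
    rewrite EFinD -lE (_ : (c * L)%:E = \int[lebesgue_measure]_(x in `[0%R, +oo[)
        (c * (expR (- (s0 * x)) * U x))%:E)%E; last first.
      rewrite EFinM -lU0 /laplace -integralZl//.
    rewrite /laplace -integralD_EFin//; apply: le_integral => //.
      exact: (integrableD _ iE iC).
    move=> x /set_mem; rewrite /= in_itv/= andbT => x0.
    rewrite lee_fin heavisideE x0 mulr1.
    have Ux := causal_ge0 x U_causal.
    have [xe|ex] := leP x e.
      rewrite -[leLHS]addr0 lerD ?ler_wpM2l ?expR_ge0 ?We//.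
      by rewrite !mulr_ge0 ?expR_ge0.
    rewrite -[leLHS]add0r lerD//; first by rewrite mulr_ge0 ?expR_ge0// ltW.
    rewrite mulrA /c -expRD ler_wpM2r// ler_expR.
    have : (s - s0) * e <= (s - s0) * x by apply: ler_wpM2l; rewrite ?subr_ge0; exact: ltW.
    by move=> h; lra.
  rewrite lU lee_fin -/c => h.
  have p1 : 0 < (psi s - r)^-1 by rewrite invr_gt0 subr_gt0 psi_gt.
  have {}h : - W 0 * s^-1 <= eta * s^-1 + c * L by rewrite mulNr; lra.
  have W2 : - W 0 = eta + eta by rewrite /eta; field.
  rewrite W2 mulrDl lerD2l ler_pdivrMr// in h.
  by rewrite mulrC.
pose b := 4 * (s0 + e^-1) * L / eta.
have b0 : 0 < b by rewrite !mulr_gt0 ?invr_gt0// addr_gt0// invr_gt0.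
pose z := b + 1; have z1 : 1 < z by rewrite /z; lra.
have z0 : 0 < z by exact: lt_trans z1.
have ze : 0 < z / e by rewrite divr_gt0.
have := key (s0 + z / e); rewrite ltrDl => /(_ ze).
rewrite (_ : s0 + z / e - s0 = z / e) ?divfK ?gt_eqF//; last by rewrite addrAC subrr add0r.
apply/negP; rewrite -ltNge.
have ez : expR (- z) * z ^+ 2 <= 4.
  have h2 : z / 2 <= expR (z / 2) by apply: le_trans (expR_ge1Dx _); rewrite lerDr.
  have -> : z ^+ 2 = 4 * ((z / 2) * (z / 2)) by field.
  rewrite mulrCA -[leRHS]mulr1 ler_pM2l// expRN ler_pdivrMl ?expR_gt0// mulr1.
  have {3}-> : z = z / 2 + z / 2 by field.
  by rewrite expRD ler_pM// divr_ge0// ltW.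
have sz : s0 + z / e <= (s0 + e^-1) * z.
  have : s0 <= s0 * z by rewrite ler_peMr// ltW.
  by rewrite (mulrDl s0) [e^-1 * z]mulrC; lra.
rewrite -(ltr_pM2r z0).
apply: (@le_lt_trans _ _ ((s0 + e^-1) * z * (expR (- z) * L) * z)).
  by rewrite ler_pM2r// ler_pM2r// mulr_gt0 ?expR_gt0.
apply: (@le_lt_trans _ _ ((s0 + e^-1) * L * 4)).
  rewrite (_ : _ * z = (s0 + e^-1) * L * (expR (- z) * z ^+ 2)); last by ring.
  apply: ler_wpM2l => //; apply: mulr_ge0; last exact: ltW.
  by apply: addr_ge0; [exact: ltW|rewrite invr_ge0 ltW].
rewrite /z [eta * _](mulrDr eta) mulr1 (_ : eta * b = (s0 + e^-1) * L * 4); first by rewrite ltrDl.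
by rewrite /b; field; rewrite !gt_eqF.
Qed.

Lemma causal_scale_function : causal_nondecreasing W.
Proof.
have Wge0 := scale_function_ge0; split=> // x y xy.
have [x0|x0] := leP 0 x; first exact: W_nondecr.
rewrite W0//; have [y0|y0] := leP 0 y; last by rewrite W0.
by rewrite (le_trans Wge0)// W_nondecr.
Qed.

Lemma scale_function_gt0 x : 0 < x -> 0 < W x.
Proof. by move=> x0; rewrite (le_lt_trans scale_function_ge0)// W_incr. Qed.

Lemma has_laplace_scale_function s : Phi psi r < s -> has_laplace W s (psi s - r)^-1.
Proof. exact: has_laplaceW. Qed.

End scale_function_facts.

(** * Right derivatives of convex functions *)

Definition convex_ineq {R : realType} (f : R -> R) :=
  forall x y t : R, 0 <= t <= 1 -> f ((1 - t) * x + t * y) <= (1 - t) * f x + t * f y.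

Lemma convex_functionP (R : realType) (f : R -> R) :
  convex_function ([set: R] : set R) f -> convex_ineq f.
Proof.
move=> cf x y t /andP[t0 t1].
have H : f (t * y + (1 - t) * x) <= t * f y + (1 - t) * f x.
  exact: (cf (Itv01 t0 t1) y x (in_setT _) (in_setT _)).
by rewrite addrC [leRHS]addrC.
Qed.

Section right_derivative.
Context (R : realType) (f : R -> R) (cf : convex_ineq f).
Implicit Types (a b c x y u h : R).

Lemma convex_slopes a b c : a < b -> b < c ->
  (f b - f a) / (b - a) <= (f c - f b) / (c - b).
Proof.
move=> ab bc; have ba : 0 < b - a by lra.
have cb : 0 < c - b by lra.
have ca : 0 < c - a by lra.
pose t := (b - a) / (c - a).
have t01 : 0 <= t <= 1.
  by apply/andP; split; [rewrite divr_ge0// ltW|rewrite ler_pdivrMr// mul1r; lra].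
have := cf a c t01.
have -> : (1 - t) * a + t * c = b by rewrite /t; field; rewrite gt_eqF.
have tca : t * (c - a) = b - a by rewrite /t divfK// gt_eqF.
move=> H; rewrite ler_pdivrMr// mulrAC ler_pdivlMr//.
move: (f a) (f b) (f c) H => A B C H.
have := ler_wpM2r (ltW ca) H.
have -> : ((1 - t) * A + t * C) * (c - a) = (c - a) * A + (t * (c - a)) * (C - A) by ring.
rewrite tca; nra.
Qed.

Let D x h := h^-1 * (f (x + h) - f x).

Let D_nondecr x h u : 0 < h -> h <= u -> D x h <= D x u.
Proof.
move=> h0; rewrite le_eqVlt => /predU1P[->//|hu].
have u0 : 0 < u by exact: lt_trans hu.
have h1 : x < x + h by rewrite ltrDl.
have h2 : x + h < x + u by rewrite ltrD2l.
have := convex_slopes h1 h2.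
have -> : x + h - x = h by ring.
have -> : x + u - (x + h) = u - h by ring.
have uh : 0 < u - h by rewrite subr_gt0.
rewrite ler_pdivrMr// mulrAC ler_pdivlMr// => H.
rewrite /D [h^-1 * _]mulrC [u^-1 * _]mulrC ler_pdivrMr// mulrAC ler_pdivlMr//.
move: H; move: (f x) (f (x + h)) (f (x + u)) => A B C; nra.
Qed.

Let left_slope_le x u h : 0 < u -> 0 < h -> (f x - f (x - u)) / u <= D x h.
Proof.
move=> u0 h0; have h1 : x - u < x by rewrite gtrBl.
have h2 : x < x + h by rewrite ltrDl.
have := convex_slopes h1 h2.
have -> : x - (x - u) = u by ring.
have -> : x + h - x = h by ring.
by rewrite /D [h^-1 * _]mulrC.
Qed.

Let D_cvg x : D x @ 0^'+ --> rderiv f x.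
Proof.
suff : cvg (D x @ 0^'+) by [].
apply/cvg_ex; exists (inf (D x @` [set` Interval (BRight 0) (BLeft 1)])).
apply: nondecreasing_at_right_cvgr; first by rewrite bnd_simp.
  move=> h u; rewrite !in_itv/= => /andP[h0 _] _ hu; exact: D_nondecr.
exists ((f x - f (x - 1)) / 1) => _ /= [h + <-]; rewrite in_itv/= => /andP[h0 _].
by apply: left_slope_le.
Qed.

Lemma rderiv_le x h : 0 < h -> rderiv f x <= (f (x + h) - f x) / h.
Proof.
move=> h0; rewrite mulrC. apply: (cvgr_to_le (@D_cvg x)).
near=> u; apply: D_nondecr; near: u; first exact: nbhs_right_gt.
exact: nbhs_right_le.
Unshelve. all: by end_near. Qed.

Lemma rderiv_ge x u : 0 < u -> (f x - f (x - u)) / u <= rderiv f x.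
Proof.
move=> u0; apply: (cvgr_to_ge (@D_cvg x)).
near=> h; apply: left_slope_le => //; near: h; exact: nbhs_right_gt.
Unshelve. all: by end_near. Qed.

Lemma rderiv_nondecreasing : {homo rderiv f : x y / x <= y}.
Proof.
move=> x y; rewrite le_eqVlt => /predU1P[->//|xy].
have d0 : 0 < y - x by rewrite subr_gt0.
have := rderiv_ge y d0; rewrite subKr; apply: le_trans.
by have := rderiv_le x d0; rewrite subrKC.
Qed.

Lemma rderiv_affine c k : rderiv (fun x => f x + c * x) k = rderiv f k + c.
Proof.
apply/cvg_lim => //; have H : (fun h => D k h + c) @ 0^'+ --> rderiv f k + c.
  by apply: cvgD; [exact: D_cvg|exact: cvg_cst].
apply: cvg_trans H; apply: near_eq_cvg; near=> h.
by rewrite /D; field; rewrite gt_eqF//; near: h; exact: nbhs_right_gt.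
Unshelve. all: by end_near. Qed.

End right_derivative.

Lemma convex_ineq_affine (R : realType) (f : R -> R) (c : R) :
  convex_ineq f -> convex_ineq (fun x => f x + c * x).
Proof. by move=> cf x y t t01; have := cf x y t t01; lra. Qed.

Lemma exprn_le_expR (R : realType) (N : nat) (e : R) : 0 < e ->
  exists2 C, 0 <= C & forall x : R, 0 <= x -> x ^+ N <= C * expR (e * x).
Proof.
move=> e0; case: N => [|N].
  by exists 1 => // x x0; rewrite expr0 mul1r -[leLHS]expR0 ler_expR mulr_ge0// ltW.
pose c := N.+1%:R / e; have c0 : 0 < c by rewrite divr_gt0.
exists (c ^+ N.+1); first by rewrite exprn_ge0// ltW.
move=> x x0; have -> : e * x = (x / c) * N.+1%:R.
  by rewrite /c; field; rewrite gt_eqF//= pnatr_eq0.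
rewrite expRM_natr -exprMn; have xc : x <= c * expR (x / c).
  rewrite -ler_pdivrMl// mulrC; apply: le_trans (expR_ge1Dx _).
  by rewrite lerDr.
by apply: lerXn2r; rewrite ?nnegrE//; exact: le_trans xc.
Qed.

(** The slope over [[x, x + 1]] bounds the right derivative at [x]. *)
Lemma rderiv_growth (R : realType) (f : R -> R) : convex_ineq f -> polynomial_growth f ->
  forall e : R, 0 < e -> exists C, forall x : R, 0 <= x -> rderiv f x <= C * expR (e * x).
Proof.
move=> cf [C0 [N fC]] e e0; have [C1 C10 HC1] := exprn_le_expR N e0.
have C00 : 0 <= C0.
  have c0 : 0 < 1 + `|0 : R| ^+ N by rewrite ltr_wpDr// exprn_ge0.
  by have := le_trans (normr_ge0 _) (fC 0); rewrite pmulr_lge0.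
exists (C0 * (1 + C1 * expR e) + C0 * (1 + C1)) => x x0.
have := rderiv_le cf x ltr01; rewrite divr1 => /le_trans; apply.
have e1 : 1 <= expR (e * x) by rewrite -[leLHS]expR0 ler_expR mulr_ge0// ltW.
have x10 : 0 <= x + 1 by rewrite addr_ge0.
have h1 : f (x + 1) <= C0 * (1 + C1 * expR (e * (x + 1))).
  apply: le_trans (ler_norm _) _; apply: le_trans (fC _) _.
  by rewrite ler_wpM2l// lerD2l ger0_norm// HC1.
have h2 : - f x <= C0 * (1 + C1 * expR (e * x)).
  apply: le_trans (ler_norm _) _; rewrite normrN; apply: le_trans (fC _) _.
  by rewrite ler_wpM2l// lerD2l ger0_norm// HC1.
have E : expR (e * (x + 1)) = expR (e * x) * expR e by rewrite -expRD mulrDr mulr1.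
rewrite E in h1.
apply: (le_trans (lerD h1 h2)).
move: (expR (e * x)) e1 => y e1; have := expR_ge0 e; move: (expR e) => z z0.
have : 0 <= C0 * (y - 1) by rewrite mulr_ge0// subr_ge0.
nra.
Qed.

(** * Integrals over bounded intervals *)

Section interval_integrals.
Context (R : realType).
Local Notation leb := (@lebesgue_measure R).
Implicit Types (f g k : R -> R) (a b c x y t : R).

Lemma fine_lebesgue_itv a b : a <= b -> fine (leb `[a, b]) = b - a.
Proof.
move=> ab; rewrite lebesgue_measure_itv/= lte_fin; case: ltP => // ba.
by apply/esym/eqP; rewrite subr_eq0 eq_le ab ba.
Qed.

Lemma bounded_integrable f a b M : measurable_fun (`[a, b] : set R) f ->
  (forall x, a <= x <= b -> `|f x| <= M) -> leb.-integrable `[a, b] (EFin \o f).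
Proof.
move=> mf fM; apply: measurable_bounded_integrable => //.
  rewrite /= lebesgue_measure_itv/=; case: ifP => // _; first by rewrite -EFinB ltry.
exists M; split; first by rewrite num_real.
move=> N MN x; rewrite /= in_itv/= => xab; apply: le_trans (ltW MN); exact: fM.
Qed.

Lemma monotone_integrable f a b : {homo f : x y / x <= y} ->
  leb.-integrable `[a, b] (EFin \o f).
Proof.
move=> ndf; apply: (@bounded_integrable _ _ _ (`|f a| + `|f b|)).
  exact: nondecreasing_measurable.
move=> x /andP[ax xb]; have h1 := ndf _ _ ax; have h2 := ndf _ _ xb.
have h3 := ler_norm (f b); have h4 := ler_norm (- f a); rewrite normrN in h4.
by rewrite ler_norml; apply/andP; split; have := normr_ge0 (f a); have := normr_ge0 (f b); lra.
Qed.

Lemma Rintegral_chasles f a b c : a <= b -> b <= c ->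
  leb.-integrable `[a, c] (EFin \o f) ->
  \int[leb]_(x in `[a, c]) f x =
  \int[leb]_(x in `[a, b]) f x + \int[leb]_(x in `[b, c]) f x.
Proof.
move=> ab bc fi; have := @Rintegral_itvB R f (BLeft a) (BRight c) b fi.
rewrite !bnd_simp => /(_ ab bc) /eqP; rewrite subr_eq => /eqP ->.
rewrite addrC Rintegral_itv_obnd_cbnd//.
by apply: integrableS fi => //; apply: subset_itv; rewrite bnd_simp.
Qed.

Lemma Rintegral_itv_ge f a b m : a <= b -> leb.-integrable `[a, b] (EFin \o f) ->
  (forall x, a <= x <= b -> m <= f x) -> m * (b - a) <= \int[leb]_(x in `[a, b]) f x.
Proof.
move=> ab fi mf; rewrite -fine_lebesgue_itv// -Rintegral_cst//.
apply: le_Rintegral => //; first exact: monotone_integrable.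
Qed.

Lemma Rintegral_itv_le f a b m : a <= b -> leb.-integrable `[a, b] (EFin \o f) ->
  (forall x, a <= x <= b -> f x <= m) -> \int[leb]_(x in `[a, b]) f x <= m * (b - a).
Proof.
move=> ab fi mf; rewrite -fine_lebesgue_itv// -Rintegral_cst//.
by apply: le_Rintegral => //; exact: monotone_integrable.
Qed.

Lemma Rintegral_shift_itv f a b c : measurable_fun setT f ->
  \int[leb]_(x in `[a + c, b + c]) f x = \int[leb]_(x in `[a, b]) f (x + c).
Proof.
move=> mf; rewrite /Rintegral (integral_shift c)//; last first.
  by apply/measurable_EFinP; exact: measurable_funTS.
congr fine; rewrite (_ : [set x | _] = `[a, b]%classic).
  by apply: eq_integral => x _; rewrite addrC.
by apply/seteqP; split => x /=; rewrite !in_itv/= ![_ + c]addrC !lerD2l.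
Qed.

Lemma Rintegral_flip_itv f a b c : measurable_fun setT f ->
  \int[leb]_(x in `[c - b, c - a]) f x = \int[leb]_(x in `[a, b]) f (c - x).
Proof.
move=> mf; rewrite /Rintegral (integral_flip c)//; last first.
  by apply/measurable_EFinP; exact: measurable_funTS.
congr fine; rewrite (_ : [set x | _] = `[a, b]%classic)//.
by apply/seteqP; split => x /=; rewrite !in_itv/= !lerD2l !lerN2 andbC.
Qed.

Let sub_le_of_sums (p q r s t B : R) :
  p = q + r -> p = s + t -> 0 <= q -> t <= B -> r - s <= B.
Proof. by lra. Qed.

(** Since [v] is monotone, the increment of the convolution is controlled by
    [u] times a telescoping integral of [v], whence a Lipschitz bound that needs
    no continuity. *)
Lemma conv_lipschitz u v x y b : causal_nondecreasing u -> causal_nondecreasing v ->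
  0 <= x -> x <= y -> y <= b ->
  conv u v y - conv u v x <= 2 * u b * v b * (y - x).
Proof.
move=> uN vN x0 xy yb; have y0 : 0 <= y by exact: le_trans xy.
have iuy := causal_integrableM y uN vN.
have iux := causal_integrableM x uN vN.
have S0 : (`[0, x] : set R) `<=` `[0, y] by apply: subset_itvl; rewrite bnd_simp.
have Sx : (`[x, y] : set R) `<=` `[0, y] by apply: subset_itvr; rewrite bnd_simp.
have iuy0 : leb.-integrable `[0, x] (EFin \o (fun z => u z * v (y - z))).
  by apply: integrableS iuy.
have iuyx : leb.-integrable `[x, y] (EFin \o (fun z => u z * v (y - z))).
  by apply: integrableS iuy.
rewrite /conv (Rintegral_chasles x0 xy iuy) addrAC -RintegralB//.
have u0 z := causal_ge0 z uN; have v0 z := causal_ge0 z vN.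
have mv : measurable_fun [set: R] v by exact: causal_measurable.
have iv c : leb.-integrable `[0, x] (EFin \o (fun z => v (c - z))).
  apply: (@bounded_integrable _ _ _ (v c)).
    apply: (@measurableT_comp _ _ _ _ _ _ v) => //; exact: measurable_funB.
  move=> z /andP[z0 zx]; rewrite ger0_norm ?v0//; apply: vN.1.
  by rewrite gerBl.
have h1 : \int[leb]_(z in `[0, x]) (u z * v (y - z) - u z * v (x - z)) <=
    u b * (\int[leb]_(z in `[0, x]) v (y - z) - \int[leb]_(z in `[0, x]) v (x - z)).
  rewrite -RintegralB// -RintegralZl//; last exact: (integrableB _ (iv y) (iv x)).
  apply: le_Rintegral => //.
  - exact: (integrableB _ iuy0 iux).
  - exact: (integrableZl _ (u b) (integrableB _ (iv y) (iv x))).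
  move=> z; rewrite /= in_itv/= => /andP[z0 zx]; rewrite -mulrBr ler_wpM2r//.
    by rewrite subr_ge0; apply: vN.1; rewrite lerB.
  by apply: uN.1; rewrite (le_trans zx)// (le_trans xy).
have h2 : \int[leb]_(z in `[0, x]) v (y - z) - \int[leb]_(z in `[0, x]) v (x - z) <=
    v b * (y - x).
  rewrite -(Rintegral_flip_itv 0 x y mv) -(Rintegral_flip_itv 0 x x mv) !subr0 subrr.
  have ivv : leb.-integrable `[0, y] (EFin \o v) by apply: monotone_integrable vN.1.
  have yx0 : 0 <= y - x by rewrite subr_ge0.
  have yxy : y - x <= y by rewrite gerBl.
  have e1 := Rintegral_chasles yx0 yxy ivv.
  have e2 := Rintegral_chasles x0 xy ivv.
  have n1 : 0 <= \int[leb]_(z in `[0, y - x]) v z by apply: Rintegral_ge0 => z _; exact: v0.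
  have n2 : \int[leb]_(z in `[x, y]) v z <= v b * (y - x).
    apply: Rintegral_itv_le => //; first exact: monotone_integrable vN.1.
    by move=> z /andP[_ zy]; apply: vN.1; exact: le_trans yb.
  exact: sub_le_of_sums e1 e2 n1 n2.
have h3 : \int[leb]_(z in `[x, y]) (u z * v (y - z)) <= u b * v b * (y - x).
  apply: Rintegral_itv_le => // z /andP[xz zy]; apply: ler_pM; rewrite ?u0 ?v0//.
    by apply: uN.1; exact: le_trans yb.
  by apply: vN.1; rewrite lerBlDr (le_trans yb)// lerDl (le_trans x0).
have h4 := ler_wpM2l (u0 b) h2.
have -> : 2 * u b * v b * (y - x) = u b * (v b * (y - x)) + u b * v b * (y - x) by ring.
by apply: lerD h3; exact: le_trans h1 h4.
Qed.

Lemma conv_continuous u v x : causal_nondecreasing u -> causal_nondecreasing v ->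
  0 <= x -> forall e, 0 < e -> exists2 d, 0 < d &
  forall y, 0 <= y -> `|y - x| < d -> `|conv u v y - conv u v x| < e.
Proof.
move=> uN vN x0 e e0; pose M := 2 * u (x + 1) * v (x + 1) + 1.
have M0 : 0 < M by rewrite ltr_wpDl// !mulr_ge0// causal_ge0.
exists (Num.min 1 (e / M)); first by rewrite lt_min ltr01 divr_gt0.
move=> y y0; rewrite lt_min => /andP[xy1 xyM].
have cN := causal_conv uN vN.
have key z t : 0 <= z -> z <= t -> t <= x + 1 -> `|t - z| < e / M ->
    `|conv u v t - conv u v z| < e.
  move=> z0 zt tx; rewrite ger0_norm ?subr_ge0// => ztM.
  rewrite ger0_norm ?subr_ge0; last exact: cN.1.
  apply: le_lt_trans (conv_lipschitz uN vN z0 zt tx) _.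
  apply: (@le_lt_trans _ _ (M * (t - z))).
    by rewrite ler_wpM2r ?subr_ge0// /M lerDl.
  by rewrite mulrC -ltr_pdivlMr.
have [xy|yx] := leP x y.
  apply: key => //; move: xy1; rewrite ger0_norm ?subr_ge0// => /ltW; lra.
rewrite distrC; apply: key => //; [exact: ltW|by rewrite lerDl|by rewrite distrC].
Qed.

End interval_integrals.

Lemma Rintegral_expRN (R : realType) (p a b : R) : 0 < p -> a <= b ->
  \int[lebesgue_measure]_(y in `[a, b]) expR (- (p * y)) =
  (expR (- (p * a)) - expR (- (p * b))) / p.
Proof.
move=> p0; rewrite le_eqVlt => /predU1P[->|ab].
  by rewrite subrr mul0r set_itv1 Rintegral_set1.
pose F (y : R) := - p^-1 * expR (- (p * y)).
have cexp : continuous (fun y : R => expR (- (p * y))).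
  move=> y; apply: continuous_comp; last exact: continuous_expR.
  by apply: continuousN; apply: mulrl_continuous.
have dF (y : R) : is_derive y 1 F (expR (- (p * y))).
  rewrite /F; apply: is_derive_eq.
  by rewrite /GRing.scale/=; field; rewrite gt_eqF.
rewrite /Rintegral (@continuous_FTC2 R (fun y => expR (- (p * y))) F a b ab).
- by rewrite -EFinB /F/=; field; rewrite gt_eqF.
- exact: continuous_subspaceT.
- split.
  + by move=> y _; exact: ex_derive.
  + by apply: cvg_at_right_filter; apply: cvgMl_tmp; exact: cexp.
  + by apply: cvg_at_left_filter; apply: cvgMl_tmp; exact: cexp.
- by move=> y _; rewrite derive1E; apply: derive_val.
Qed.

(** * The Laplace transform of the value function *)

Section transform_series.
Context (R : realType) (psi : R -> R) (q lam phi Phi : R).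
Context (lam0 : 0 < lam) (phi0 : 0 < phi) (phiPhi : phi < Phi).
Context (psi_phi : psi phi = q) (psi_Phi : psi Phi = q + lam).
Context (psi_lt : forall t, 0 <= t -> t < Phi -> psi t < q + lam).
Context (psi_gt : forall t, Phi < t -> q + lam < psi t).
Context (psi_series : forall t0, 0 < t0 ->
  exists2 a, pseries_on t0 a (fun h => psi (t0 - h)) & forall k, (0 < k)%N -> 0 <= a k.+1).
Context (t0 : R) (Phit0 : Phi < t0).
Implicit Types (t h : R).

Let t00 : 0 < t0. Proof. by rewrite (lt_trans phi0)// (lt_trans phiPhi). Qed.

Lemma pseries_on_at0 (r : R) a F : 0 < r -> pseries_on r a F -> F 0 = a 0%N.
Proof.
move=> r0 aF; have [|_ c0] := aF 0; first by rewrite lexx.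
apply: (cvg_unique _ c0) => //; apply: cvg_near_cst; exists 1%N => // -[//|n] _ /=.
rewrite big_ord_recl expr0 mulr1 big1 ?addr0// => k _.
by rewrite lift0 expr0n/= mulr0.
Qed.

(** With [r = q + lam], [chi = (psi - r) / (id - Phi)] is positive and has nonpositive
    Taylor coefficients in the direction of decreasing arguments, except for the
    constant one, because the division by the linear factor shifts the signs by
    one. *)
Let chi_inv : exists b, exists2 V, pseries_on t0 b (fun h => V (t0 - h)) &
  forall t, 0 < t <= t0 -> V t * (psi t - (q + lam)) = t - Phi.
Proof.
have [a aF a0] := psi_series t00.
pose c := Poly [:: - (q + lam)].
have pF : pseries_on t0 (fun k => a k + c`_k) (fun h => psi (t0 - h) - (q + lam)).
  refine (pseries_on_eq _ (pseries_onD aF (pseries_on_poly (r := t0) c))) => h _.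
  by rewrite /c horner_Poly/= mul0r add0r.
have h0 : 0 < t0 - Phi < t0 by rewrite subr_gt0 Phit0/= gtrBl (lt_trans phi0).
have [|b [Q bQ QE] bN] := pseries_on_div h0 pF.
  by rewrite subKr psi_Phi subrr.
have {}bN k : (0 < k)%N -> 0 <= b k.
  apply: bN => j j0; rewrite /c coef_Poly addr_ge0 ?a0//.
  by case: j j0 => // j _; rewrite /= nth_nil.
have {}QE h : 0 <= h < t0 -> (Phi - (t0 - h)) * Q h = psi (t0 - h) - (q + lam).
  by move=> hh; rewrite -QE//; congr (_ * _); ring.
have Q_mono h k : 0 <= h -> h <= k -> k < t0 -> Q h <= Q k.
  move=> hp hk kt.
  have [_ ch] := bQ h (introT andP (conj hp (le_lt_trans hk kt))).
  have [_ ck] := bQ k (introT andP (conj (le_trans hp hk) kt)).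
  apply: (ler_cvg_to ch ck); apply: nearW => n; apply: ler_sum => -[[|i] ni] _ /=.
    by rewrite !expr0.
  by rewrite ler_wpM2l ?bN// lerXn2r// nnegrE (le_trans hp).
have Q_neg h : 0 <= h -> h < t0 -> Q h < 0.
  move=> hp ht; have [hl|hg|he] := ltgtP h (t0 - Phi); last 2 first.
  - have := QE h; rewrite hp ht => /(_ isT) E.
    have p0 : 0 < Phi - (t0 - h) by lra.
    have : psi (t0 - h) < q + lam by apply: psi_lt; lra.
    by rewrite -subr_lt0 -E pmulr_rlt0.
  - have ? := Phit0.
    pose k := (t0 - Phi + t0) / 2.
    have kh : h <= k by rewrite he /k; have := phi0; have := phiPhi; lra.
    have kt : k < t0 by rewrite /k; have := phi0; have := phiPhi; lra.
    apply: (le_lt_trans (Q_mono _ _ hp kh kt)).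
    have kp : 0 <= k by exact: le_trans kh.
    have := QE k; rewrite kp kt => /(_ isT) E.
    have p0 : 0 < Phi - (t0 - k) by rewrite /k; have := phi0; have := phiPhi; lra.
    have : psi (t0 - k) < q + lam.
      by apply: psi_lt; rewrite /k; have := phi0; have := phiPhi; lra.
    by rewrite -subr_lt0 -E pmulr_rlt0.
  have := QE h; rewrite hp ht => /(_ isT) E.
  have p0 : Phi - (t0 - h) < 0 by lra.
  have : q + lam < psi (t0 - h) by apply: psi_gt; lra.
  by rewrite -subr_gt0 -E nmulr_rgt0.
have [|k|h /andP[hp ht]|v vV] := pseries_on_inv (pseries_onZ (-1) bQ).
- by rewrite -(pseries_on_at0 t00 bQ) mulN1r oppr_gt0 Q_neg.
- by rewrite mulN1r oppr_le0 bN.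
- by rewrite mulN1r oppr_gt0 Q_neg.
exists v, (fun t => (-1 * Q (t0 - t))^-1).
  by refine (pseries_on_eq _ vV) => h _; rewrite subKr.
move=> t /andP[tp tt0]; have hp : 0 <= t0 - t by rewrite subr_ge0.
have ht : t0 - t < t0 by rewrite gtrBl.
have := QE (t0 - t); rewrite hp ht subKr => /(_ isT) <-.
by field; rewrite ltr0_neq0// Q_neg.
Qed.

(** [kappa] continues the first term of the transform of the value function to all
    positive arguments.  The factor [1 / chi] takes care of the zero of [psi - r] at
    [Phi], and the remaining two divisions are by linear factors at points where
    the numerator vanishes: [G] at [Phi], and the whole expression at [phi], since
    [psi phi - r = - lam] there. *)
Lemma transform_series (G : R -> R) : (exists g, pseries_on t0 g (fun h => G (t0 - h))) ->
  G Phi = 0 -> exists k, exists2 kappa, pseries_on t0 k (fun h => kappa (t0 - h)) &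
  forall t, 0 < t <= t0 -> (t - phi) * kappa t * (psi t - (q + lam)) =
    G phi * (psi t - (q + lam)) + lam * G t.
Proof.
move=> [g gG] GPhi; have [v [V vV VE]] := chi_inv.
have h0 : 0 < t0 - Phi < t0 by rewrite subr_gt0 Phit0/= gtrBl (lt_trans phi0).
have [|n [nu nN nE] _] := pseries_on_div h0 gG; first by rewrite subKr.
have phit0 : phi < t0 by exact: lt_trans Phit0.
have h1 : 0 < t0 - phi < t0 by rewrite subr_gt0 phit0/= gtrBl.
pose c := Poly [:: G phi].
have NF := pseries_onD (pseries_on_poly (r := t0) c) (pseries_onZ (- lam) (pseries_onM nN vV)).
have cE h : c.[h] = G phi by rewrite /c horner_Poly/= mul0r add0r.
have rhoE t : 0 < t <= t0 -> - nu (t0 - t) * V t * (psi t - (q + lam)) = G t.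
  move=> tt; rewrite -mulrA VE//; case/andP: tt => tp tt0.
  have ht : 0 <= t0 - t < t0 by rewrite subr_ge0 tt0 gtrBl.
  have := nE _ ht; rewrite subKr => <-; ring.
have [|k [K kK KE] _] := pseries_on_div h1 NF.
  have phi1 : 0 < phi <= t0 by rewrite phi0 ltW.
  have E := rhoE phi phi1; rewrite psi_phi in E.
  by rewrite cE subKr -E; ring.
exists (fun j => -1 * k j), (fun t => -1 * K (t0 - t)).
  by refine (pseries_on_eq _ (pseries_onZ (-1) kK)) => h _; rewrite subKr.
move=> t tt; case/andP: (tt) => tp tt0.
have ht : 0 <= t0 - t < t0 by rewrite subr_ge0 tt0 gtrBl.
have := KE _ ht; rewrite cE subKr => E.
rewrite -[in RHS](rhoE t tt).
have -> : (t - phi) * (-1 * K (t0 - t)) = (t0 - t - (t0 - phi)) * K (t0 - t) by ring.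
by rewrite E; ring.
Qed.

End transform_series.

(** In this section [u y - c] is the slope [g (a1 + y)] seen from the lower barrier
    [a1], so that [G] is its Laplace transform, and [GPhi] says that [a1] has been
    chosen to cancel the pole at [Phi].  By [KG], [t G t] is asymptotically at least
    [K] as [t] tends to 0.  [rho0 x] is [rho] at [a1 + x], and [M x] is
    [exp (phi x) Gamma(a1, a1 + x)]. *)
Section value_function.
Context (R : realType) (psi : R -> R) (q lam phi Phi : R).
Context (q0 : 0 < q) (lam0 : 0 < lam) (phi0 : 0 < phi) (phiPhi : phi < Phi).
Context (psi_phi : psi phi = q) (psi_Phi : psi Phi = q + lam).
Context (psi_lt : forall t, 0 <= t -> t < Phi -> psi t < q + lam).
Context (psi_gt : forall t, Phi < t -> q + lam < psi t).
Context (psi_series : forall t0, 0 < t0 ->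
  exists2 a, pseries_on t0 a (fun h => psi (t0 - h)) & forall k, (0 < k)%N -> 0 <= a k.+1).
Context (psi_near0 : forall e eta : R, 0 < e -> 0 < eta -> exists2 t, 0 < t < eta & - e < psi t).
Context (W : R -> R) (WN : causal_nondecreasing W).
Context (LW : forall t, Phi < t -> has_laplace W t (psi t - (q + lam))^-1).
Context (u U : R -> R) (uN : causal_nondecreasing u) (c : R) (c0 : 0 <= c).
Context (LU : forall t, 0 < t -> has_laplace u t (U t)).
Context (dl K C : R) (dl0 : 0 < dl) (KG : forall t, 0 < t -> K - t * C <= t * (U t - c / t)).
Context (Kdl : (q + lam) * dl < K) (GPhi : U Phi - c / Phi = 0).
Implicit Types (t h x y : R).

Let G t := U t - c / t.
Let E := causal_exp phi.
Let step := @heaviside R.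
Let r1 := conv u W.
Let r2 := conv step W.
Let rho0 x := r1 x - c * r2 x.
Let M x := G phi * E x + lam * (conv r1 E x - c * conv r2 E x) - lam * dl / phi * step x.

Let EN : causal_nondecreasing E. Proof. by apply: causal_nondecreasing_exp; exact: ltW. Qed.
Let stepN : causal_nondecreasing step. Proof. exact: causal_nondecreasing_exp. Qed.
Let r1N : causal_nondecreasing r1. Proof. exact: causal_conv. Qed.
Let r2N : causal_nondecreasing r2. Proof. exact: causal_conv. Qed.
Let Phi0 : 0 < Phi. Proof. exact: lt_trans phiPhi. Qed.

Let laplaceM t : Phi < t -> has_laplace M t
  ((G phi + lam * (G t * (psi t - (q + lam))^-1)) / (t - phi) - lam * dl / phi * t^-1).
Proof.
move=> Pt; have t0 : 0 < t by exact: lt_trans Pt.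
have LE : has_laplace E t (t - phi)^-1.
  by apply: has_laplace_exp; rewrite (ltW phi0)/= (lt_trans phiPhi).
have Ls : has_laplace step t t^-1 by exact: has_laplace_heaviside.
have L1 := has_laplace_conv r1N EN (has_laplace_conv uN WN (LU t0) (LW Pt)) LE.
have L2 := has_laplace_conv r2N EN (has_laplace_conv stepN WN Ls (LW Pt)) LE.
have := has_laplaceD (has_laplaceD (has_laplaceZ (G phi) LE)
  (has_laplaceZ lam (has_laplaceD L1 (has_laplaceZ (- c) L2))))
  (has_laplaceZ (- (lam * dl / phi)) Ls).
rewrite (_ : _ + _ = (G phi + lam * (G t * (psi t - (q + lam))^-1)) / (t - phi) -
  lam * dl / phi * t^-1); last first.
  have psit : psi t - (q + lam) != 0 by rewrite gt_eqF// subr_gt0 psi_gt.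
  have tphi : t - phi != 0 by rewrite gt_eqF// subr_gt0 (lt_trans phiPhi).
  by rewrite /G; field; rewrite psit tphi !gt_eqF.
apply: has_laplace_eq => x x0; rewrite /M.
move: (G phi) (E x) (conv r1 E x) (conv r2 E x) (step x) (lam * dl / phi) => y1 y2 y3 y4 y5 y6.
ring.
Qed.

Let I x := \int[lebesgue_measure]_(y in `[0, x]) (expR (- (phi * y)) * rho0 y).

Let integrable_discounted v x : causal_nondecreasing v ->
  lebesgue_measure.-integrable (`[0, x] : set R) (EFin \o (fun y => expR (- (phi * y)) * v y)).
Proof.
move=> vN; apply: (@bounded_integrable _ _ _ _ (v x)); first exact: measurable_laplace.
move=> y /andP[y0 yx]; rewrite ger0_norm; last by rewrite mulr_ge0 ?expR_ge0 ?causal_ge0.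
rewrite -[leRHS]mul1r ler_pM ?expR_ge0 ?causal_ge0//; last by apply: vN.1.
by rewrite expR_le1 oppr_le0 mulr_ge0// ltW.
Qed.

Let conv_discounted v x : 0 <= x -> causal_nondecreasing v -> conv v E x =
  expR (phi * x) * \int[lebesgue_measure]_(y in `[0, x]) (expR (- (phi * y)) * v y).
Proof.
move=> x0 vN; rewrite -RintegralZl//; last exact: integrable_discounted.
apply: eq_Rintegral => y /set_mem; rewrite /= in_itv/= => /andP[y0 yx].
rewrite /E /causal_exp subr_ge0 yx mulrA -expRD mulrC.
by congr (expR _ * _); ring.
Qed.

Let rho0_integrable x :
  lebesgue_measure.-integrable (`[0, x] : set R) (EFin \o (fun y => expR (- (phi * y)) * rho0 y)).
Proof.
have i1 := integrable_discounted x r1N; have i2 := integrable_discounted x r2N.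
rewrite (_ : EFin \o _ = EFin \o (fun y => expR (- (phi * y)) * r1 y -
  c * (expR (- (phi * y)) * r2 y))).
  exact: (integrableB _ i1 (integrableZl _ c i2)).
by apply/funext => y; rewrite /= /rho0; congr EFin; ring.
Qed.

Lemma value_functionE x : 0 <= x ->
  M x = expR (phi * x) * (G phi + lam * I x - lam * dl / phi * expR (- (phi * x))).
Proof.
move=> x0; have i1 := integrable_discounted x r1N; have i2 := integrable_discounted x r2N.
have -> : I x = \int[lebesgue_measure]_(y in `[0, x]) (expR (- (phi * y)) * r1 y) -
    c * \int[lebesgue_measure]_(y in `[0, x]) (expR (- (phi * y)) * r2 y).
  rewrite -RintegralZl// -RintegralB//; last exact: (integrableZl _ c i2).
  by apply: eq_Rintegral => y _; rewrite /rho0; ring.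
rewrite /M !conv_discounted// /E /step /causal_exp x0 heavisideE x0.
have ee : expR (phi * x) * (lam * dl / phi * expR (- (phi * x))) = lam * dl / phi.
  by rewrite mulrCA -expRD subrr expR0 mulr1.
rewrite [RHS]mulrBr ee mulr1; move: (expR _) (\int[_]_(_ in _) _) (\int[_]_(_ in _) _) (G phi) (lam * dl / phi) => y1 y2 y3 y4 y5.
ring.
Qed.

Let t0 := Phi + 1.
Let Pt0 : Phi < t0. Proof. by rewrite ltrDl. Qed.
Let t00 : 0 < t0. Proof. exact: lt_trans Pt0. Qed.

Let kappa_ex : exists k, exists2 kappa, pseries_on t0 k (fun h => kappa (t0 - h)) &
  forall t, 0 < t <= t0 -> (t - phi) * kappa t * (psi t - (q + lam)) =
    G phi * (psi t - (q + lam)) + lam * G t.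
Proof.
apply: (transform_series phi0 phiPhi psi_phi psi_Phi psi_lt psi_gt psi_series Pt0) => //.
have [|a aU] := @pseries_on_laplace R u t0 t0 U t00 uN.
  by move=> h /andP[h0 ht]; apply: LU; rewrite subr_gt0.
have HG := pseries_onD aU (pseries_onZ (- c) (pseries_on_geometric t00)).
by eexists; refine (pseries_on_eq _ HG) => h _; rewrite /G mulNr.
Qed.

Let measurableM : measurable_fun (`[0, +oo[ : set R) M.
Proof.
have m v D : causal_nondecreasing v -> measurable D -> measurable_fun D v.
  by move=> vN mD; exact: causal_measurable.
apply: measurable_funB; last by apply: measurable_funM => //; exact: m.
apply: measurable_funD; first by apply: measurable_funM => //; exact: m.
apply: measurable_funM => //; apply: measurable_funB; first by apply: m => //; exact: causal_conv.
by apply: measurable_funM => //; apply: m => //; exact: causal_conv.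
Qed.

(** If [M] were nonpositive, Pringsheim's theorem would identify its transform with
    [kappa t - lam dl / (phi t)] for all positive [t].  But [t] times this is
    asymptotically at least [lam / phi (K / (q + lam) - dl) > 0] as [t] tends to 0. *)
Lemma value_function_pos : exists2 x, 0 <= x & 0 < M x.
Proof.
apply/not_exists2P => Mneg.
have {}Mneg x : 0 <= x -> 0 <= -1 * M x.
  by move=> x0; rewrite mulN1r oppr_ge0 leNgt; apply/negP; have [] := Mneg x.
have [k [kappa kS kE]] := kappa_ex.
pose F t := -1 * kappa t + lam * dl / phi * t^-1.
have FS : pseries_on t0 (fun j => -1 * k j + lam * dl / phi * t0^-1 ^+ j.+1) (fun h => F (t0 - h)).
  exact: (pseries_onD (pseries_onZ (-1) kS) (pseries_onZ _ (pseries_on_geometric t00))).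
have t0P : 0 < t0 - Phi by rewrite subr_gt0.
have mM : measurable_fun (`[0, +oo[ : set R) (fun x => -1 * M x) by exact: measurable_funM.
have key := laplace_pringsheim t0P t00 mM Mneg _ FS.
have {}key t : 0 < t < t0 -> 0 <= F t.
  move=> /andP[tp tt].
  have : laplace (fun x => -1 * M x) (t0 - (t0 - t)) = (F (t0 - (t0 - t)))%:E.
    apply: key; last by rewrite subr_ge0 ltW//= gtrBl.
    move=> h /andP[h0 ht]; have Pth : Phi < t0 - h by lra.
    have [_ ->] := has_laplaceZ (-1) (laplaceM Pth).
    have := kE (t0 - h); rewrite gerBl h0 (lt_trans Phi0 Pth) => /(_ isT).
    have psit : psi (t0 - h) - (q + lam) != 0 by rewrite gt_eqF// subr_gt0 psi_gt.
    have tphi : t0 - h - phi != 0 by rewrite gt_eqF// subr_gt0 (lt_trans phiPhi).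
    move=> e; congr EFin.
    have -> : G phi + lam * (G (t0 - h) / (psi (t0 - h) - (q + lam))) = (t0 - h - phi) * kappa (t0 - h).
      by apply: (mulIf psit); rewrite e; field.
    by rewrite [_ * kappa _]mulrC mulfK// /F; ring.
  rewrite subKr => e; rewrite -lee_fin -e; apply: integral_ge0 => x; rewrite /= in_itv/= andbT => x0.
  by rewrite lee_fin mulr_ge0 ?expR_ge0 ?Mneg.
(* [t (phi - t) (q + lam - psi t) F t] is negative for small [t] with [psi t > - e];
   [e] and [eta] are chosen to absorb the terms that vanish as [t] tends to 0 *)
pose e := (K - (q + lam) * dl) / (2 * dl).
have e0 : 0 < e by rewrite divr_gt0 ?subr_gt0// mulr_gt0.
pose B := lam * `|C| + `|G phi| * (q + lam + e) + 1.
have B0 : 0 < B by rewrite ltr_wpDl// addr_ge0// mulr_ge0// ?ltW// !addr_gt0.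
pose eta := Num.min phi (lam * (K - (q + lam) * dl) / (2 * B)).
have eta0 : 0 < eta by rewrite lt_min phi0 divr_gt0 ?mulr_gt0 ?subr_gt0.
have [t /andP[tp] + tpsi] := psi_near0 e0 eta0.
rewrite lt_min => /andP[tphi tB].
have tt0 : t < t0 by rewrite (lt_trans tphi)// (lt_trans phiPhi).
have := key t; rewrite tp tt0 => /(_ isT) Ft.
have psit := psi_lt (ltW tp) (lt_trans tphi phiPhi).
have := kE t; rewrite tp (ltW tt0) => /(_ isT) kt.
have s0 : 0 < q + lam - psi t by rewrite subr_gt0.
have := KG tp; rewrite -/(G t) => Gt.
have h1 : 0 <= t * (phi - t) * (q + lam - psi t) * F t.
  by rewrite !mulr_ge0// ?(ltW tp) ?(ltW s0)// subr_ge0 ltW.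
have h2 : t * (phi - t) * (q + lam - psi t) * F t =
    - (t * G phi * (psi t - (q + lam)) + lam * (t * G t)) +
    lam * dl * (phi - t) / phi * (q + lam - psi t).
  have -> : t * G phi * (psi t - (q + lam)) + lam * (t * G t) =
      t * ((t - phi) * kappa t * (psi t - (q + lam))) by rewrite kt; ring.
  by rewrite /F; field; rewrite !gt_eqF.
have s1 : q + lam - psi t <= q + lam + e by lra.
move: h1; rewrite h2; apply/negP; rewrite -ltNge.
set s := q + lam - psi t in s0 s1 *.
have -> : psi t - (q + lam) = - s by rewrite /s; ring.
have a1 : lam * dl * (phi - t) / phi * s <= lam * dl * s.
  rewrite ler_wpM2r ?(ltW s0)// ler_pdivrMr// ler_wpM2l ?mulr_ge0 ?(ltW lam0) ?(ltW dl0)//.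
  by rewrite gerBl ltW.
have a2 : lam * dl * s <= lam * dl * (q + lam + e).
  by rewrite ler_wpM2l// mulr_ge0// ltW.
have a3 : lam * dl * (q + lam + e) = lam * (K + (q + lam) * dl) / 2.
  by rewrite /e; field; rewrite gt_eqF.
have a4 : t * G phi * s <= t * (`|G phi| * (q + lam + e)).
  rewrite -mulrA ler_wpM2l ?(ltW tp)//.
  apply: (@le_trans _ _ (`|G phi| * s)); first by rewrite ler_wpM2r ?ler_norm ?(ltW s0).
  by rewrite ler_wpM2l.
have a5 : lam * (K - t * C) <= lam * (t * G t) by rewrite ler_wpM2l// ltW.
have a6 : t * (lam * C) <= t * (lam * `|C|).
  by rewrite ler_wpM2l ?(ltW tp)// ler_wpM2l ?ler_norm// ltW.
have a7 : t * B < lam * (K - (q + lam) * dl) / 2.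
  rewrite -ltr_pdivlMr//.
  suff <- : lam * (K - (q + lam) * dl) / (2 * B) = lam * (K - (q + lam) * dl) / 2 / B by [].
  by field; rewrite gt_eqF.
have a8 : t * G phi * - s = - (t * G phi * s) by ring.
rewrite a8 {a8}; rewrite /B (mulrDr t) mulr1 (mulrDr t) in a7.
move: (t * G phi * s) (lam * dl * (phi - t) / phi * s) (lam * dl * s) a1 a2 a3 a4 => y1 y2 y3.
move: (lam * dl * (q + lam + e)) (t * (`|G phi| * (q + lam + e))) a5 a6 a7 => y4 y5.
by lra.
Qed.

(** If [M] grew like [exp (phi x)], its transform would be infinite at [phi].  But
    [M + B] is nonnegative for some constant [B], so that Pringsheim's theorem makes
    its transform there a value of the series of [kappa], up to a finite term. *)
Lemma value_function_not_exp (x0 eps : R) : 0 <= x0 -> 0 < eps ->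
  ~ (forall x, x0 <= x -> eps * E x <= M x).
Proof.
move=> x00 eps0 epsM.
have E0 x : 0 <= E x by exact: causal_ge0.
pose B := `|G phi| * E x0 + lam * c * conv r2 E x0 + lam * dl / phi.
have B0 : 0 <= B.
  rewrite !addr_ge0 ?mulr_ge0 ?invr_ge0 ?(ltW lam0) ?(ltW dl0) ?(ltW phi0)//.
  by apply: causal_ge0; exact: causal_conv.
have MB x : 0 <= x -> 0 <= M x + B * step x.
  move=> xp; rewrite /step heavisideE xp mulr1.
  have [xx0|xx0] := leP x0 x.
    by rewrite addr_ge0// (le_trans _ (epsM x xx0))// mulr_ge0// ltW.
  rewrite /M /step heavisideE xp mulr1.
  have c1 := causal_conv r1N EN; have c2 := causal_conv r2N EN.
  have h1 := causal_ge0 x c1; have h2 := c2.1 _ _ (ltW xx0); have h3 := EN.1 _ _ (ltW xx0).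
  have h4 : - (`|G phi| * E x0) <= G phi * E x.
    apply: (@le_trans _ _ (- (`|G phi| * E x))); first by rewrite lerN2 ler_wpM2l.
    by rewrite -mulNr ler_wpM2r// lerNl -normrN ler_norm.
  have h5 : lam * c * conv r2 E x <= lam * c * conv r2 E x0 by rewrite ler_wpM2l// mulr_ge0// ltW.
  have h6 : 0 <= lam * conv r1 E x by apply: mulr_ge0 h1; exact: ltW.
  rewrite /B; move: (conv r1 E x) (conv r2 E x) (conv r2 E x0) (`|G phi| * E x0) h4 h5 h6.
  move: (G phi * E x) (lam * dl / phi) => y1 y2 y3 y4 y5 y6 h4 h5 h6.
  have -> : y1 + lam * (y3 - c * y4) - y2 + (y6 + lam * c * y5 + y2) =
    (y1 + y6) + y3 * lam + (lam * c * y5 - lam * c * y4) by ring.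
  by rewrite addr_ge0 ?subr_ge0// addr_ge0 ?[y3 * _]mulrC// -lerBlDr sub0r.
have [k [kappa kS kE]] := kappa_ex.
pose F t := kappa t + (B - lam * dl / phi) * t^-1.
have FS := pseries_onD kS (pseries_onZ (B - lam * dl / phi) (pseries_on_geometric t00)).
have t0P : 0 < t0 - Phi by rewrite subr_gt0.
have mM : measurable_fun (`[0, +oo[ : set R) (fun x => M x + B * step x).
  by apply: measurable_funD => //; apply: measurable_funM => //; exact: causal_measurable.
have key := @laplace_pringsheim _ _ t0 _ _ _ F t0P t00 mM MB _ FS.
have : laplace (fun x => M x + B * step x) (t0 - (t0 - phi)) = (F (t0 - (t0 - phi)))%:E.
  apply: key; last by rewrite subr_ge0 ltW ?(lt_trans phiPhi)//= gtrBl.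
  move=> h /andP[h0 ht]; have Pth : Phi < t0 - h by lra.
  have [_ ->] := has_laplaceD (laplaceM Pth) (has_laplaceZ B (has_laplace_heaviside (lt_trans Phi0 Pth))).
  have := kE (t0 - h); rewrite gerBl h0 (lt_trans Phi0 Pth) => /(_ isT).
  have psit : psi (t0 - h) - (q + lam) != 0 by rewrite gt_eqF// subr_gt0 psi_gt.
  have tphi : t0 - h - phi != 0 by rewrite gt_eqF// subr_gt0 (lt_trans phiPhi).
  move=> e; congr EFin.
  have -> : G phi + lam * (G (t0 - h) / (psi (t0 - h) - (q + lam))) = (t0 - h - phi) * kappa (t0 - h).
    by apply: (mulIf psit); rewrite e; field.
  by rewrite [_ * kappa _]mulrC mulfK// /F; ring.
rewrite subKr => e.
have : (+oo <= laplace (fun x => (M x + B * step x)%R) phi)%E.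
  apply: (@le_trans _ _ (\int[lebesgue_measure]_(x in `[x0, +oo[) eps%:E)%E).
    rewrite integral_cst//= lebesgue_measure_itv/= ltry.
    by rewrite addye// gt0_muley// lte_fin.
  apply: (@le_trans _ _ (\int[lebesgue_measure]_(x in `[x0, +oo[)
      (expR (- (phi * x)) * (M x + B * step x))%R%:E)%E).
    apply: ge0_le_integral => //.
    - by move=> x _; rewrite lee_fin ltW.
    - apply/measurable_EFinP; apply: measurable_funM.
        by apply: measurableT_comp => //; apply: measurable_funN; exact: measurable_funM.
      by apply: measurable_funS mM => //; apply: subset_itvr; rewrite bnd_simp.
    - move=> x; rewrite /= in_itv/= andbT => xx0; rewrite lee_fin.
      have xp := le_trans x00 xx0.
      apply: (@le_trans _ _ (expR (- (phi * x)) * (eps * E x))).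
        rewrite /E /causal_exp xp mulrCA -expRD addrC subrr expR0 mulr1//.
      rewrite ler_wpM2l ?expR_ge0//; apply: le_trans (epsM x xx0) _.
      by rewrite lerDl mulr_ge0// causal_ge0.
  apply: ge0_subset_integral => //.
  - apply/measurable_EFinP; apply: measurable_funM => //.
    by apply: measurableT_comp => //; apply: measurable_funN; exact: measurable_funM.
  - by move=> x; rewrite /= in_itv/= andbT => xp; rewrite lee_fin mulr_ge0 ?expR_ge0 ?MB.
  - by apply: subset_itvr; rewrite bnd_simp.
by rewrite e leye_eq.
Qed.

(** Otherwise [rho0 > - dl] wherever [M] is nonnegative.  Beyond a point where [M] is
    positive, [m x = exp (- phi x) M x] increases as long as [rho0 > - dl], so that
    neither condition can ever fail first; hence [M] grows like [exp (phi x)]. *)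
Lemma value_function_crossing : exists2 x, 0 < x & rho0 x + dl <= 0 /\ 0 <= M x.
Proof.
apply: contrapT => H.
have {}H x : 0 <= x -> 0 <= M x -> 0 < rho0 x + dl.
  rewrite le_eqVlt => /predU1P[<- _|x0 Mx].
    have conv0 v : causal_nondecreasing v -> conv v W 0 = 0.
      by move=> vN; rewrite /conv set_itv1 Rintegral_set1.
    by rewrite /rho0 /r1 /r2 !conv0// mulr0 subr0 add0r.
  by rewrite ltNge; apply/negP => r0; apply: H; exists x.
have [x0 x00 Mx0] := value_function_pos.
pose m x := G phi + lam * I x - lam * dl / phi * expR (- (phi * x)).
have Mm x : 0 <= x -> M x = expR (phi * x) * m x by exact: value_functionE.
have mx0 : 0 < m x0 by move: Mx0; rewrite Mm// pmulr_rgt0// expR_gt0.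
have m_incr x : x0 <= x -> (forall y, x0 <= y <= x -> - dl <= rho0 y) -> m x0 <= m x.
  move=> xx0 Hy; have xp := le_trans x00 xx0.
  pose J := \int[lebesgue_measure]_(y in `[x0, x]) (expR (- (phi * y)) * rho0 y).
  have Ix : I x = I x0 + J := Rintegral_chasles x00 xx0 (rho0_integrable x).
  have iexp : lebesgue_measure.-integrable (`[x0, x] : set R) (EFin \o (fun y => - dl * expR (- (phi * y)))).
    apply: (@bounded_integrable _ _ _ _ dl).
      apply: measurable_funM => //.
      by apply: measurableT_comp => //; apply: measurable_funN; exact: measurable_funM.
    move=> y /andP[y0 _]; rewrite normrM normrN (gtr0_norm dl0) (gtr0_norm (expR_gt0 _)).
    rewrite -[leRHS]mulr1 ler_wpM2l ?(ltW dl0)// expR_le1 oppr_le0 mulr_ge0 ?(ltW phi0)//.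
    exact: le_trans y0.
  have iexp1 : lebesgue_measure.-integrable (`[x0, x] : set R) (EFin \o (fun y => expR (- (phi * y)))).
    apply: (@bounded_integrable _ _ _ _ 1).
      by apply: measurableT_comp => //; apply: measurable_funN; exact: measurable_funM.
    move=> y /andP[y0 _]; rewrite (gtr0_norm (expR_gt0 _)) expR_le1 oppr_le0 mulr_ge0 ?(ltW phi0)//.
    exact: le_trans y0.
  have HJ : - dl * ((expR (- (phi * x0)) - expR (- (phi * x))) / phi) <= J.
    rewrite -Rintegral_expRN// -RintegralZl//; apply: le_Rintegral => //.
      by apply: integrableS (rho0_integrable x) => //; apply: subset_itvr; rewrite bnd_simp.
    move=> y; rewrite /= in_itv/= => yx; rewrite mulrC ler_wpM2l ?expR_ge0//; exact: Hy.
  rewrite /m Ix; have := ler_wpM2l (ltW lam0) HJ.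
  rewrite (_ : lam * (- dl * _) = - (lam * dl / phi * expR (- (phi * x0))) +
    lam * dl / phi * expR (- (phi * x))); last by field; rewrite gt_eqF.
  rewrite [lam * (_ + J)]mulrDr; move: (lam * J) (lam * I x0) (G phi) => y1 y2 y3.
  move: (lam * dl / phi * expR (- (phi * x))) (lam * dl / phi * expR (- (phi * x0))) => y4 y5 h.
  rewrite -subr_ge0 (_ : _ - _ = y1 - (- y5 + y4)); last by ring.
  by rewrite subr_ge0.
have rho_pos x : x0 <= x -> 0 < rho0 x + dl.
  move=> xx0; rewrite ltNge; apply/negP => rx.
  pose Z := [set y | x0 <= y <= x /\ rho0 y + dl <= 0].
  have Zx : Z x by split; rewrite ?xx0 ?lexx.
  have Zlb : has_inf Z by split; [exists x|exists x0 => y [/andP[]]].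
  pose y := inf Z.
  have yx0 : x0 <= y by apply: lb_le_inf; [exists x|move=> z [/andP[]]].
  have yx : y <= x by apply: inf_lbound => //; case: Zlb.
  have yp := le_trans x00 yx0.
  have before z : x0 <= z -> z < y -> 0 < rho0 z + dl.
    move=> z0 zy; rewrite ltNge; apply/negP => rz.
    have : y <= z by apply: inf_lbound; [case: Zlb|split=> //; rewrite z0 (le_trans (ltW zy))].
    by rewrite leNgt zy.
  have rcont e : 0 < e -> exists2 d, 0 < d & forall z, 0 <= z -> `|z - y| < d -> `|rho0 z - rho0 y| < e.
    move=> e0; have e2 : 0 < e / (2 * (1 + c)).
      by rewrite divr_gt0// mulr_gt0// ltr_pwDl.
    have [d1 d10 H1] := conv_continuous uN WN yp (divr_gt0 e0 (ltr0Sn _ 1)).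
    have [d2 d20 H2] := conv_continuous stepN WN yp e2.
    exists (Num.min d1 d2); first by rewrite lt_min d10.
    move=> z z0; rewrite lt_min => /andP[zd1 zd2]; rewrite /rho0.
    have -> : r1 z - c * r2 z - (r1 y - c * r2 y) = (r1 z - r1 y) - c * (r2 z - r2 y) by ring.
    apply: le_lt_trans (ler_normB _ _) _; rewrite normrM (ger0_norm c0).
    have := H1 z z0 zd1; have := ltW (H2 z z0 zd2).
    rewrite -/r1 -/r2; move: (`|r1 z - r1 y|) (`|r2 z - r2 y|) => p1 p2 h2 h1.
    have : c * p2 <= c * (e / (2 * (1 + c))) by rewrite ler_wpM2l.
    have : c * (e / (2 * (1 + c))) <= e / 2.
      have c1 : 0 < 1 + c by rewrite ltr_pwDl.
      rewrite invfM mulrCA mulrA mulrA ler_pdivrMr//.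
      have : 0 <= e / 2 by rewrite divr_ge0// ltW.
      nra.
    lra.
  have ry0 : 0 <= rho0 y + dl.
    move: yx0; rewrite le_eqVlt => /predU1P[<-|x0y]; first by rewrite ltW// H// ltW.
    rewrite leNgt; apply/negP; rewrite -oppr_gt0 => ry; have [d d0 Hd] := rcont _ ry.
    pose z := Num.max x0 (y - d / 2).
    have zx0 : x0 <= z by rewrite le_max lexx.
    have zd : y - d / 2 <= z by rewrite le_max lexx orbT.
    have zy : z < y by rewrite gt_max x0y ltrBlDr ltrDl divr_gt0.
    have := Hd z (le_trans x00 zx0); rewrite distrC ger0_norm ?subr_ge0 ?(ltW zy)//.
    have dzy : y - z < d by lra.
    move=> /(_ dzy); have := before z zx0 zy.
    by rewrite ltr_norml => rz /andP[_]; lra.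
  have ry : 0 < rho0 y + dl.
    apply: H => //; rewrite Mm// mulr_ge0 ?expR_ge0//; apply: le_trans (ltW mx0) _.
    apply: m_incr => // z /andP[z0 zy]; rewrite -subr_ge0 opprK.
    move: zy; rewrite le_eqVlt => /predU1P[->|zy]; last exact/ltW/before.
    exact: ry0.
  have [d d0 Hd] := rcont _ ry.
  have [z [/andP[z0 zx] rz] zd] := inf_adherent d0 Zlb.
  have yz : y <= z by apply: inf_lbound; [case: Zlb|split => //; rewrite z0].
  have := Hd z (le_trans x00 z0); rewrite ger0_norm ?subr_ge0// ltrBlDl => /(_ zd).
  by rewrite distrC ltr_norml => /andP[_]; lra.
apply: (value_function_not_exp x00 mx0) => x xx0; have xp := le_trans x00 xx0.
rewrite Mm// /E /causal_exp xp mulrC ler_wpM2l ?expR_ge0//; apply: m_incr => // y /andP[y0 _].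
by rewrite -subr_ge0 opprK ltW// rho_pos.
Qed.

End value_function.

(** * The integral [rho] as a function of its endpoints *)

Section conv_associative.
Context (R : realType).
Local Notation leb := (@lebesgue_measure R).
Implicit Types (u v w : R -> R) (x y t : R).

(** Tonelli's theorem, both sides being the integral of [u z v (y - z) w (x - y)] over
    [y] and [z]. *)
Lemma convA u v w x : causal_nondecreasing u -> causal_nondecreasing v ->
  causal_nondecreasing w -> conv (conv u v) w x = conv u (conv v w) x.
Proof.
move=> uN vN wN; apply: EFin_inj.
have uvN := causal_conv uN vN; have vwN := causal_conv vN wN.
rewrite !EFin_conv//.
pose K (z : measurableTypeR R * measurableTypeR R) :=
  (u z.2 * v (z.1 - z.2) * w (x - z.1))%:E.
have K0 z : (0 <= K z)%E by rewrite lee_fin !mulr_ge0// causal_ge0.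
have mK : measurable_fun setT K.
  apply/measurable_EFinP; apply: measurable_funM.
    apply: measurable_funM.
      by apply: (@measurableT_comp _ _ _ _ _ _ u) => //; exact: causal_measurable.
    apply: (@measurableT_comp _ _ _ _ _ _ v); first exact: causal_measurable.
    exact: measurable_funB.
  apply: (@measurableT_comp _ _ _ _ _ _ w); first exact: causal_measurable.
  exact: measurable_funB.
transitivity (\int[leb]_y \int[leb]_z K (y, z))%E.
  apply: eq_integral => y _; rewrite EFinM EFin_conv// -ge0_integralZr//.
  - by apply/measurable_EFinP; exact: measurable_convolved.
  - by move=> z _; rewrite lee_fin mulr_ge0// causal_ge0.
  - by rewrite lee_fin causal_ge0.
rewrite (fubini_tonelli (m1 := leb) (m2 := leb) K mK K0).
apply: eq_integral => z _.
have mKz : measurable_fun setT (fun y => K (y, z)).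
  have mw : measurable_fun setT (fun y => w (x - y)).
    by apply: measurableT_comp; [exact: causal_measurable|exact: measurable_funB].
  have mv : measurable_fun setT (fun y => v (y - z)).
    by apply: measurableT_comp; [exact: causal_measurable|exact: measurable_funB].
  have mu : measurable_fun setT (fun y : R => u z) by exact: measurable_cst.
  by apply/measurable_EFinP; exact: (measurable_funM (measurable_funM mu mv) mw).
rewrite (integral_shift z measurableT mKz).
rewrite (_ : [set _ | _] = setT); last exact/seteqP.
rewrite EFinM EFin_conv// -ge0_integralZl_EFin ?causal_ge0//.
- by apply: eq_integral => y _; rewrite /K/= -EFinM [z + y]addrC addrK opprD [- y - z]addrC addrA mulrA.
- by move=> y _; rewrite lee_fin mulr_ge0// causal_ge0.
- by apply/measurable_EFinP; exact: measurable_convolved.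
Qed.

End conv_associative.

Section running_cost.
Context (R : realType) (g : R -> R) (g_nd : {homo g : x y / x <= y}).
Local Notation leb := (@lebesgue_measure R).
Implicit Types (V : R -> R) (a b c x y s t : R).

Let mg : measurable_fun setT g. Proof. exact: nondecreasing_measurable. Qed.

(** Subtracting the value at [a] turns [g (a + x)], [x >= 0], into a nonnegative
    function, to which the results on causal functions apply. *)
Definition excess a x := (g (x + a) - g a) * heaviside x.

Lemma causal_excess a : causal_nondecreasing (excess a).
Proof.
split=> [x y xy|x x0]; rewrite /excess !heavisideE; last by rewrite leNgt x0 mulr0.
have [x0|x0] := leP 0 x; last first.
  rewrite mulr0; case: (leP 0 y) => y0; last by rewrite mulr0.
  by rewrite mulr1 subr_ge0 g_nd// lerDr.
by rewrite (le_trans x0 xy) !mulr1 lerB// g_nd// lerD2r.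
Qed.

Section weighted.
Context (V : R -> R) (VN : causal_nondecreasing V).

Let mV b : measurable_fun setT (fun y => V (b - y)).
Proof. by apply: measurableT_comp; [exact: causal_measurable|exact: measurable_funB]. Qed.

Let weight_bound a b a' b' y : a <= y -> y <= b ->
  `|g y * V (b' - y)| <= (`|g a| + `|g b|) * V (b' - a).
Proof.
move=> ay yb; rewrite normrM ler_pM//.
  have h1 := g_nd ay; have h2 := g_nd yb; have h3 := ler_norm (g b); have h4 := ler_norm (- g a).
  rewrite normrN in h4.
  by rewrite ler_norml; apply/andP; split; have := normr_ge0 (g a); have := normr_ge0 (g b); lra.
by rewrite ger0_norm ?causal_ge0//; apply: VN.1; rewrite lerD2l lerN2.
Qed.

Let weight_integrable a a' b :
  leb.-integrable (`[a, a'] : set R) (EFin \o (fun y => g y * V (b - y))).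
Proof.
apply: (@bounded_integrable _ _ _ _ ((`|g a| + `|g a'|) * V (b - a))).
  by apply: measurable_funTS; exact: (measurable_funM mg (mV b)).
by move=> y /andP[ay ya]; exact: weight_bound.
Qed.

Lemma rho_diag a : rho V a a g = 0.
Proof. by rewrite /rho set_itv1 Rintegral_set1. Qed.

Lemma rho_split a a' b : a <= a' -> a' <= b ->
  rho V a b g = \int[leb]_(y in `[a, a']) (g y * V (b - y)) + rho V a' b g.
Proof. by move=> aa ab; exact: Rintegral_chasles. Qed.

(** As a function of its endpoint, [rho] is a combination of convolutions of
    nondecreasing functions. *)
Lemma rho_conv a x : 0 <= x ->
  rho V a (a + x) g = conv (excess a) V x + g a * conv (@heaviside R) V x.
Proof.
move=> x0; rewrite /rho -{1}[a]add0r [a + x]addrC Rintegral_shift_itv; last first.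
  exact: (measurable_funM mg (mV _)).
have eN := causal_excess a; have hN : causal_nondecreasing (@heaviside R).
  exact: causal_nondecreasing_exp.
rewrite /conv -RintegralZl//; last exact: causal_integrableM.
rewrite -RintegralD//; first last.
- have i2 := causal_integrableM x hN VN; exact: (integrableZl _ (g a) i2).
- exact: causal_integrableM.
apply: eq_Rintegral => y /set_mem; rewrite /= in_itv/= => /andP[y0 yx].
rewrite /excess heavisideE y0 !mulr1 (_ : x + a - (y + a) = x - y); last by ring.
by rewrite mul1r mulrBl subrK.
Qed.

Let split_le a a' b : a <= a' -> a' <= b -> g a' < 0 ->
  \int[leb]_(y in `[a, a']) (g y * V (b - y)) <= g a' * V (b - a') * (a' - a).
Proof.
move=> aa ab ga; apply: Rintegral_itv_le => // y /andP[ay ya].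
have h1 := g_nd ya; have h2 : V (b - a') <= V (b - y) by apply: VN.1; rewrite lerD2l lerN2.
have h3 := causal_ge0 (b - a') VN.
apply: (@le_trans _ _ (g a' * V (b - y))); first by rewrite ler_wpM2r// (le_trans h3).
by rewrite ler_wnM2l// ltW.
Qed.

Lemma rho_le a a' b : a <= a' -> a' <= b -> g a' < 0 -> rho V a b g <= rho V a' b g.
Proof.
move=> aa ab ga; rewrite (rho_split aa ab) gerDr; apply: le_trans (split_le aa ab ga) _.
by rewrite mulr_le0_ge0 ?subr_ge0// mulr_le0_ge0 ?(ltW ga)//; exact: causal_ge0.
Qed.

Lemma rho_lt a a' b : (forall x, 0 < x -> 0 < V x) -> a < a' -> a' <= b -> g a' < 0 ->
  rho V a b g < rho V a' b g.
Proof.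
move=> V0 aa ab ga; pose m := (a + a') / 2.
have am : a < m by rewrite /m; lra.
have ma : m < a' by rewrite /m; lra.
have gm : g m < 0 by apply: le_lt_trans ga; apply: g_nd; exact: ltW.
have mb := lt_le_trans ma ab.
apply: (@lt_le_trans _ _ (rho V m b g)); last exact: rho_le (ltW ma) ab ga.
rewrite (rho_split (ltW am) (ltW mb)) gtrDr; apply: le_lt_trans (split_le (ltW am) (ltW mb) gm) _.
by rewrite pmulr_llt0 ?subr_gt0// pmulr_llt0// V0// subr_gt0.
Qed.

Lemma rho_lipschitz B a a' b : B <= a -> a <= a' -> a' <= b -> g a' < 0 ->
  rho V a' b g - rho V a b g <= (- g B * V (b - B)) * (a' - a).
Proof.
move=> Ba aa ab ga; rewrite (rho_split aa ab) opprD addrC subrK lerNl -mulNr -mulNr opprK.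
apply: Rintegral_itv_ge => // y /andP[ay ya].
have h1 := g_nd ya; have h2 : g B <= g y by apply: g_nd; exact: le_trans ay.
have h3 : V (b - y) <= V (b - B) by apply: VN.1; rewrite lerD2l lerN2 (le_trans Ba).
have h4 := causal_ge0 (b - y) VN.
apply: (@le_trans _ _ (g B * V (b - y))); last by rewrite ler_wpM2r.
by rewrite ler_wnM2l// (le_trans h2)// (le_trans h1)// ltW.
Qed.

(** Far to the left the integrand is below a negative constant. *)
Lemma rho_unbounded x0 b K : (forall x, 0 < x -> 0 < V x) -> g x0 < 0 ->
  exists a, [/\ a < x0, a < b & rho V a b g < - K].
Proof.
move=> V0 gx0; pose m := Num.min x0 (b - 1).
have mx0 : m <= x0 by rewrite ge_min lexx.
have mb : m < b by rewrite gt_min ltrBlDr ltrDl ltr01 orbT.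
have gm : g m < 0 by apply: le_lt_trans gx0; exact: g_nd.
have k0 : 0 < - g m * V (b - m) by rewrite mulr_gt0 ?oppr_gt0// V0// subr_gt0.
pose a := m - (`|K + rho V m b g| + 1) / (- g m * V (b - m)).
have am : a < m by rewrite ltrBlDr ltrDl divr_gt0// ltr_wpDl.
exists a; split; [exact: lt_le_trans mx0|exact: lt_trans mb|].
rewrite (rho_split (ltW am) (ltW mb)).
have := split_le (ltW am) (ltW mb) gm.
have -> : g m * V (b - m) * (m - a) = - (`|K + rho V m b g| + 1).
  have V1 : 0 < V (b - m) by rewrite V0// subr_gt0.
  rewrite /a subKr; field; by rewrite (lt_eqF gm) (gt_eqF V1).
have := ler_norm (K + rho V m b g); move: (rho V m b g) (`|_|) => y1 y2.
by move: (Rintegral _ _ _) => y3; lra.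
Qed.

(** Start just before the sign change of [g]: the negative part of the integrand is
    bounded and lives on a short interval. *)
Lemma rho_ge x0 b e : g x0 < 0 -> 0 < e -> exists a, [/\ g a < 0, a <= b & - e < rho V a b g].
Proof.
move=> gx0 e0; have [gb|gb] := ltP (g b) 0.
  by exists b; rewrite gb lexx rho_diag oppr_lt0.
pose N := [set a | g a < 0].
have ub a : N a -> a <= b.
  by move=> /= ga; rewrite leNgt; apply/negP => /ltW/g_nd; rewrite leNgt (lt_le_trans ga).
have hN : has_sup N by split; [exists x0|exists b].
have x0b := ub _ gx0.
pose k := - g x0 * V (b - x0) + 1.
have k1 : 0 <= - g x0 * V (b - x0) by rewrite mulr_ge0 ?oppr_ge0 ?(ltW gx0)//; exact: causal_ge0.
have k0 : 0 < k by rewrite ltr_wpDl.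
pose d := e / (4 * k); have d0 : 0 < d by rewrite divr_gt0// mulr_gt0.
have [a0 Na0 sa0] := sup_adherent d0 hN.
pose a := Num.max a0 x0.
have Na : g a < 0 by rewrite /a maxEle; case: ifP.
have aS : a <= sup N by apply: sup_ubound => //; case: hN.
have aa0 : a0 <= a by rewrite le_max lexx.
have ax0 : x0 <= a by rewrite le_max lexx orbT.
pose c := Num.min b (sup N + d).
have Sb : sup N <= b by apply: ge_sup; [exists x0|move=> y; exact: ub].
have ac : a <= c by rewrite le_min (le_trans aS)//= (le_trans aS)// lerDl ltW.
have cb : c <= b by rewrite ge_min lexx.
exists a; split=> //; first exact: ub.
rewrite (rho_split ac cb).
have h1 : 0 <= rho V c b g.
  move: cb; rewrite le_eqVlt => /predU1P[->|cb]; first by rewrite rho_diag.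
  apply: Rintegral_ge0 => y; rewrite /= in_itv/= => /andP[cy yb].
  apply: mulr_ge0; last exact: causal_ge0.
  rewrite leNgt; apply/negP => gy.
  have : y <= sup N by apply: sup_ubound => //; case: hN.
  move: cb cy; rewrite /c gt_min ltxx/= => cb; rewrite ge_min => /orP[by'|cy]; lra.
have h2 : g x0 * V (b - x0) * (c - a) <= \int[leb]_(y in `[a, c]) (g y * V (b - y)).
  apply: Rintegral_itv_ge => // y /andP[ay ya].
  have h3 : g x0 <= g y by apply: g_nd; exact: le_trans ay.
  have h4 : V (b - y) <= V (b - x0) by apply: VN.1; rewrite lerD2l lerN2 (le_trans ax0).
  have h5 := causal_ge0 (b - y) VN.
  apply: (@le_trans _ _ (g x0 * V (b - y))); last by rewrite ler_wpM2r.
  by rewrite ler_wnM2l// ltW.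
have h3 : c - a <= 2 * d.
  have : c <= sup N + d by rewrite /c ge_min lexx orbT.
  lra.
have h4 : (- g x0 * V (b - x0)) * (c - a) <= k * (2 * d).
  by rewrite ler_pM ?subr_ge0// lerDl.
have h5 : k * (2 * d) = e / 2 by rewrite /d; field; rewrite gt_eqF.
by move: h2 h4; rewrite !mulNr; move: (_ * (c - a)) (Rintegral _ _ _) => y1 y2; lra.
Qed.

Lemma rho_continuous a b e : a <= b -> 0 < e -> exists2 d, 0 < d &
  forall b', a <= b' -> `|b' - b| < d -> `|rho V a b' g - rho V a b g| < e.
Proof.
move=> ab e0; have eN := causal_excess a.
have hN : causal_nondecreasing (@heaviside R) by exact: causal_nondecreasing_exp.
have ba : 0 <= b - a by rewrite subr_ge0.
have k0 : 0 < 1 + `|g a| by rewrite ltr_pwDl.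
have e2 : 0 < e / (2 * (1 + `|g a|)) by rewrite divr_gt0// mulr_gt0.
have [d1 d10 H1] := conv_continuous eN VN ba (divr_gt0 e0 (ltr0Sn _ 1)).
have [d2 d20 H2] := conv_continuous hN VN ba e2.
exists (Num.min d1 d2); first by rewrite lt_min d10.
move=> b' ab'; rewrite lt_min => /andP[bd1 bd2].
have ba' : 0 <= b' - a by rewrite subr_ge0.
have sh : b' - a - (b - a) = b' - b by ring.
rewrite -(subrKC a b') -(subrKC a b) !rho_conv//.
have := H1 _ ba'; rewrite sh => /(_ bd1); have := H2 _ ba'; rewrite sh => /(_ bd2).
move: (conv _ _ (b' - a)) (conv _ _ (b - a)) => r2' r2 h2.
move: (conv _ _ (b' - a)) (conv _ _ (b - a)) => r1' r1 h1.
have -> : r1' + g a * r2' - (r1 + g a * r2) = (r1' - r1) + g a * (r2' - r2) by ring.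
apply: le_lt_trans (ler_normD _ _) _; rewrite normrM.
have h3 : `|g a| * `|r2' - r2| <= e / 2.
  apply: (@le_trans _ _ ((1 + `|g a|) * (e / (2 * (1 + `|g a|))))).
    by rewrite ler_pM ?ler_wpDl// ltW.
  by rewrite le_eqVlt; apply/orP; left; apply/eqP; field; rewrite gt_eqF.
by rewrite [ltRHS](splitr e) ltr_leD.
Qed.

End weighted.
End running_cost.

(** * Discounted tails of the slope *)

Section discounted_tail.
Context (R : realType) (g : R -> R) (g_nd : {homo g : x y / x <= y}).
Context (g_growth : forall e : R, 0 < e -> exists C, forall x, 0 <= x -> g x <= C * expR (e * x)).
Local Notation leb := (@lebesgue_measure R).
Implicit Types (a b c x y s t : R).

Let mg : measurable_fun setT g. Proof. exact: nondecreasing_measurable. Qed.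

Definition discounted_tail s a := \int[leb]_(z in `[a, +oo[) (expR (- (s * z)) * g z).

Lemma has_laplace_excess a s : 0 < s -> exists U, has_laplace (excess g a) s U.
Proof.
move=> s0; have s2 : 0 <= s / 2 < s by rewrite divr_ge0 ?(ltW s0)//= ltr_pdivrMr// ltr_pMr// ltr1n.
have s20 : 0 < s / 2 by rewrite divr_gt0.
have [C HC] := g_growth s20.
apply: (@has_laplace_le _ _ (s / 2) (C * expR (s / 2 * `|a|) + `|g a|)) => //.
  exact: causal_excess.
move=> x x0; rewrite /excess heavisideE x0 mulr1 mulrDl; apply: lerD.
  rewrite -mulrA -expRD -mulrDr addrC; apply: le_trans (HC _ _); first by apply: g_nd; rewrite lerD2r ler_norm.
  by rewrite addr_ge0.
apply: (@le_trans _ _ `|g a|); first by rewrite -normrN ler_norm.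
by rewrite -[leLHS]mulr1 ler_wpM2l// -[leLHS]expR0 ler_expR mulr_ge0// ltW.
Qed.

Let has_laplace_shifted a s U : 0 < s -> has_laplace (excess g a) s U ->
  has_laplace (fun y => g (y + a)) s (U + g a / s).
Proof.
move=> s0 HU; have := has_laplaceD HU (has_laplaceZ (g a) (has_laplace_heaviside s0)).
by apply: has_laplace_eq => x x0; rewrite /excess heavisideE x0 !mulr1 subrK.
Qed.

Let ray_shift a : [set x | `[a, +oo[%classic (a + x)] = `[0, +oo[%classic :> set R.
Proof. by apply/seteqP; split => x /=; rewrite !in_itv/= !andbT lerDl. Qed.

Let measurable_discounted s : measurable_fun setT (fun z => expR (- (s * z)) * g z).
Proof.
apply: measurable_funM mg; apply: measurableT_comp => //; apply: measurable_funN.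
exact: measurable_funM.
Qed.

Lemma discounted_integrable s a : 0 < s ->
  leb.-integrable (`[a, +oo[ : set R) (EFin \o (fun z => expR (- (s * z)) * g z)).
Proof.
move=> s0; have [U HU] := has_laplace_excess a s0.
have [/integrableP[_ iU] _] := has_laplace_shifted s0 HU.
have md := measurable_discounted s.
apply/integrableP; split; first by apply/measurable_EFinP; exact: measurable_funTS.
rewrite (integral_shift a)//; last first.
  by apply/measurable_EFinP; apply: measurableT_comp => //; exact: measurable_funTS.
rewrite ray_shift.
rewrite (_ : integral _ _ _ = ((expR (- (s * a)))%:E *
  \int[leb]_(x in `[0%R, +oo[) `|(EFin \o (fun x => expR (- (s * x)) * g (x + a))%R) x|)%E).
  by rewrite lte_mul_pinfty ?lee_fin ?expR_ge0.
rewrite -ge0_integralZl_EFin//.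
- apply: eq_integral => x _ /=; rewrite -EFinM; congr EFin.
  rewrite -[expR (- (s * a)) in RHS]ger0_norm ?expR_ge0// -normrM mulrA -expRD [a + x]addrC.
  by congr (`|expR _ * _|); ring.
- apply/measurable_EFinP; apply: measurableT_comp => //; apply: measurable_funTS.
  apply: measurable_funM; last by apply: measurableT_comp => //; exact: measurable_funD.
  by apply: measurableT_comp => //; apply: measurable_funN; exact: measurable_funM.
Qed.

Lemma discounted_tailE s a : 0 < s ->
  \int[leb]_(y in `[0, +oo[) (expR (- (s * y)) * g (y + a)) = expR (s * a) * discounted_tail s a.
Proof.
move=> s0; rewrite /discounted_tail -RintegralZl//; last exact: discounted_integrable.
rewrite [RHS]/Rintegral (integral_shift a)//; last first.
  apply/measurable_EFinP; apply: measurable_funTS; apply: measurable_funM => //.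
rewrite ray_shift /Rintegral; congr fine; apply: eq_integral => y _; congr EFin.
by rewrite mulrA -expRD [a + y]addrC; congr (expR _ * _); ring.
Qed.

Lemma has_laplace_excess_tail a s : 0 < s ->
  has_laplace (excess g a) s (expR (s * a) * discounted_tail s a - g a / s).
Proof.
move=> s0; have [U HU] := has_laplace_excess a s0.
have [_ HL] := has_laplace_shifted s0 HU.
rewrite -discounted_tailE//; suff -> : \int[leb]_(y in `[0, +oo[) (expR (- (s * y)) * g (y + a)) = U + g a / s.
  by rewrite addrK.
by rewrite /Rintegral -[RHS]/(fine (U + g a / s)%:E) -HL.
Qed.

Lemma discounted_tail_split s a b : 0 < s -> a <= b ->
  discounted_tail s a = \int[leb]_(z in `[a, b]) (expR (- (s * z)) * g z) + discounted_tail s b.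
Proof.
move=> s0 ab; have fi := discounted_integrable a s0.
have := @Rintegral_itvB R _ (BLeft a) (BInfty _ false) b fi.
rewrite !bnd_simp => /(_ ab isT) /eqP; rewrite subr_eq => /eqP H; rewrite [LHS]H.
rewrite addrC Rintegral_itv_obnd_cbnd//.
by apply: integrableS fi => //; apply: subset_itv; rewrite bnd_simp.
Qed.

Let seg_integrable s a b : 0 < s ->
  leb.-integrable (`[a, b] : set R) (EFin \o (fun z => expR (- (s * z)) * g z)).
Proof.
move=> s0; apply: integrableS (discounted_integrable a s0) => //.
by apply: subset_itv; rewrite bnd_simp.
Qed.

(** [g] is at least [g a] up to [b], and at least [g b] from there on. *)
Lemma discounted_tail_ge s a b : 0 < s -> a <= b ->
  g a * expR (- (s * a)) + (g b - g a) * expR (- (s * b)) <= s * discounted_tail s a.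
Proof.
move=> s0 ab; rewrite (discounted_tail_split s0 ab).
have h1 : g b * expR (- (s * b)) <= s * discounted_tail s b.
  have [_ L] := has_laplace_excess_tail b s0.
  have : 0 <= expR (s * b) * discounted_tail s b - g b / s.
    rewrite -lee_fin -L; apply: integral_ge0 => x _; rewrite lee_fin mulr_ge0 ?expR_ge0//.
    exact: causal_ge0 (causal_excess g_nd b).
  rewrite subr_ge0 ler_pdivrMr// => h.
  apply: le_trans (ler_wpM2r (expR_ge0 _) h) _.
  rewrite (_ : expR _ * _ * _ * _ = expR (s * b) * expR (- (s * b)) * (s * discounted_tail s b)); last by ring.
  by rewrite -expRD subrr expR0 mul1r.
have h2 : g a * (expR (- (s * a)) - expR (- (s * b))) <= s * \int[leb]_(z in `[a, b]) (expR (- (s * z)) * g z).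
  rewrite mulrC -ler_pdivrMl// mulrA [_^-1 * _]mulrC -Rintegral_expRN// mulrC.
  have ie : leb.-integrable (`[a, b] : set R) (EFin \o (fun z => expR (- (s * z)))).
    apply: (@bounded_integrable _ _ _ _ (expR (- (s * a)))).
      by apply: measurableT_comp => //; apply: measurable_funN; exact: measurable_funM.
    by move=> y /andP[ay _]; rewrite ger0_norm ?expR_ge0// ler_expR lerN2 ler_pM2l.
  rewrite -RintegralZl//; apply: le_Rintegral => //.
  - exact: (integrableZl _ (g a) ie).
  - exact: seg_integrable.
  - by move=> z; rewrite /= in_itv/= => /andP[az _]; rewrite mulrC ler_wpM2l ?expR_ge0// g_nd.
rewrite mulrDr; apply: le_trans (lerD h2 h1).
by rewrite le_eqVlt; apply/orP; left; apply/eqP; ring.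
Qed.

Lemma discounted_tail_gt0 s a x1 : 0 < s -> 0 <= g a -> 0 < g x1 -> 0 < discounted_tail s a.
Proof.
move=> s0 ga gx; pose b := Num.max a x1.
have ab : a <= b by rewrite le_max lexx.
have gb : 0 < g b by apply: lt_le_trans gx _; apply: g_nd; rewrite le_max lexx orbT.
rewrite -(pmulr_rgt0 _ s0); apply: lt_le_trans (discounted_tail_ge s0 ab).
have eb : expR (- (s * b)) <= expR (- (s * a)) by rewrite ler_expR lerN2 ler_pM2l.
have e0 : 0 < g b * expR (- (s * b)) by rewrite mulr_gt0 ?expR_gt0.
have h : g a * expR (- (s * b)) <= g a * expR (- (s * a)) by rewrite ler_wpM2l.
by rewrite mulrBl; move: e0 h; move: (g b * _) (g a * _) (g a * _) => y1 y2 y3; lra.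
Qed.

Let seg_le s a b : 0 < s -> a <= b -> g b < 0 ->
  \int[leb]_(z in `[a, b]) (expR (- (s * z)) * g z) <= expR (- (s * b)) * g b * (b - a).
Proof.
move=> s0 ab gb; apply: Rintegral_itv_le => //; first exact: seg_integrable.
move=> y /andP[ay yb]; apply: (@le_trans _ _ (expR (- (s * y)) * g b)).
  by rewrite ler_wpM2l ?expR_ge0// g_nd.
by rewrite ler_wnM2r ?(ltW gb)// ler_expR lerN2 ler_pM2l.
Qed.

Lemma discounted_tail_le s a b : 0 < s -> a <= b -> g b < 0 ->
  discounted_tail s a <= discounted_tail s b.
Proof.
move=> s0 ab gb; rewrite (discounted_tail_split s0 ab) gerDr; apply: le_trans (seg_le s0 ab gb) _.
by rewrite mulr_le0_ge0 ?subr_ge0// mulr_ge0_le0 ?expR_ge0// ltW.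
Qed.

Lemma discounted_tail_lipschitz s B D a b : 0 < s -> B <= a -> a <= b -> b <= D ->
  `|discounted_tail s b - discounted_tail s a| <= expR (- (s * B)) * (`|g B| + `|g D|) * (b - a).
Proof.
move=> s0 Ba ab bD; rewrite (discounted_tail_split s0 ab) opprD addrC subrK normrN.
have gb z : a <= z <= b -> `|expR (- (s * z)) * g z| <= expR (- (s * B)) * (`|g B| + `|g D|).
  move=> /andP[az zb]; rewrite normrM ger0_norm ?expR_ge0// ler_pM ?expR_ge0//.
    by rewrite ler_expR lerN2 ler_pM2l// (le_trans Ba).
  have h1 : g B <= g z by apply: g_nd; exact: le_trans az.
  have h2 : g z <= g D by apply: g_nd; exact: le_trans bD.
  have h3 := ler_norm (g D); have h4 := ler_norm (- g B); rewrite normrN in h4.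
  by rewrite ler_norml; apply/andP; split; have := normr_ge0 (g B); have := normr_ge0 (g D); lra.
rewrite ler_norml; apply/andP; split.
  rewrite -mulNr; apply: Rintegral_itv_ge => //; first exact: seg_integrable.
  by move=> z /gb; rewrite ler_norml => /andP[].
apply: Rintegral_itv_le => //; first exact: seg_integrable.
by move=> z /gb; rewrite ler_norml => /andP[].
Qed.

Lemma discounted_tail_lt0 s x0 c : 0 < s -> g x0 < 0 ->
  exists a, [/\ a <= x0, a <= c & discounted_tail s a < 0].
Proof.
move=> s0 gx; pose b := Num.min x0 c.
have bx : b <= x0 by rewrite ge_min lexx.
have bc : b <= c by rewrite ge_min lexx orbT.
have gb : g b < 0 by apply: le_lt_trans gx; exact: g_nd.
have k0 : 0 < expR (- (s * b)) * - g b by rewrite mulr_gt0 ?expR_gt0// oppr_gt0.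
pose a := b - (`|discounted_tail s b| + 1) / (expR (- (s * b)) * - g b).
have ab : a <= b by rewrite gerBl divr_ge0 ?addr_ge0// ltW.
exists a; split; [exact: le_trans bx|exact: le_trans bc|].
rewrite (discounted_tail_split s0 ab); have := seg_le s0 ab gb.
have -> : expR (- (s * b)) * g b * (b - a) = - (`|discounted_tail s b| + 1).
  rewrite /a subKr; have eb := expR_gt0 (- (s * b)).
  by field; rewrite (lt_eqF gb) (gt_eqF eb).
have := ler_norm (discounted_tail s b); move: (discounted_tail s b) (`|_|) => y1 y2.
by move: (Rintegral _ _ _) => y3; lra.
Qed.

End discounted_tail.

(** * Common zeros of two monotone families *)

Section common_root.
Context (R : realType).
Implicit Types (a b c d e x y : R).

Lemma lipschitz_root (f : R -> R) a b L : a <= b ->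
  (forall x y, a <= x -> x <= y -> y <= b -> `|f y - f x| <= L * (y - x)) ->
  f a <= 0 -> 0 <= f b -> exists c, [/\ a <= c, c <= b & f c = 0].
Proof.
move=> ab fL fa fb; pose S := [set x | a <= x <= b /\ f x <= 0].
have hS : has_sup S.
  by split; [exists a; rewrite /S/= lexx ab|exists b => x [/andP[]]].
have Sa : S a by rewrite /S/= lexx ab.
pose c := sup S.
have ac : a <= c by apply: sup_ubound => //; case: hS.
have cb : c <= b by apply: ge_sup; [exists a|move=> x [/andP[]]].
have k0 : 0 < `|L| + 1 by rewrite ltr_wpDl.
have small e y : y < e / (`|L| + 1) -> 0 <= y -> L * y < e.
  rewrite ltr_pdivlMr// => h y0.
  have := ler_wpM2r y0 (ler_norm L); move: h; rewrite mulrDr mulr1 [y * _]mulrC.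
  by move: (_ * y) => z; lra.
exists c; split => //; apply/eqP; rewrite eq_le; apply/andP; split; rewrite leNgt; apply/negP => fc.
  have [x Sx cx] := sup_adherent (divr_gt0 fc k0) hS.
  have xc : x <= c by apply: sup_ubound => //; case: hS.
  have [/andP[ax xb] fx] := Sx; have := fL _ _ ax xc cb.
  have := small (f c) (c - x); rewrite subr_ge0 xc => /(_ _ isT) h.
  have {}h : L * (c - x) < f c by apply: h; rewrite ltrBlDr -ltrBlDl.
  by move=> H; have := le_lt_trans (le_trans (ler_norm _) H) h; lra.
have cb' : c < b by rewrite lt_neqAle cb andbT; apply/eqP => E; move: fb; rewrite -E leNgt fc.
have nf0 : 0 < - f c by rewrite oppr_gt0.
have d0 := divr_gt0 nf0 k0.
pose y := Num.min b (c + - f c / (`|L| + 1) / 2).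
have cy : c < y by rewrite lt_min cb' ltrDl divr_gt0.
have yb : y <= b by rewrite ge_min lexx.
have yd : y <= c + - f c / (`|L| + 1) / 2 by rewrite ge_min lexx orbT.
have h : L * (y - c) < - f c by apply: small; [lra|rewrite subr_ge0 ltW].
have := le_lt_trans (le_trans (ler_norm _) (fL _ _ ac (ltW cy) yb)) h => fy.
have : y <= c.
  apply: sup_ubound; [by case: hS|split; first by rewrite yb (le_trans ac (ltW cy))].
  lra.
by rewrite leNgt cy.
Qed.

Context (F1 F2 : R -> R -> R) (D : set R).
Context (D_down : forall a a', a <= a' -> D a' -> D a).
Context (F1_lt : forall a a' b, a < a' -> a' <= b -> D a' -> F1 a b < F1 a' b).
Context (F2_le : forall a a' b, a <= a' -> a' <= b -> D a' -> F2 a b <= F2 a' b).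
Context (F1_lip : forall B b, exists2 L, 0 <= L & forall a a', B <= a -> a <= a' -> a' <= b ->
  D a' -> F1 a' b - F1 a b <= L * (a' - a)).
Context (F2_lip : forall B b, exists2 L, 0 <= L & forall a a', B <= a -> a <= a' -> a' <= b ->
  D a' -> F2 a' b - F2 a b <= L * (a' - a)).
Context (F1_cont : forall a b e, a <= b -> 0 < e -> exists2 d, 0 < d &
  forall b', a <= b' -> `|b' - b| < d -> `|F1 a b' - F1 a b| < e).
Context (F2_cont : forall a b e, a <= b -> 0 < e -> exists2 d, 0 < d &
  forall b', a <= b' -> `|b' - b| < d -> `|F2 a b' - F2 a b| < e).
Context (F1_low : forall b, exists a, [/\ D a, a <= b & F1 a b <= 0]).
Context (F1_high : forall b, exists a, [/\ D a, a <= b & 0 < F1 a b]).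
Context (F1_diag : forall b, 0 < F1 b b).

Let root a b := [/\ D a, a <= b & F1 a b = 0].

Let root_ex b : exists a, root a b.
Proof.
have [a [Da ab fa]] := F1_low b; have [a' [Da' ab' fa']] := F1_high b.
have aa : a <= a' by rewrite leNgt; apply/negP => aa; have := F1_lt aa ab Da; lra.
have [L L0 HL] := F1_lip a b.
have [//|x y ax xy ya|//||c [ac ca fc]] := @lipschitz_root (F1^~ b) a a' L.
- rewrite ger0_norm; first by apply: HL => //; [exact: le_trans ab'|exact: D_down Da'].
  move: xy; rewrite le_eqVlt => /predU1P[->|xy]; first by rewrite subrr.
  by rewrite subr_ge0 ltW// F1_lt// ?(le_trans ya)//; exact: D_down Da'.
- exact: ltW.
- by exists c; split=> //; [exact: D_down Da'|exact: le_trans ab'].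
Qed.

Let root_ltP a b c : root a b -> D c -> c <= b -> F1 c b <= 0 -> c <= a.
Proof.
by move=> [Da ab f0] Dc cb fc; rewrite leNgt; apply/negP => ac; have := F1_lt ac cb Dc; lra.
Qed.

Let root_gtP a b c : root a b -> c <= b -> 0 <= F1 c b -> a <= c.
Proof.
by move=> [Da ab f0] cb fc; rewrite leNgt; apply/negP => ca; have := F1_lt ca ab Da; lra.
Qed.

Let small_step L e k : 0 <= L -> 0 < e -> 0 < k -> exists x, [/\ 0 < x, x < k & L * x < e].
Proof.
move=> L0 e0 k0; have L1 : 0 < L + 1 by rewrite ltr_wpDl.
exists (Num.min (k / 2) (e / (L + 1))); split.
- by rewrite lt_min !divr_gt0.
- by rewrite gt_min ltr_pdivrMr// ltr_pMr// ltr1n.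
- apply: (@le_lt_trans _ _ (L * (e / (L + 1)))); first by rewrite ler_wpM2l// ge_min lexx orbT.
  by rewrite mulrA ltr_pdivrMr// [e * _]mulrC ltr_pM2r// ltrDl.
Qed.

Let root_neg_open a b : root a b -> F2 a b < 0 -> exists2 d, 0 < d &
  forall a' b', `|b' - b| < d -> root a' b' -> F2 a' b' < 0.
Proof.
move=> rab f2; have [Da ab f1] := rab.
have [h [Dh hb fh]] := F1_high b.
have ah : a < h.
  rewrite ltNge; apply/negP; rewrite le_eqVlt => /predU1P[E|ha].
    by move: fh; rewrite E f1 ltxx.
  by have := F1_lt ha ab Da; lra.
have [L L0 HL] := F2_lip a b.
have n2 : 0 < - F2 a b by rewrite oppr_gt0.
have ha0 : 0 < h - a by rewrite subr_gt0.
have [x [x0 xh Lx]] := small_step L0 n2 ha0.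
pose c := a + x.
have ac : a < c by rewrite ltrDl.
have ch : c < h by rewrite /c addrC -ltrBrDr.
have Dc : D c by exact: D_down (ltW ch) Dh.
have cb := lt_le_trans ch hb.
have f1c : 0 < F1 c b by rewrite -f1; apply: F1_lt => //; exact: ltW.
have f2c : F2 c b < 0.
  have := HL _ _ (lexx a) (ltW ac) (ltW cb) Dc; have -> : c - a = x by rewrite /c addrC addKr.
  lra.
have n2c : 0 < - F2 c b by rewrite oppr_gt0.
have [d1 d10 H1] := F1_cont (ltW cb) f1c; have [d2 d20 H2] := F2_cont (ltW cb) n2c.
exists (Num.min (b - c) (Num.min d1 d2)); first by rewrite !lt_min subr_gt0 cb d10.
move=> a' b'; rewrite !lt_min => /and3P[bc bd1 bd2] r'.
have cb' : c <= b' by move: bc; rewrite ltr_norml => /andP[]; lra.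
have := H1 _ cb' bd1; rewrite ltr_norml => /andP[g1 _].
have := H2 _ cb' bd2; rewrite ltr_norml => /andP[_ g2].
have ac' : a' <= c by apply: root_gtP r' cb' _; lra.
apply: (@le_lt_trans _ _ (F2 c b')); last lra.
exact: F2_le.
Qed.

Let root_pos_open a b : root a b -> 0 < F2 a b -> exists2 d, 0 < d &
  forall a' b', `|b' - b| < d -> root a' b' -> 0 < F2 a' b'.
Proof.
move=> rab f2; have [Da ab f1] := rab.
have [L L0 HL] := F2_lip (a - 1) b.
have [x [x0 x1 Lx]] := small_step L0 f2 ltr01.
pose c := a - x.
have ca : c < a by rewrite ltrBlDr ltrDl.
have Dc : D c by exact: D_down (ltW ca) Da.
have cb := lt_le_trans ca ab.
have f1c : F1 c b < 0 by rewrite -f1; exact: F1_lt.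
have f2c : 0 < F2 c b.
  have c1 : a - 1 <= c by rewrite lerD2l lerN2 ltW.
  have := HL _ _ c1 (ltW ca) ab Da; have -> : a - c = x by rewrite /c subKr.
  lra.
have n1c : 0 < - F1 c b by rewrite oppr_gt0.
have [d1 d10 H1] := F1_cont (ltW cb) n1c; have [d2 d20 H2] := F2_cont (ltW cb) f2c.
exists (Num.min (b - c) (Num.min d1 d2)); first by rewrite !lt_min subr_gt0 cb d10.
move=> a' b'; rewrite !lt_min => /and3P[bc bd1 bd2] r'.
have cb' : c <= b' by move: bc; rewrite ltr_norml => /andP[]; lra.
have := H1 _ cb' bd1; rewrite ltr_norml => /andP[_ g1].
have := H2 _ cb' bd2; rewrite ltr_norml => /andP[g2 _].
have ac' : c <= a' by apply: root_ltP r' Dc cb' _; lra.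
apply: (@lt_le_trans _ _ (F2 c b')); first lra.
by case: r' => Da' ab' _; exact: F2_le.
Qed.

(** Let [alpha b] be the root of [F1 ^~ b].  The set of [b] with [F2 (alpha b) b < 0] is
    open, and so is the one with [F2 (alpha b) b > 0]: by monotonicity, membership is
    witnessed by a point [c] slightly to the right, respectively left, of [alpha b],
    where [F1] and [F2] have strict signs that persist for nearby [b].  As [b0] is in
    the first set and [b1] is not, the supremum of the first set in [[b0, b1]] is in
    neither. *)
Lemma common_root b0 b1 a1 : b0 <= b1 -> (forall a, D a -> a <= b0 -> F2 a b0 < 0) ->
  D a1 -> a1 <= b1 -> F1 a1 b1 <= 0 -> 0 <= F2 a1 b1 ->
  exists a b, [/\ a < b, F1 a b = 0 & F2 a b = 0].
Proof.
move=> b01 neg Da1 ab1 f1 f2.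
pose S := [set b | b0 <= b <= b1 /\ exists2 a, root a b & F2 a b < 0].
have Sb0 : S b0.
  split; first by rewrite lexx.
  by have [a ra] := root_ex b0; exists a => //; case: ra => Da ab _; exact: neg.
have hS : has_sup S by split; [exists b0|exists b1 => x [/andP[]]].
pose b := sup S.
have bb0 : b0 <= b by apply: sup_ubound => //; case: hS.
have bb1 : b <= b1 by apply: ge_sup; [exists b0|move=> x [/andP[]]].
have [a ra] := root_ex b.
have ab : a < b.
  by have [_ ab f] := ra; rewrite lt_neqAle ab andbT; apply/eqP => E; have := F1_diag b; rewrite -{1}E f ltxx.
exists a, b; split=> //; first by case: ra.
apply/eqP; rewrite eq_le; apply/andP; split; rewrite leNgt; apply/negP => fab.
  have [d d0 Hd] := root_pos_open ra fab.
  have [b' Sb' bd] := sup_adherent d0 hS.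
  have b'b : b' <= b by apply: sup_ubound => //; case: hS.
  have [_ [a' ra' fa']] := Sb'.
  have : 0 < F2 a' b' by apply: Hd ra'; rewrite distrC ger0_norm ?subr_ge0// ltrBlDr -ltrBlDl.
  lra.
have [d d0 Hd] := root_neg_open ra fab.
have bb1' : b < b1.
  rewrite lt_neqAle bb1 andbT; apply/eqP => E; rewrite E in ra fab.
  have aa := root_ltP ra Da1 ab1 f1; case: ra => Da ab' _.
  by have := F2_le aa ab' Da; lra.
pose b' := Num.min b1 (b + d / 2).
have bb' : b < b' by rewrite lt_min bb1' ltrDl divr_gt0.
have b'd : b' <= b + d / 2 by rewrite ge_min lexx orbT.
have : b' <= b.
  apply: sup_ubound; [by case: hS|split].
    by rewrite ge_min lexx (le_trans bb0 (ltW bb')).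
  have [a' ra'] := root_ex b'; exists a' => //; apply: Hd ra'.
  by rewrite ger0_norm ?subr_ge0 ?(ltW bb')//; lra.
by rewrite leNgt bb'.
Qed.

End common_root.

(** * Existence of the barriers *)

Lemma continuous_eps_delta (R : realType) (h : R -> R) (b e : R) : {for b, continuous h} -> 0 < e ->
  exists2 d, 0 < d & forall b', `|b' - b| < d -> `|h b' - h b| < e.
Proof.
move=> /cvgrPdist_lt hb e0; have [d /= d0 H] := hb e e0.
by exists d => // b' bb; rewrite distrC; apply: H; rewrite /ball_/= distrC.
Qed.

Section barriers.
Context (R : realType) (psi : R -> R) (q lam phi Phi : R).
Context (q0 : 0 < q) (lam0 : 0 < lam) (phi0 : 0 < phi) (phiPhi : phi < Phi).
Context (psi_phi : psi phi = q) (psi_Phi : psi Phi = q + lam).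
Context (psi_lt : forall t, 0 <= t -> t < Phi -> psi t < q + lam).
Context (psi_gt : forall t, Phi < t -> q + lam < psi t).
Context (psi_series : forall t0, 0 < t0 ->
  exists2 a, pseries_on t0 a (fun h => psi (t0 - h)) & forall k, (0 < k)%N -> 0 <= a k.+1).
Context (psi_near0 : forall e eta : R, 0 < e -> 0 < eta -> exists2 t, 0 < t < eta & - e < psi t).
Context (W : R -> R) (WN : causal_nondecreasing W) (W_gt0 : forall x, 0 < x -> 0 < W x).
Context (LW : forall t, Phi < t -> has_laplace W t (psi t - (q + lam))^-1).
Context (g : R -> R) (g_nd : {homo g : x y / x <= y}).
Context (g_growth : forall e : R, 0 < e -> exists C, forall x, 0 <= x -> g x <= C * expR (e * x)).
Context (dl x0 x1 : R) (dl0 : 0 < dl) (gx0 : g x0 < 0) (gx1 : (q + lam) * dl < g x1).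
Local Notation leb := (@lebesgue_measure R).
Implicit Types (t x y a b : R).

Let E := causal_exp phi.
Let V := conv W E.
Let tail s a := discounted_tail g s a.

Let EN : causal_nondecreasing E. Proof. by apply: causal_nondecreasing_exp; exact: ltW. Qed.
Let VN : causal_nondecreasing V. Proof. exact: causal_conv. Qed.
Let stepN : causal_nondecreasing (@heaviside R). Proof. exact: causal_nondecreasing_exp. Qed.
Let Phi0 : 0 < Phi. Proof. exact: lt_trans phiPhi. Qed.

Let gx1_gt0 : 0 < g x1.
Proof. by apply: lt_trans gx1; rewrite mulr_gt0// addr_gt0. Qed.

(** This is the function Gamma with an arbitrary nondecreasing slope [g], the first
    integral being shifted to start at [a]. *)
Definition Gamma_slope a b := expR (phi * a) * discounted_tail g phi a
  + lam * \int[leb]_(y in `[0, b - a]) (expR (- (phi * y)) * rho W a (y + a) g)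
  - lam * dl / phi * expR (- (phi * (b - a))).

Let F1 a b := rho W a b g + dl.
Let F2 a b := expR (phi * b) * tail phi a + lam * rho V a b g - lam * dl / phi.

Let U a t := expR (t * a) * tail t a - g a / t.

Let UE a t : U a t - (- g a) / t = expR (t * a) * tail t a.
Proof. by rewrite /U mulNr opprK subrK. Qed.

Let rho_convN a x : 0 <= x ->
  conv (excess g a) W x - (- g a) * conv (@heaviside R) W x = rho W a (a + x) g.
Proof. by move=> xp; rewrite rho_conv// mulNr opprK. Qed.

(** Associativity of convolution moves the discounting from [rho] to the kernel,
    which becomes [V]. *)
Let value_barrier a x : 0 <= x ->
  (U a phi - (- g a) / phi) * E x +
   lam * (conv (conv (excess g a) W) E x - (- g a) * conv (conv (@heaviside R) W) E x) -
   lam * dl / phi * heaviside x = F2 a (a + x).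
Proof.
move=> xp; have eN := causal_excess g_nd a.
rewrite UE !convA// -/V heavisideE xp mulr1 /F2 (rho_conv g_nd VN)// mulNr opprK.
rewrite /E /causal_exp xp (mulrDr phi) expRD; move: (conv _ _ _) (conv _ _ _) => y1 y2.
by rewrite -[expR _ * _ * expR _]mulrA [tail _ _ * _]mulrC mulrA.
Qed.

Let Gamma_barrier a b : a <= b -> F2 a b = expR (phi * (b - a)) * Gamma_slope a b.
Proof.
move=> ab; have xp : 0 <= b - a by rewrite subr_ge0.
rewrite -{1}(subrKC a b) -value_barrier//.
rewrite (value_functionE lam phi0 WN (U a) (causal_excess g_nd a) (- g a) dl xp) UE /Gamma_slope.
congr (_ * (_ + _ * _ - _)); apply: eq_Rintegral => y /set_mem; rewrite /= in_itv/= => /andP[y0 _].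
by rewrite rho_convN// addrC.
Qed.

Let F1_lip B b : exists2 L, 0 <= L & forall a a', B <= a -> a <= a' -> a' <= b ->
  g a' < 0 -> F1 a' b - F1 a b <= L * (a' - a).
Proof.
exists (`|g B| * W (b - B)); first by apply: mulr_ge0 => //; exact: causal_ge0.
move=> a a' Ba aa ab ga; rewrite /F1 opprD addrACA subrr addr0.
apply: le_trans (rho_lipschitz g_nd WN Ba aa ab ga) _; rewrite ler_wpM2r ?subr_ge0//.
by rewrite ler_wpM2r ?causal_ge0// -normrN ler_norm.
Qed.

Let F2_lip B b : exists2 L, 0 <= L & forall a a', B <= a -> a <= a' -> a' <= b ->
  g a' < 0 -> F2 a' b - F2 a b <= L * (a' - a).
Proof.
exists (expR (phi * b) * (expR (- (phi * B)) * (`|g B| + `|g b|)) + lam * (`|g B| * V (b - B))).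
  have V0 := causal_ge0 (b - B) VN.
  by rewrite addr_ge0 ?mulr_ge0 ?expR_ge0 ?addr_ge0// ltW.
move=> a a' Ba aa ab ga; rewrite /F2 mulrDl.
have h1 := le_trans (ler_norm _) (discounted_tail_lipschitz g_nd g_growth phi0 Ba aa ab).
have {}h1 := ler_wpM2l (expR_ge0 (phi * b)) h1.
have h2 := rho_lipschitz g_nd VN Ba aa ab ga.
have h3 : - g B * V (b - B) * (a' - a) <= `|g B| * V (b - B) * (a' - a).
  rewrite ler_wpM2r ?subr_ge0// ler_wpM2r ?causal_ge0// -normrN; exact: ler_norm.
have {}h2 := ler_wpM2l (ltW lam0) (le_trans h2 h3).
have := lerD h1 h2; rewrite /tail !mulrA; apply: le_trans.
by rewrite le_eqVlt; apply/orP; left; apply/eqP; ring.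
Qed.

Let F1_cont a b e : a <= b -> 0 < e -> exists2 d, 0 < d &
  forall b', a <= b' -> `|b' - b| < d -> `|F1 a b' - F1 a b| < e.
Proof.
move=> ab e0; have [d d0 H] := rho_continuous g_nd WN ab e0.
by exists d => // b' ab' bb; rewrite /F1 opprD addrACA subrr addr0; exact: H.
Qed.

Let F2_cont a b e : a <= b -> 0 < e -> exists2 d, 0 < d &
  forall b', a <= b' -> `|b' - b| < d -> `|F2 a b' - F2 a b| < e.
Proof.
move=> ab e0; have e2 : 0 < e / 2 by rewrite divr_gt0.
have e3 : 0 < e / 2 / lam by rewrite divr_gt0.
have [d d0 H] := rho_continuous g_nd VN ab e3.
have hc : {for b, continuous (fun b => expR (phi * b) * tail phi a)}.
  apply: (@continuousM _ _ (fun b => expR (phi * b)) (fun=> tail phi a)); last exact: cvg_cst.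
  apply: continuous_comp; last exact: continuous_expR.
  by apply: (@continuousM _ _ (fun=> phi) id); [exact: cvg_cst|exact: cvg_id].
have [d' d'0 H'] := continuous_eps_delta hc e2.
exists (Num.min d d'); first by rewrite lt_min d0.
move=> b' ab'; rewrite lt_min => /andP[bd bd']; rewrite /F2.
have := H _ ab' bd; have /= := H' _ bd'.
move: (expR (phi * b') * tail phi a) (expR (phi * b) * tail phi a) (rho V a b' g) (rho V a b g) => y1 y2 y3 y4 h1 h2.
have -> : y1 + lam * y3 - lam * dl / phi - (y2 + lam * y4 - lam * dl / phi) =
  (y1 - y2) + lam * (y3 - y4) by ring.
apply: le_lt_trans (ler_normD _ _) _; rewrite [ltRHS](splitr e) ltrD//.
by rewrite normrM gtr0_norm// mulrC -ltr_pdivlMr.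
Qed.

(** The first argument is the root of the tail discounted at rate [Phi], for which
    the transform of the value function has no pole at [Phi]. *)
Let crossing : exists a b, [/\ g a < 0, a <= b, F1 a b <= 0 & 0 <= F2 a b].
Proof.
have [a0 [a0x _ ta0]] := discounted_tail_lt0 g_nd g_growth 0 Phi0 gx0.
have x01 : x0 <= x1.
  by rewrite leNgt; apply/negP => /ltW/g_nd; have := lt_trans gx0 gx1_gt0; rewrite leNgt => ->.
have tx1 : 0 <= tail Phi x1.
  by apply: ltW; apply: discounted_tail_gt0 gx1_gt0 => //; exact: ltW.
have lip x y (ax : a0 <= x) (xy : x <= y) (yx : y <= x1) :=
  discounted_tail_lipschitz g_nd g_growth Phi0 ax xy yx.
have [a1 [_ a1x ta1]] := lipschitz_root (le_trans a0x x01) lip (ltW ta0) tx1.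
have ga1 : g a1 < 0.
  rewrite ltNge; apply/negP => ga; have := discounted_tail_gt0 g_nd g_growth Phi0 ga gx1_gt0.
  by rewrite ta1 ltxx.
pose C := (x1 - a1) * (g x1 - g a1).
have KG t : 0 < t -> g x1 - t * C <= t * (U a1 t - (- g a1) / t).
  move=> t0; rewrite UE [leRHS]mulrCA.
  have := ler_wpM2l (expR_ge0 (t * a1)) (discounted_tail_ge g_nd g_growth t0 a1x).
  apply: le_trans.
  have -> : expR (t * a1) * (g a1 * expR (- (t * a1)) + (g x1 - g a1) * expR (- (t * x1))) =
      g a1 + (g x1 - g a1) * expR (- (t * (x1 - a1))).
    rewrite (_ : - (t * (x1 - a1)) = t * a1 + - (t * x1)); last by ring.
    rewrite expRD !expRN; have := expR_gt0 (t * a1); have := expR_gt0 (t * x1).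
    by move: (expR _) (expR _) => e1 e2 e10 e20; field; rewrite !gt_eqF.
  have h0 : 0 <= g x1 - g a1 by rewrite subr_ge0 ltW// (lt_trans ga1).
  have := ler_wpM2l h0 (expR_ge1Dx (- (t * (x1 - a1)))).
  rewrite /C; move: (expR _) => y h; rewrite -subr_ge0.
  have -> : g a1 + (g x1 - g a1) * y - (g x1 - t * ((x1 - a1) * (g x1 - g a1))) =
    (g x1 - g a1) * y - (g x1 - g a1) * (1 + - (t * (x1 - a1))) by ring.
  by rewrite subr_ge0.
have ca : 0 <= - g a1 by rewrite oppr_ge0 ltW.
have LU t : 0 < t -> has_laplace (excess g a1) t (U a1 t).
  by move=> t0; exact: has_laplace_excess_tail.
have GPhi : U a1 Phi - (- g a1) / Phi = 0 by rewrite UE /tail ta1 mulr0.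
have [x xp [h1 h2]] := value_function_crossing q0 lam0 phi0 phiPhi psi_phi psi_Phi psi_lt psi_gt
  psi_series psi_near0 WN LW (causal_excess g_nd a1) ca LU dl0 KG gx1 GPhi.
exists a1, (a1 + x); split=> //.
- by rewrite lerDl ltW.
- by move: h1; rewrite rho_convN// ltW.
- by move: h2; rewrite value_barrier// ltW.
Qed.

Lemma barriers_exist : exists a b, [/\ a < b, rho W a b g + dl = 0 & Gamma_slope a b = 0].
Proof.
have [a1 [b1 [ga1 ab1 f1 f2]]] := crossing.
have [b0 [b0x b0a tb0]] := discounted_tail_lt0 g_nd g_growth a1 phi0 gx0.
have F2_le a a' b : a <= a' -> a' <= b -> g a' < 0 -> F2 a b <= F2 a' b.
  move=> aa ab ga; rewrite /F2 lerD2r lerD//.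
    by rewrite ler_wpM2l ?expR_ge0//; exact: discounted_tail_le.
  by rewrite ler_wpM2l ?(ltW lam0)//; exact: rho_le.
have neg a : g a < 0 -> a <= b0 -> F2 a b0 < 0.
  move=> ga ab; have gb0 : g b0 < 0 by apply: le_lt_trans gx0; exact: g_nd.
  apply: le_lt_trans (F2_le _ _ _ ab (lexx b0) gb0) _.
  rewrite /F2 rho_diag mulr0 addr0 subr_lt0; apply: (@lt_trans _ _ 0).
    by rewrite pmulr_rlt0 ?expR_gt0.
  by rewrite divr_gt0// mulr_gt0.
have [|||||a [b [ab fab gab]]] := @common_root R F1 F2 [set a | g a < 0] _ _ F2_le F1_lip F2_lip
  F1_cont F2_cont _ _ _ b0 b1 a1 (le_trans b0a ab1) neg ga1 ab1 f1 f2.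
- by move=> a a' aa; apply: le_lt_trans; exact: g_nd.
- by move=> a a' b aa ab ga; rewrite /F1 ltrD2r; exact: rho_lt.
- move=> b; have [a [ax ab ra]] := rho_unbounded g_nd WN b dl W_gt0 gx0.
  exists a; split; [|exact: ltW|by rewrite /F1 -lerBrDr sub0r ltW].
  by apply: le_lt_trans gx0; apply: g_nd; exact: ltW.
- move=> b; have [a [ga ab ra]] := rho_ge g_nd WN b gx0 dl0.
  by exists a; split=> //; rewrite /F1 -ltrBlDr sub0r.
- by move=> b; rewrite /F1 rho_diag add0r.
exists a, b; split=> //; apply/eqP; move/eqP: gab.
by rewrite Gamma_barrier ?(ltW ab)// mulf_eq0 gt_eqF ?expR_gt0.
Qed.

End barriers.

(** * The Levy process and the cost function *)

Section exponent.
Context (d : measure_display) (T : measurableType d) (R : realType).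
Context (P : probability T R) (X : R -> T -> R) (psi : R -> R).
Context (HX : levy_process P X) (Hpsi : laplace_exponent P X psi).

Let mX1 : measurable_fun setT (X 1). Proof. by case: HX => H _ _ _ _; exact: H. Qed.

Let psiE s : 0 <= s -> (\int[P]_w (expR (s * X 1 w))%:E = (expR (psi s))%:E)%E.
Proof. by move=> s0; rewrite -Hpsi// unlock. Qed.

Lemma laplace_exponent_unbounded : ~ subordinator P (fun t w => - X t w) ->
  forall K, exists2 s, 0 <= s & K < psi s.
Proof.
move=> nsub K; apply/not_exists2P => H; apply: nsub.
apply: levy_nonpos_subordinator => //; apply: (@cumulant_bounded _ _ _ _ _ mX1 _ psiE K) => s s0.
by rewrite leNgt; apply/negP; case: (H s).
Qed.

Lemma laplace_exponent_near0 e eta : 0 < e -> 0 < eta -> exists2 t, 0 < t < eta & - e < psi t.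
Proof.
move=> e0 eta0; have H := cumulant_cvg0 mX1 psiE.
have e1 : expR (- e) < 1 by rewrite -[ltRHS]expR0 ltr_expR oppr_lt0.
near \oo => n; exists n.+1%:R^-1.
  rewrite invr_gt0 ltr0n/=; near: n; exact: near_infty_natSinv_lt (PosNum eta0).
rewrite -ltr_expR; near: n; exact: cvgr_gt H _ e1.
Unshelve. all: by end_near. Qed.

Lemma laplace_exponent_Phi p : ~ subordinator P (fun t w => - X t w) -> 0 < p ->
  [/\ 0 < Phi psi p, psi (Phi psi p) = p,
  (forall s, Phi psi p < s -> p < psi s) & (forall s, 0 <= s -> s < Phi psi p -> psi s < p)].
Proof.
move=> nsub p0; apply: Phi_spec => //; first exact: cumulant0 psiE.
  by move=> s u t s0 u0 t01; have := cumulant_convex mX1 psiE s0 u0 t01.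
by move=> K; have := laplace_exponent_unbounded nsub K.
Qed.

End exponent.

Section cost_derivative.
Context (R : realType) (q lambda Kc Kp : R) (f : R -> R).
Context (fC : convex_ineq f).

Let ftE : ftilde q lambda Kc Kp f = fun x => (fun x => f x + q * Kc * x) x + lambda * (Kc - Kp) * x.
Proof. by []. Qed.

Lemma rderiv_ftilde x :
  rderiv (ftilde q lambda Kc Kp f) x = rderiv f x + q * Kc + lambda * (Kc - Kp).
Proof. by rewrite ftE rderiv_affine ?rderiv_affine//; exact: convex_ineq_affine. Qed.

Lemma rderiv_ftilde_nondecreasing : {homo rderiv (ftilde q lambda Kc Kp f) : x y / x <= y}.
Proof. by move=> x y xy; rewrite !rderiv_ftilde !lerD2r rderiv_nondecreasing. Qed.

Lemma rderiv_ftilde_growth : polynomial_growth f -> forall e : R, 0 < e ->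
  exists C, forall x, 0 <= x -> rderiv (ftilde q lambda Kc Kp f) x <= C * expR (e * x).
Proof.
move=> fG e e0; have [C HC] := rderiv_growth fC fG e0.
exists (C + `|q * Kc + lambda * (Kc - Kp)|) => x x0; rewrite rderiv_ftilde -addrA mulrDl lerD ?HC//.
apply: le_trans (ler_norm _) _; rewrite -[leLHS]mulr1 ler_wpM2l//.
by rewrite -[leLHS]expR0 ler_expR mulr_ge0// ltW.
Qed.

(** Otherwise the infimum would be taken over the whole line. *)
Lemma abar_fin_num_lt0 : abar q lambda Kc Kp f \is a fin_num ->
  exists x, rderiv (ftilde q lambda Kc Kp f) x < 0.
Proof.
move=> /fineK afin; apply/not_existsP => H.
have : (abar q lambda Kc Kp f <= (fine (abar q lambda Kc Kp f) - 1)%:E)%E.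
  apply: ereal_inf_lbound; exists (fine (abar q lambda Kc Kp f) - 1) => //=.
  by rewrite leNgt; apply/negP; exact: H.
by rewrite -{1}afin lee_fin lerBrDr gerDl ler10.
Qed.

(** Otherwise the infimum would be taken over the empty set.  The slope of [ftilde]
    exceeds [f' + q Kp] by [(q + lambda) (Kc - Kp)]. *)
Lemma abarbar_fin_num_gt : abarbar q Kp f \is a fin_num ->
  exists x, (q + lambda) * (Kc - Kp) < rderiv (ftilde q lambda Kc Kp f) x.
Proof.
move=> afin; apply/not_existsP => H; move: afin; rewrite /abarbar.
rewrite (_ : [set a | _] = set0) ?image_set0 ?ereal_inf0//.
apply/seteqP; split => // x /= hx; apply: (H x); rewrite rderiv_ftilde.
rewrite -subr_gt0; congr (0 < _): hx; ring.
Qed.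

End cost_derivative.

Unset Implicit Arguments.

Theorem theorem5p6 (R : realType) (d : measure_display) (T : measurableType d)
    (P : probability T R) (X : R -> T -> R)
    (gammaX sigma : R) (mu : {measure set (measurableTypeR R) -> \bar R})
    (q lambda Kc Kp : R) (f : R -> R) (W : R -> R)
    (psi := levy_khintchine gammaX sigma mu)
    (HX : spectrally_negative P X)
    (Hsigma : 0 <= sigma)
    (Hmu : levy_measure mu)
    (Hpsi : laplace_exponent P X psi)
    (Hsub : ~ subordinator P (fun t w => - X t w))
    (Htheta : exists2 theta : R, 0 < theta &
       (\int[mu]_(y in `]-oo, (-1)%R]) (expR (theta * `|y|))%:E < +oo)%E)
    (Hq : 0 < q) (Hlambda : 0 < lambda) (HK : Kp < Kc)
    (Hconvex : convex_function ([set: R] : set R) f)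
    (HC1 : piecewise_C1 f)
    (Hgrowth : polynomial_growth f)
    (Habar : abar q lambda Kc Kp f \is a fin_num)
    (Habarbar : abarbar q Kp f \is a fin_num)
    (HW : scale_function psi (q + lambda) W) :
  exists a b : R, a < b /\
    Gamma_fun psi W q lambda Kc Kp f a b = 0 /\
    gamma_fun W q lambda Kc Kp f a b = 0.
Proof.
have [LX _] := HX; have fC := convex_functionP Hconvex.
have r0 : 0 < q + lambda by exact: addr_gt0.
have [phi0 psi_phi psi_gtq _] := laplace_exponent_Phi LX Hpsi Hsub Hq.
have [Phi0 psi_Phi psi_gt psi_lt] := laplace_exponent_Phi LX Hpsi Hsub r0.
have phiPhi : Phi psi q < Phi psi (q + lambda).
  rewrite ltNge le_eqVlt; apply/negP => /predU1P[E|/psi_gt].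
    by move: psi_Phi; rewrite E psi_phi => /eqP; rewrite -subr_eq0 opprD addrA subrr sub0r oppr_eq0 gt_eqF.
  by rewrite psi_phi gtrDl ltNge (ltW Hlambda).
have [x0 gx0] := abar_fin_num_lt0 Habar.
have [x1 gx1] := abarbar_fin_num_gt lambda Kc fC Habarbar.
have dl0 : 0 < Kc - Kp by rewrite subr_gt0.
have g_growth := rderiv_ftilde_growth q lambda Kc Kp fC Hgrowth.
have g_nd := @rderiv_ftilde_nondecreasing _ q lambda Kc Kp _ fC.
have [a [b [ab F1 F2]]] := barriers_exist Hq Hlambda phi0 phiPhi psi_phi psi_Phi psi_lt psi_gt
  (levy_khintchine_pseries gammaX sigma Hmu) (laplace_exponent_near0 LX Hpsi)
  (causal_scale_function HW psi_gt Phi0) (scale_function_gt0 HW psi_gt Phi0)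
  (has_laplace_scale_function HW) g_nd g_growth dl0 gx0 gx1.
exists a, b; split=> //; split.
  rewrite -F2 /Gamma_fun /Gamma_slope discounted_tailE//.
  by rewrite -[Kp - Kc]opprB mulrN; congr (_ - _); rewrite mulrAC [_ / _ * _]mulrAC.
by rewrite /gamma_fun -addrA -[Kp - Kc]opprB -opprD F1 oppr0.
Qed.
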